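(* Let $b \in \mathbb{C}$, $z_0 \in \mathbb{D}\setminus\{0\}$, and let $\Omega \subsetneq \mathbb{C}$ be a domain which is starlike with respect to $b$. Let $P$ be a conformal map of $\mathbb{D}$ onto $\Omega$ with $P(0)=b$. Then the region of variability $$V_\Omega^{-1}(z_0,0) = \left\{ \int_0^{z_0} \frac{g(\zeta)-b}{\zeta}\, d\zeta : g \in \mathcal{F}_\Omega,\ g(0)=b \right\}$$ is a convex closed Jordan domain, and coincides with the set $K(\overline{\mathbb{D}}(0,|z_0|))$, where $K(z)=\int_0^z \zeta^{-1}(P(\zeta)-b)\, d\zeta$ for $z\in\mathbb{D}$. Furthermore, for $|\varepsilon|=1$ and $g\in\mathcal{F}_\Omega$ with $g(0)=b$, the relation $$\int_0^{z_0}\zeta^{-1}(g(\zeta)-b)\, d\zeta = K(\varepsilon z_0)$$ holds if, and only if, $g(z)= P(\varepsilon z)$ for all $z\in\mathbb{D}$.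
   Context: $\mathbb{D}=\{z\in\mathbb{C}:|z|<1\}$ and $\overline{\mathbb{D}}(0,r)=\{z\in\mathbb{C}: |z|\le r\}$. A domain $\Omega$ is starlike with respect to $b$ if $b\in\Omega$ and the segment from $b$ to each point of $\Omega$ lies in $\Omega$. A conformal map of $\mathbb{D}$ onto $\Omega$ is an analytic bijection. $\mathcal{F}_\Omega$ is the class of analytic functions $g$ in $\mathbb{D}$ with $g(\mathbb{D})\subset\Omega$. The integrands $\zeta^{-1}(g(\zeta)-b)$ and $\zeta^{-1}(P(\zeta)-b)$ have removable singularities at $0$. A closed Jordan domain is the union of a Jordan curve and its interior. *)

(* Defs.v *)
From Stdlib Require Export Reals.
From Coquelicot Require Export Coquelicot.

Local Open Scope C_scope.

Definition unit_disk (z : C) : Prop := (Cmod z < 1)%R.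

Definition closed_disk (r : R) (z : C) : Prop := (Cmod z <= r)%R.

Definition image (f : C -> C) (A : C -> Prop) (w : C) : Prop :=
  exists z : C, A z /\ f z = w.

Definition set_eq (A B : C -> Prop) : Prop := forall w : C, A w <-> B w.

Definition connected_set (A : C -> Prop) : Prop :=
  ~ exists U V : C -> Prop,
      open U /\ open V /\
      (forall z, A z -> U z \/ V z) /\
      (forall z, A z -> ~ (U z /\ V z)) /\
      (exists z, A z /\ U z) /\ (exists z, A z /\ V z).

Definition component (A : C -> Prop) (w z : C) : Prop :=
  exists B : C -> Prop,
    connected_set B /\ (forall u, B u -> A u) /\ B w /\ B z.

Definition bounded_set (A : C -> Prop) : Prop :=
  exists M : R, forall z : C, A z -> (Cmod z <= M)%R.

Definition domain (A : C -> Prop) : Prop :=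
  (exists z, A z) /\ open A /\ connected_set A.

Definition segment (u v : C) (w : C) : Prop :=
  exists t : R, (0 <= t <= 1)%R /\ w = RtoC (1 - t) * u + RtoC t * v.

Definition starlike (A : C -> Prop) (b : C) : Prop :=
  A b /\ forall z, A z -> forall w, segment b z w -> A w.

Definition convex_set (A : C -> Prop) : Prop :=
  forall u v, A u -> A v -> forall w, segment u v w -> A w.

(* Functions on the disk are total functions [C -> C] of which only the values
   on [unit_disk] matter.  The derivative here is the complex one: the scalars
   of [C_NormedModule] are complex. *)
Definition analytic_on_disk (f : C -> C) : Prop :=
  forall z : C, unit_disk z ->
    ex_derive (K := C_AbsRing) (V := C_NormedModule) f z.

Definition conformal_map_onto (P : C -> C) (Omega : C -> Prop) : Prop :=
  analytic_on_disk P /\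
  (forall z1 z2, unit_disk z1 -> unit_disk z2 -> P z1 = P z2 -> z1 = z2) /\
  set_eq (image P unit_disk) Omega.

Definition analytic_into (Omega : C -> Prop) (g : C -> C) : Prop :=
  analytic_on_disk g /\ forall z, unit_disk z -> Omega (g z).

(* The integral of [h] from 0 to [z] along the segment [zeta = t z]. *)
Definition segment_integral (h : C -> C) (z : C) : C :=
  RInt (V := C_R_CompleteNormedModule)
       (fun t : R => h (RtoC t * z) * z) 0 1.

(* At [zeta = 0] the quotient takes the junk value of division by zero instead
   of its limit; a single point does not affect the Riemann integral. *)
Definition integral_quotient (f : C -> C) (b z : C) : C :=
  segment_integral (fun zeta : C => (f zeta - b) / zeta) z.

Definition variability_region (Omega : C -> Prop) (b z0 : C) (w : C) : Prop :=
  exists g : C -> C,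
    analytic_into Omega g /\ g 0 = b /\ w = integral_quotient g b z0.

Definition jordan_curve (J : C -> Prop) : Prop :=
  exists gamma : R -> C,
    continuous_on (fun t : R => (0 <= t <= 1)%R) gamma /\
    gamma 0%R = gamma 1%R /\
    (forall s t : R, (0 <= s < 1)%R -> (0 <= t < 1)%R ->
       gamma s = gamma t -> s = t) /\
    (forall w : C, J w <-> exists t : R, (0 <= t <= 1)%R /\ gamma t = w).

(* By the Jordan curve theorem the complement of [J] has exactly one bounded
   component, and this is it. *)
Definition jordan_interior (J : C -> Prop) (w : C) : Prop :=
  ~ J w /\ bounded_set (component (fun z => ~ J z) w).

Definition closed_jordan_domain (A : C -> Prop) : Prop :=
  exists J : C -> Prop,
    jordan_curve J /\ forall w, A w <-> J w \/ jordan_interior J w.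

(* Main.v *)
(* Put F = P - b and G = g - b, and let K_G(z) be the integral of G(zeta)/zeta from 0 to z.
   For e in C, the derivative of Re(e K_G) is Re(e G) in the radial and Re(i e G) in the
   angular logarithmic coordinate, so at a maximum point on a circle about 0 the number e G
   is real.  By the Schwarz lemma for F^-1 o (t F), a point at which F takes the value t F(z),
   0 <= t < 1, has modulus less than |z|.  Hence the maximum of Re(e K_F) over |z| <= r, say
   m(r), is attained only at the point of modulus r with e F > 0.  If G = F o omega is not a
   rotation of F, then |omega(z)| < |z|, and at a maximum point z <> 0 of
   Re(e K_G(z)) - m(|z|) the radial derivative of the first term would be smaller than that
   of the second; so Re(e K_G(z)) < m(|z|) for all z <> 0.  Thus the region of variability lies
   in the half-planes bounded by the lines through K_F(zeta), |zeta| = |z0|, with outer normal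
   F(zeta), and it meets these lines only for rotations of F.  A closest point argument shows
   that the intersection of the half-planes is the image of the closed disk under K_F. *)

Require Import Defs.
From Stdlib Require Import Lra Classical ClassicalEpsilon List.
Local Open Scope C_scope.

(** * Continuity and complex differentiability *)

(** Neither power series nor Cauchy's formula is used: the function theory rests on Goursat's
    theorem in the logarithmic coordinate [w], with [z = a + cexp w]. There a circle about [a] is a
    vertical segment, the horizontal sides of a rectangle of height [2 * PI] cancel by periodicity,
    and [a] lies at infinity, so that mere continuity at [a] suffices. Hence the maximum principle
    applies directly to difference quotients. This yields the Schwarz lemma, the nonvanishing of the
    derivative of a univalent function and the analyticity of [F^-1 o G]. The same coordinate
    governs [K_G]: away from 0 only its derivatives along rays and circles are established. Likewise
    [m] is not shown to be differentiable; its growth over a short radial step is bounded below by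
    that of one competitor point. Convexity is that of an intersection of half-planes, and
    injectivity of [K_F] is needed on one circle only, where it follows from the uniqueness of the
    contact point with a supporting line. *)

Definition ccont (f : C -> C) (z : C) : Prop :=
  forall eps : R, (0 < eps)%R -> exists d : R, (0 < d)%R /\
    forall w : C, (Cmod (w - z) < d)%R -> (Cmod (f w - f z) < eps)%R.

(* Caratheodory's form of the complex derivative: it turns the differentiation
   rules into statements about continuity. *)
Definition has_slope (f phi : C -> C) (z : C) : Prop :=
  ccont phi z /\ forall w : C, f w = f z + phi w * (w - z).

Definition cdiff (f : C -> C) (z : C) : Prop := exists phi, has_slope f phi z.

Lemma Ceq_dec (z w : C) : {z = w} + {z <> w}.
Proof.
  destruct z as [a b], w as [c d].
  destruct (Req_dec_T a c) as [->|H]; [|right; congruence].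
  destruct (Req_dec_T b d) as [->|H]; [now left|right; congruence].
Qed.

Lemma Cminus_diag (z : C) : z - z = 0.
Proof. ring. Qed.

Lemma Cminus_neq0 (z w : C) : z <> w -> z - w <> 0.
Proof. intros H E. apply H. replace z with (z - w + w) by ring. rewrite E. ring. Qed.

Lemma Cmod_minus_sym (z w : C) : Cmod (z - w) = Cmod (w - z).
Proof. replace (z - w) with (- (w - z)) by ring. apply Cmod_opp. Qed.

Lemma Cmod_minus_triangle (u v w : C) : (Cmod (u - w) <= Cmod (u - v) + Cmod (v - w))%R.
Proof. replace (u - w) with ((u - v) + (v - w)) by ring. apply Cmod_triangle. Qed.

Lemma Cmod_reverse_triangle (u v : C) : (Cmod u - Cmod v <= Cmod (u - v))%R.
Proof.
  assert (H := Cmod_triangle (u - v) v).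
  replace (u - v + v) with u in H by ring. lra.
Qed.

Lemma Cmod_le_abs_sum (x y : R) : (Cmod (x, y) <= Rabs x + Rabs y)%R.
Proof.
  replace ((x, y) : C) with (RtoC x + Ci * RtoC y)
    by (unfold Ci, RtoC, Cmult, Cplus; simpl; f_equal; ring).
  eapply Rle_trans; [apply Cmod_triangle|].
  rewrite Cmod_mult, Cmod_Ci, !Cmod_R. lra.
Qed.

Lemma im_le_Cmod (z : C) : (Rabs (Im z) <= Cmod z)%R.
Proof.
  destruct z as [x y].
  eapply Rle_trans; [|apply (Rmax_Cmod (x, y))]. apply Rmax_r.
Qed.

Lemma conj_mult_self (z : C) : Cconj z * z = RtoC (Cmod z ^ 2).
Proof. rewrite Cmult_comm. symmetry. apply Cmod2_conj. Qed.

Lemma ccont_const (c z : C) : ccont (fun _ => c) z.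
Proof.
  intros eps He. exists 1%R. split; [lra|]. intros w _.
  now rewrite Cminus_diag, Cmod_0.
Qed.

Lemma ccont_id (z : C) : ccont (fun w => w) z.
Proof. intros eps He. exists eps. auto. Qed.

Lemma ccont_plus (f g : C -> C) (z : C) :
  ccont f z -> ccont g z -> ccont (fun w => f w + g w) z.
Proof.
  intros Hf Hg eps He.
  destruct (Hf (eps / 2)%R ltac:(lra)) as [d1 [Hd1 H1]].
  destruct (Hg (eps / 2)%R ltac:(lra)) as [d2 [Hd2 H2]].
  exists (Rmin d1 d2). split; [now apply Rmin_glb_lt|].
  intros w Hw.
  specialize (H1 w (Rlt_le_trans _ _ _ Hw (Rmin_l _ _))).
  specialize (H2 w (Rlt_le_trans _ _ _ Hw (Rmin_r _ _))).
  replace (f w + g w - (f z + g z)) with ((f w - f z) + (g w - g z)) by ring.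
  eapply Rle_lt_trans; [apply Cmod_triangle|lra].
Qed.

Lemma ccont_mult (f g : C -> C) (z : C) :
  ccont f z -> ccont g z -> ccont (fun w => f w * g w) z.
Proof.
  intros Hf Hg eps He.
  set (M := (Cmod (f z) + Cmod (g z) + 1)%R).
  assert (HM : (1 <= M)%R)
    by (unfold M; pose proof (Cmod_ge_0 (f z)); pose proof (Cmod_ge_0 (g z)); lra).
  set (e := Rmin 1 (eps / (2 * M))).
  assert (He' : (0 < e)%R).
  { apply Rmin_glb_lt; [lra|]. apply Rdiv_lt_0_compat; lra. }
  destruct (Hf e He') as [d1 [Hd1 H1]].
  destruct (Hg e He') as [d2 [Hd2 H2]].
  exists (Rmin d1 d2). split; [now apply Rmin_glb_lt|].
  intros w Hw.
  specialize (H1 w (Rlt_le_trans _ _ _ Hw (Rmin_l _ _))).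
  specialize (H2 w (Rlt_le_trans _ _ _ Hw (Rmin_r _ _))).
  replace (f w * g w - f z * g z)
    with ((f w - f z) * (g w - g z) + ((f w - f z) * g z + f z * (g w - g z))) by ring.
  eapply Rle_lt_trans; [apply Cmod_triangle|].
  eapply Rle_lt_trans; [apply Rplus_le_compat_l, Cmod_triangle|].
  rewrite !Cmod_mult.
  assert (E1 : (e <= 1)%R) by apply Rmin_l.
  assert (E2 : (e * (2 * M) <= eps)%R).
  { apply Rmult_le_reg_r with (/ (2 * M))%R; [apply Rinv_0_lt_compat; lra|].
    rewrite Rmult_assoc, Rinv_r, Rmult_1_r by lra. apply Rmin_r. }
  pose proof (Cmod_ge_0 (f w - f z)). pose proof (Cmod_ge_0 (g w - g z)).
  pose proof (Cmod_ge_0 (f z)). pose proof (Cmod_ge_0 (g z)).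
  unfold M in E2. nra.
Qed.

Lemma ccont_opp (f : C -> C) (z : C) : ccont f z -> ccont (fun w => - f w) z.
Proof.
  intros Hf eps He. destruct (Hf eps He) as [d [Hd H]].
  exists d. split; [easy|]. intros w Hw.
  replace (- f w - - f z) with (- (f w - f z)) by ring.
  rewrite Cmod_opp. now apply H.
Qed.

Lemma ccont_minus (f g : C -> C) (z : C) :
  ccont f z -> ccont g z -> ccont (fun w => f w - g w) z.
Proof. intros Hf Hg. apply (ccont_plus f (fun w => - g w)); [|apply ccont_opp]; easy. Qed.

Lemma ccont_comp (f g : C -> C) (z : C) :
  ccont g z -> ccont f (g z) -> ccont (fun w => f (g w)) z.
Proof.
  intros Hg Hf eps He. destruct (Hf eps He) as [d [Hd H]].
  destruct (Hg d Hd) as [d' [Hd' H']].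
  exists d'. split; [easy|]. intros w Hw. apply H. now apply H'.
Qed.

Lemma ccont_inv_at (z : C) : z <> 0 -> ccont Cinv z.
Proof.
  intros Hz eps He.
  assert (Hm := proj1 (Cmod_gt_0 z) Hz). set (m := Cmod z) in *.
  (* The first bound keeps [|w| > m / 2], hence [|w z| > m * m / 2], which the second bound then
     absorbs. *)
  exists (Rmin (m / 2) (eps * (m * m / 2))). split.
  { apply Rmin_glb_lt; [lra|]. apply Rmult_lt_0_compat; [easy|nra]. }
  intros w Hw.
  assert (H1 := Rlt_le_trans _ _ _ Hw (Rmin_l _ _)).
  assert (H2 := Rlt_le_trans _ _ _ Hw (Rmin_r _ _)).
  assert (Hmw : (m / 2 < Cmod w)%R).
  { assert (H := Cmod_reverse_triangle z w). rewrite Cmod_minus_sym in H. fold m in H. lra. }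
  assert (Hw0 : w <> 0) by (apply Cmod_gt_0; lra).
  replace (/ w - / z) with ((z - w) / (w * z)) by (field; auto).
  rewrite Cmod_div by now apply Cmult_neq_0.
  rewrite Cmod_mult, Cmod_minus_sym. fold m.
  apply Rmult_lt_reg_r with (Cmod w * m)%R; [nra|].
  unfold Rdiv at 1. rewrite Rmult_assoc, Rinv_l, Rmult_1_r by nra.
  eapply Rlt_le_trans; [apply H2|]. apply Rmult_le_compat_l; nra.
Qed.

Lemma ccont_inv (f : C -> C) (z : C) : ccont f z -> f z <> 0 -> ccont (fun w => / f w) z.
Proof. intros Hf Hz. apply (ccont_comp Cinv f); [easy|now apply ccont_inv_at]. Qed.

Lemma ccont_ext_loc (f g : C -> C) (z : C) (d : R) :
  (0 < d)%R -> (forall w, (Cmod (w - z) < d)%R -> f w = g w) -> ccont f z -> ccont g z.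
Proof.
  intros Hd E Hf eps He. destruct (Hf eps He) as [d' [Hd' H]].
  exists (Rmin d d'). split; [now apply Rmin_glb_lt|]. intros w Hw.
  rewrite <- !E; [| rewrite Cminus_diag, Cmod_0; easy | eapply Rlt_le_trans; [apply Hw|apply Rmin_l]].
  apply H. eapply Rlt_le_trans; [apply Hw|apply Rmin_r].
Qed.

Lemma ccont_neq0 (f : C -> C) (z : C) : ccont f z -> f z <> 0 ->
  exists d, (0 < d)%R /\ forall w, (Cmod (w - z) < d)%R -> f w <> 0.
Proof.
  intros Hf Hz. destruct (Hf (Cmod (f z)) (proj1 (Cmod_gt_0 _) Hz)) as [d [Hd H]].
  exists d. split; [easy|]. intros w Hw E. specialize (H w Hw).
  rewrite E in H. replace (0 - f z) with (- f z) in H by ring.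
  rewrite Cmod_opp in H. lra.
Qed.

Lemma cdiff_ccont (f : C -> C) (z : C) : cdiff f z -> ccont f z.
Proof.
  intros [phi [Hc E]].
  apply (ccont_ext_loc (fun w => f z + phi w * (w - z)) f z 1); [lra|intros w _; symmetry; apply E|].
  apply ccont_plus; [apply ccont_const|].
  apply ccont_mult; [easy|].
  apply ccont_minus; [apply ccont_id|apply ccont_const].
Qed.

(** The only possible Caratheodory function with value [l] at the base point: off [z] it is forced.
    Differentiability at [z] is thus its continuity there for a suitable [l]. *)
Definition slope (f : C -> C) (l z w : C) : C :=
  if Ceq_dec w z then l else (f w - f z) / (w - z).

Lemma slope_diag (f : C -> C) (l z : C) : slope f l z z = l.
Proof. unfold slope. destruct (Ceq_dec z z); congruence. Qed.

Lemma slope_neq (f : C -> C) (l z w : C) : w <> z -> slope f l z w = (f w - f z) / (w - z).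
Proof. unfold slope. destruct (Ceq_dec w z); congruence. Qed.

Lemma slope_eq (f : C -> C) (l z w : C) : f w = f z + slope f l z w * (w - z).
Proof.
  unfold slope. destruct (Ceq_dec w z) as [->|H].
  - ring.
  - field. now apply Cminus_neq0.
Qed.

Lemma has_slope_of_ccont (f : C -> C) (l z : C) :
  ccont (slope f l z) z -> has_slope f (slope f l z) z.
Proof. intros H. split; [easy|]. intros w. apply slope_eq. Qed.

Lemma has_slope_unfold (f phi : C -> C) (z w : C) :
  has_slope f phi z -> w <> z -> phi w = (f w - f z) / (w - z).
Proof.
  intros [_ E] Hw. rewrite (E w). field. now apply Cminus_neq0.
Qed.

Lemma has_slope_slope (f phi : C -> C) (z : C) :
  has_slope f phi z -> forall w, slope f (phi z) z w = phi w.
Proof.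
  intros H w. unfold slope. destruct (Ceq_dec w z) as [->|Hw]; [easy|].
  symmetry. now apply has_slope_unfold.
Qed.

(** [has_slope] asks for its identity at every [w]. A formula valid only near [z], as for a
    reciprocal whose denominator may vanish elsewhere, is completed by the exact difference
    quotient. *)
Lemma cdiff_loc (f phi : C -> C) (z : C) (d : R) : (0 < d)%R -> ccont phi z ->
  (forall w, (Cmod (w - z) < d)%R -> f w = f z + phi w * (w - z)) -> cdiff f z.
Proof.
  intros Hd Hc E. exists (slope f (phi z) z). apply has_slope_of_ccont.
  apply (ccont_ext_loc phi _ z d); [easy| |easy].
  intros w Hw. unfold slope. destruct (Ceq_dec w z) as [->|H]; [easy|].
  rewrite (E w Hw). field. now apply Cminus_neq0.
Qed.

Lemma cdiff_ext_loc (f g : C -> C) (z : C) (d : R) :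
  (0 < d)%R -> (forall w, (Cmod (w - z) < d)%R -> f w = g w) -> cdiff f z -> cdiff g z.
Proof.
  intros Hd E [phi [Hc Hs]]. apply (cdiff_loc g phi z d Hd Hc).
  intros w Hw. rewrite <- !E; [apply Hs| |easy].
  rewrite Cminus_diag, Cmod_0. easy.
Qed.

Lemma cdiff_const (c z : C) : cdiff (fun _ => c) z.
Proof. exists (fun _ => 0). split; [apply ccont_const|]. intros w. ring. Qed.

Lemma cdiff_id (z : C) : cdiff (fun w => w) z.
Proof. exists (fun _ => 1). split; [apply ccont_const|]. intros w. ring. Qed.

Lemma cdiff_plus (f g : C -> C) (z : C) :
  cdiff f z -> cdiff g z -> cdiff (fun w => f w + g w) z.
Proof.
  intros [p [Hp Ep]] [q [Hq Eq]]. exists (fun w => p w + q w). split.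
  - now apply ccont_plus.
  - intros w. rewrite (Ep w), (Eq w). ring.
Qed.

Lemma cdiff_mult (f g : C -> C) (z : C) :
  cdiff f z -> cdiff g z -> cdiff (fun w => f w * g w) z.
Proof.
  intros Hf Hg. assert (Cg := cdiff_ccont _ _ Hg).
  destruct Hf as [p [Hp Ep]], Hg as [q [Hq Eq]].
  exists (fun w => p w * g w + f z * q w). split.
  - apply ccont_plus; apply ccont_mult; try easy. apply ccont_const.
  - intros w. rewrite (Ep w), (Eq w). ring.
Qed.

Lemma cdiff_minus (f g : C -> C) (z : C) :
  cdiff f z -> cdiff g z -> cdiff (fun w => f w - g w) z.
Proof.
  intros [p [Hp Ep]] [q [Hq Eq]]. exists (fun w => p w - q w). split.
  - now apply ccont_minus.
  - intros w. rewrite (Ep w), (Eq w). ring.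
Qed.

Lemma cdiff_inv (f : C -> C) (z : C) : cdiff f z -> f z <> 0 -> cdiff (fun w => / f w) z.
Proof.
  intros Hf Hz. assert (Cf := cdiff_ccont _ _ Hf).
  destruct (ccont_neq0 f z Cf Hz) as [d [Hd Hn]].
  destruct Hf as [p [Hp Ep]].
  apply (cdiff_loc _ (fun w => - p w * (/ f w * / f z)) z d Hd).
  - apply ccont_mult; [now apply ccont_opp|].
    apply ccont_mult; [now apply ccont_inv|apply ccont_const].
  - intros w Hw. specialize (Hn w Hw).
    replace (- p w * (/ f w * / f z) * (w - z)) with (- (p w * (w - z)) * (/ f w * / f z)) by ring.
    replace (p w * (w - z)) with (f w - f z) by (rewrite (Ep w); ring).
    field. auto.
Qed.

Lemma cdiff_div (f g : C -> C) (z : C) :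
  cdiff f z -> cdiff g z -> g z <> 0 -> cdiff (fun w => f w / g w) z.
Proof.
  intros Hf Hg Hz. apply (cdiff_mult f (fun w => / g w)); [easy|now apply cdiff_inv].
Qed.

Lemma cdiff_comp (f g : C -> C) (z : C) :
  cdiff g z -> cdiff f (g z) -> cdiff (fun w => f (g w)) z.
Proof.
  intros Hg Hf. assert (Cg := cdiff_ccont _ _ Hg).
  destruct Hf as [p [Hp Ep]], Hg as [q [Hq Eq]].
  exists (fun w => p (g w) * q w). split.
  - apply ccont_mult; [|easy]. now apply (ccont_comp p g).
  - intros w. rewrite (Ep (g w)).
    replace (g w - g z) with (q w * (w - z)) by (rewrite (Eq w); ring). ring.
Qed.

Lemma cdiff_slope_away (f : C -> C) (l a z : C) :
  z <> a -> cdiff f z -> cdiff (slope f l a) z.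
Proof.
  intros Hz Hf.
  apply (cdiff_ext_loc (fun w => (f w - f a) / (w - a)) _ z (Cmod (z - a))).
  - now apply Cmod_gt_0, Cminus_neq0.
  - intros w Hw. symmetry. apply slope_neq. intros ->.
    rewrite Cmod_minus_sym in Hw. lra.
  - apply cdiff_div.
    + apply cdiff_minus; [easy|apply cdiff_const].
    + apply cdiff_minus; [apply cdiff_id|apply cdiff_const].
    + now apply Cminus_neq0.
Qed.

Lemma ex_derive_cdiff (f : C -> C) (z : C) :
  ex_derive (K := C_AbsRing) (V := C_NormedModule) f z <-> cdiff f z.
Proof.
  split.
  - intros [l [_ Hl]].
    (* The derivative is tested at every limit of the filter [locally z]; [z] is one of them. *)
    specialize (Hl z (fun P H => H)).
    exists (slope f l z). apply has_slope_of_ccont.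
    intros eps He.
    assert (He2 : (0 < eps / 2)%R) by lra.
    destruct (Hl (mkposreal _ He2)) as [d Hd]. simpl in Hd.
    exists d. split; [apply cond_pos|]. intros w Hw.
    rewrite slope_diag. unfold slope. destruct (Ceq_dec w z) as [->|Hn].
    { rewrite Cminus_diag, Cmod_0. lra. }
    specialize (Hd w Hw).
    change (Cmod ((f w + - f z) + - ((w + - z) * l)) <= eps / 2 * Cmod (w + - z))%R in Hd.
    assert (Hpos := proj1 (Cmod_gt_0 _) (Cminus_neq0 _ _ Hn)).
    replace ((f w - f z) / (w - z) - l) with (((f w + - f z) + - ((w + - z) * l)) / (w - z))
      by (field; now apply Cminus_neq0).
    rewrite Cmod_div by now apply Cminus_neq0.
    apply Rle_lt_trans with (eps / 2)%R; [|lra].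
    apply Rmult_le_reg_r with (Cmod (w - z)); [easy|].
    unfold Rdiv at 1. rewrite Rmult_assoc, Rinv_l, Rmult_1_r by lra. exact Hd.
  - intros [phi [Hc E]]. exists (phi z). split; [apply is_linear_scal_l|].
    intros y Hy. assert (z = y) as <-.
    { apply (is_filter_lim_locally_unique (V := AbsRing_NormedModule C_AbsRing)). exact Hy. }
    intros eps. destruct (Hc eps (cond_pos eps)) as [d [Hd H]].
    exists (mkposreal _ Hd). intros w Hw.
    specialize (H w Hw).
    change (Cmod ((f w + - f z) + - ((w + - z) * phi z)) <= eps * Cmod (w + - z))%R.
    replace ((f w + - f z) + - ((w + - z) * phi z)) with ((phi w - phi z) * (w + - z))
      by (rewrite (E w); ring).
    rewrite Cmod_mult. apply Rmult_le_compat_r; [apply Cmod_ge_0|lra].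
Qed.

Lemma ccont_continuous (f : C -> C) (z : C) : ccont f z ->
  continuous (T := C_UniformSpace) (U := C_UniformSpace) f z.
Proof.
  intros Hf. apply filterlim_locally. intros eps.
  destruct (Hf eps (cond_pos eps)) as [d [Hd H]].
  (* Balls of the product uniform structure are squares; one of half-side [d / 2] lies in the disk
     of radius [sqrt 2 * (d / 2) < d]. *)
  assert (Hd2 : (0 < d / 2)%R) by lra.
  exists (mkposreal _ Hd2). intros w Hb.
  apply (C_NormedModule_mixin_compat2 z w) in Hb. simpl in Hb.
  change (Cmod (w - z) < sqrt 2 * (d / 2))%R in Hb.
  assert (Hs : (sqrt 2 < 2)%R).
  { pose proof (sqrt_sqrt 2 ltac:(lra)). pose proof (sqrt_pos 2). nra. }
  apply C_NormedModule_mixin_compat1. apply H. nra.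
Qed.

Lemma open_Cmod (U : C -> Prop) : open U <->
  forall z, U z -> exists d, (0 < d)%R /\ forall w, (Cmod (w - z) < d)%R -> U w.
Proof.
  split.
  - intros HU z Hz. destruct (HU z Hz) as [d Hd].
    exists d. split; [apply cond_pos|]. intros w Hw.
    apply Hd. now apply C_NormedModule_mixin_compat1.
  - intros HU z Hz. destruct (HU z Hz) as [d [Hd H]].
    assert (Hd2 : (0 < d / 2)%R) by lra.
    exists (mkposreal _ Hd2). intros w Hb. apply H.
    apply (C_NormedModule_mixin_compat2 z w) in Hb. simpl in Hb.
    change (Cmod (w - z) < sqrt 2 * (d / 2))%R in Hb.
    assert (Hs : (sqrt 2 < 2)%R).
    { pose proof (sqrt_sqrt 2 ltac:(lra)). pose proof (sqrt_pos 2). nra. }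
    nra.
Qed.

(** * Compactness *)

Definition closed_set (S : C -> Prop) : Prop :=
  forall z, ~ S z -> exists d, (0 < d)%R /\ forall w, S w -> (d <= Cmod (w - z))%R.

(** A square containing [S] is covered by finitely many neighbourhoods. Those centred off [S] are
    chosen disjoint from [S], which closedness permits, so each point of [S] is covered from a
    centre in [S]. *)
Lemma finite_subcover (S : C -> Prop) (delta : C -> R) :
  closed_set S -> bounded_set S -> (forall z, S z -> (0 < delta z)%R) ->
  exists l : list C, forall z, S z ->
    exists p, In p l /\ S p /\ (Cmod (z - p) < delta p)%R.
Proof.
  intros Hcl [M HM] Hdelta.
  (* The cover is by squares of half-side [d], which lie in disks of radius [2 * d]; hence the
     factor 2. *)
  assert (Hex : forall z : C, exists d : posreal,
    (S z -> (2 * d <= delta z)%R) /\ (~ S z -> forall w, S w -> (2 * d <= Cmod (w - z))%R)).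
  { intros z. destruct (classic (S z)) as [Hz|Hz].
    - assert (H : (0 < delta z / 2)%R) by (specialize (Hdelta z Hz); lra).
      exists (mkposreal _ H). split; [simpl; intros; lra|tauto].
    - destruct (Hcl z Hz) as [d [Hd H]].
      assert (Hd2 : (0 < d / 2)%R) by lra.
      exists (mkposreal _ Hd2). split; [tauto|]. intros _ w Hw. simpl.
      specialize (H w Hw). lra. }
  destruct (choice _ Hex) as [e He].
  pose (enc := fun x : Compactness.Tn 2 R => ((fst x, fst (snd x)) : C)).
  (* The conclusion of [compactness_list] is doubly negated. *)
  apply NNPP. intros Hno.
  apply (compactness_list 2 (- M, (- M, tt))%R (M, (M, tt)) (fun x => e (enc x))).
  intros [l Hl]. apply Hno. exists (map enc l).
  intros [x y] Hz.
  assert (Hb := HM _ Hz).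
  assert (Hx := Rle_trans _ _ _ (re_le_Cmod (x, y)) Hb).
  assert (Hy := Rle_trans _ _ _ (im_le_Cmod (x, y)) Hb).
  simpl in Hx, Hy. apply Rabs_le_between in Hx, Hy.
  destruct (Hl (x, (y, tt))) as [[u [v []]] [Hin [_ Hclose]]].
  { simpl. repeat split; lra. }
  simpl in Hclose. destruct Hclose as [H1 [H2 _]].
  unfold enc in H1, H2; simpl in H1, H2.
  assert (Hd : (Cmod ((x, y) - (u, v)) < 2 * e (u, v))%R).
  { eapply Rle_lt_trans; [apply (Cmod_le_abs_sum (x - u) (y - v))|].
    lra. }
  destruct (He (u, v)) as [Ha Hb'].
  exists (u, v). split; [|split].
  - apply (in_map enc) in Hin. exact Hin.
  - destruct (classic (S (u, v))) as [Hs|Hs]; [easy|].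
    specialize (Hb' Hs _ Hz). lra.
  - destruct (classic (S (u, v))) as [Hs|Hs].
    + specialize (Ha Hs). lra.
    + specialize (Hb' Hs _ Hz). lra.
Qed.

(* Only upper semicontinuity is required. *)
Lemma max_attained (S : C -> Prop) (v : C -> R) :
  closed_set S -> bounded_set S -> (exists z, S z) ->
  (forall z, S z -> forall eps, (0 < eps)%R -> exists d, (0 < d)%R /\
     forall w, S w -> (Cmod (w - z) < d)%R -> (v w < v z + eps)%R) ->
  exists z, S z /\ forall w, S w -> (v w <= v z)%R.
Proof.
  intros Hcl Hb [z1 Hz1] Husc. apply NNPP. intros Hno.
  (* Without a maximum every [z] is beaten by some [y z], and semicontinuity keeps [v] below
     [v (y z)] near [z]. Among the finitely many centres covering [S], take [p] with [v (y p)]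
     largest: the neighbourhood that contains [y p] gives a contradiction. *)
  assert (Hup : forall z, exists y, S z -> S y /\ (v z < v y)%R).
  { intros z. destruct (classic (S z)) as [Hz|Hz]; [|exists z; tauto].
    apply NNPP. intros H. apply Hno. exists z. split; [easy|].
    intros w Hw. destruct (Rle_lt_dec (v w) (v z)) as [|Hlt]; [easy|].
    exfalso. apply H. now exists w. }
  destruct (choice _ Hup) as [y Hy].
  assert (Hd : forall z, exists d, S z -> (0 < d)%R /\
     forall w, S w -> (Cmod (w - z) < d)%R -> (v w < v (y z))%R).
  { intros z. destruct (classic (S z)) as [Hz|Hz]; [|exists 1%R; tauto].
    destruct (Hy z Hz) as [_ Hlt].
    destruct (Husc z Hz (v (y z) - v z)%R ltac:(lra)) as [d [Hd H]].
    exists d. intros _. split; [easy|]. intros w Hw Hwd.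
    specialize (H w Hw Hwd). lra. }
  destruct (choice _ Hd) as [d Hd'].
  destruct (finite_subcover S d Hcl Hb (fun z Hz => proj1 (Hd' z Hz))) as [l Hl].
  assert (Hmax : forall l : list C, (exists p, In p l /\ S p) ->
     exists p, In p l /\ S p /\ forall q, In q l -> S q -> (v (y q) <= v (y p))%R).
  { clear - Hy. induction l as [|a l IH]; intros [p [Hin Hp]]; [destruct Hin|].
    destruct (classic (exists p, In p l /\ S p)) as [H|H].
    - destruct (IH H) as [q [Hq [HSq Hm]]].
      destruct (classic (S a /\ (v (y q) < v (y a))%R)) as [[Ha Hlt]|Hn].
      + exists a. split; [now left|]. split; [easy|].
        intros r [<-|Hr] HSr; [lra|]. specialize (Hm r Hr HSr). lra.
      + exists q. split; [now right|]. split; [easy|].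
        intros r [<-|Hr] HSr; [|now apply Hm].
        apply Rnot_lt_le. tauto.
    - destruct Hin as [<-|Hin]; [|exfalso; apply H; now exists p].
      exists a. split; [now left|]. split; [easy|].
      intros r [<-|Hr] HSr; [lra|]. exfalso. apply H. now exists r. }
  destruct (Hmax l) as [p [Hin [HSp Hm]]].
  { destruct (Hl z1 Hz1) as [p [H1 [H2 _]]]. now exists p. }
  destruct (Hl (y p) (proj1 (Hy p HSp))) as [q [Hq [HSq Hc]]].
  assert (H := proj2 (Hd' q HSq) (y p) (proj1 (Hy p HSp)) Hc).
  specialize (Hm q Hq HSq). lra.
Qed.

Lemma max_attained_ccont (S : C -> Prop) (u : C -> C) :
  closed_set S -> bounded_set S -> (exists z, S z) -> (forall z, S z -> ccont u z) ->
  (exists z, S z /\ forall w, S w -> (Re (u w) <= Re (u z))%R) /\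
  (exists z, S z /\ forall w, S w -> (Cmod (u w) <= Cmod (u z))%R) /\
  (exists z, S z /\ forall w, S w -> (Cmod (u z) <= Cmod (u w))%R).
Proof.
  intros Hcl Hb Hne Hc. split; [|split].
  - apply max_attained; try easy. intros z Hz eps He.
    destruct (Hc z Hz eps He) as [d [Hd H]]. exists d. split; [easy|].
    intros w _ Hw. specialize (H w Hw).
    assert (H1 := re_le_Cmod (u w - u z)).
    assert (H2 := Rle_abs (Re (u w - u z))).
    assert (E : Re (u w - u z) = (Re (u w) - Re (u z))%R) by reflexivity. lra.
  - apply (max_attained S (fun z => Cmod (u z))); try easy. intros z Hz eps He.
    destruct (Hc z Hz eps He) as [d [Hd H]]. exists d. split; [easy|].
    intros w _ Hw. specialize (H w Hw).
    assert (H1 := Cmod_reverse_triangle (u w) (u z)). lra.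
  - destruct (max_attained S (fun z => - Cmod (u z))%R) as [z [Hz Hm]]; try easy.
    + intros z Hz eps He.
      destruct (Hc z Hz eps He) as [d [Hd H]]. exists d. split; [easy|].
      intros w _ Hw. specialize (H w Hw). rewrite Cmod_minus_sym in H.
      assert (H1 := Cmod_reverse_triangle (u z) (u w)). lra.
    + exists z. split; [easy|]. intros w Hw. specialize (Hm w Hw). lra.
Qed.

(** Only [z] is confined to [S], since the covering neighbourhoods are neighbourhoods in the plane;
    [w] may lie slightly outside [S]. *)
Lemma heine (S : C -> Prop) (u : C -> C) :
  closed_set S -> bounded_set S -> (forall z, S z -> ccont u z) ->
  forall eps, (0 < eps)%R -> exists d, (0 < d)%R /\
    forall z w, S z -> (Cmod (w - z) < d)%R -> (Cmod (u w - u z) < eps)%R.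
Proof.
  intros Hcl Hb Hc eps He.
  assert (Hex : forall z, exists d, S z -> (0 < d)%R /\
    forall w, (Cmod (w - z) < 2 * d)%R -> (Cmod (u w - u z) < eps / 2)%R).
  { intros z. destruct (classic (S z)) as [Hz|Hz]; [|exists 1%R; tauto].
    destruct (Hc z Hz (eps / 2)%R ltac:(lra)) as [d [Hd H]].
    exists (d / 2)%R. intros _. split; [lra|]. intros w Hw. apply H. lra. }
  destruct (choice _ Hex) as [d Hd].
  destruct (finite_subcover S d Hcl Hb (fun z Hz => proj1 (Hd z Hz))) as [l Hl].
  assert (Hmin : forall l : list C, exists m, (0 < m)%R /\
    forall p, In p l -> S p -> (m <= d p)%R).
  { clear - Hd. induction l as [|a l [m [Hm IH]]].
    - exists 1%R. split; [lra|]. intros p [].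
    - destruct (classic (S a)) as [Ha|Ha].
      + exists (Rmin m (d a)). split; [apply Rmin_glb_lt; [easy|apply (Hd a Ha)]|].
        intros p [<-|Hp] HSp; [apply Rmin_r|].
        eapply Rle_trans; [apply Rmin_l|now apply IH].
      + exists m. split; [easy|]. intros p [<-|Hp] HSp; [easy|now apply IH]. }
  destruct (Hmin l) as [m [Hm Hml]].
  exists m. split; [easy|]. intros z w Hz Hw.
  destruct (Hl z Hz) as [p [Hin [HSp Hc']]].
  specialize (Hml p Hin HSp). destruct (Hd p HSp) as [_ H].
  assert (H1 := H z ltac:(pose proof (Cmod_ge_0 (w - z)); lra)).
  assert (H2 := H w ltac:(pose proof (Cmod_minus_triangle w z p); lra)).
  assert (H3 := Cmod_minus_triangle (u w) (u p) (u z)).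
  rewrite (Cmod_minus_sym (u p)) in H3. lra.
Qed.

Lemma closed_disk_closed (a : C) (r : R) : closed_set (fun z => (Cmod (z - a) <= r)%R).
Proof.
  intros z Hz. apply Rnot_le_lt in Hz. exists (Cmod (z - a) - r)%R. split; [lra|].
  intros w Hw. assert (H := Cmod_minus_triangle z w a).
  rewrite (Cmod_minus_sym z w) in H. lra.
Qed.

Lemma closed_disk_bounded (a : C) (r : R) : bounded_set (fun z => (Cmod (z - a) <= r)%R).
Proof.
  exists (r + Cmod a)%R. intros z Hz.
  assert (H := Cmod_triangle (z - a) a).
  replace (z - a + a) with z in H by ring. lra.
Qed.

Lemma circle_closed (a : C) (r : R) : closed_set (fun z => Cmod (z - a) = r).
Proof.
  intros z Hz. exists (Rabs (Cmod (z - a) - r)). split; [apply Rabs_pos_lt; lra|].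
  intros w Hw. assert (H1 := Cmod_minus_triangle z w a).
  assert (H2 := Cmod_minus_triangle w z a).
  rewrite (Cmod_minus_sym z w) in H1. apply Rabs_le. lra.
Qed.

Lemma circle_bounded (a : C) (r : R) : bounded_set (fun z => Cmod (z - a) = r).
Proof.
  destruct (closed_disk_bounded a r) as [M HM]. exists M. intros z Hz. apply HM. lra.
Qed.

(** * Integrals of complex-valued functions of a real variable *)

Notation is_CInt := (is_RInt (V := C_R_NormedModule)).
Notation CInt := (RInt (V := C_R_CompleteNormedModule)).
Notation is_Rderive := (is_derive (K := R_AbsRing) (V := C_R_NormedModule)).

Lemma is_CInt_unique (f : R -> C) (a b : R) (l : C) : is_CInt f a b l -> CInt f a b = l.
Proof. apply (is_RInt_unique (V := C_R_CompleteNormedModule)). Qed.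

Lemma CInt_correct (f : R -> C) (a b : R) :
  ex_RInt (V := C_R_NormedModule) f a b -> is_CInt f a b (CInt f a b).
Proof. apply (RInt_correct (V := C_R_CompleteNormedModule)). Qed.

Lemma is_CInt_pair (f : R -> C) (a b x y : R) :
  is_RInt (fun t => Re (f t)) a b x -> is_RInt (fun t => Im (f t)) a b y ->
  is_CInt f a b (x, y).
Proof.
  apply (is_RInt_fct_extend_pair (U := R_NormedModule) (V := R_NormedModule) f).
Qed.

Lemma is_CInt_Re (f : R -> C) (a b : R) (l : C) :
  is_CInt f a b l -> is_RInt (fun t => Re (f t)) a b (Re l).
Proof. apply (is_RInt_fct_extend_fst (U := R_NormedModule) (V := R_NormedModule) f). Qed.

Lemma is_CInt_Im (f : R -> C) (a b : R) (l : C) :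
  is_CInt f a b l -> is_RInt (fun t => Im (f t)) a b (Im l).
Proof. apply (is_RInt_fct_extend_snd (U := R_NormedModule) (V := R_NormedModule) f). Qed.

Lemma is_CInt_scal (k : C) (f : R -> C) (a b : R) (l : C) :
  is_CInt f a b l -> is_CInt (fun t => k * f t) a b (k * l).
Proof.
  intros H. assert (Hr := is_CInt_Re _ _ _ _ H). assert (Hi := is_CInt_Im _ _ _ _ H).
  destruct k as [p q], l as [x y]. simpl in Hr, Hi.
  apply is_CInt_pair.
  - apply (is_RInt_minus (V := R_NormedModule) (fun t => p * Re (f t))%R
      (fun t => q * Im (f t))%R a b (p * x)%R (q * y)%R);
    apply (is_RInt_scal (V := R_NormedModule)); easy.
  - apply (is_RInt_plus (V := R_NormedModule) (fun t => p * Im (f t))%R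
      (fun t => q * Re (f t))%R a b (p * y)%R (q * x)%R);
    apply (is_RInt_scal (V := R_NormedModule)); easy.
Qed.

Lemma is_CInt_plus (f g : R -> C) (a b : R) (l m : C) :
  is_CInt f a b l -> is_CInt g a b m -> is_CInt (fun t => f t + g t) a b (l + m).
Proof. apply (is_RInt_plus (V := C_R_NormedModule)). Qed.

Lemma is_CInt_minus (f g : R -> C) (a b : R) (l m : C) :
  is_CInt f a b l -> is_CInt g a b m -> is_CInt (fun t => f t - g t) a b (l - m).
Proof. apply (is_RInt_minus (V := C_R_NormedModule)). Qed.

Lemma is_CInt_const (c : C) (a b : R) : is_CInt (fun _ => c) a b (RtoC (b - a) * c).
Proof.
  replace (RtoC (b - a) * c) with (scal (V := C_R_NormedModule) (b - a)%R c).
  - apply (is_RInt_const (V := C_R_NormedModule)).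
  - apply (scal_R_Cmult (b - a)%R c).
Qed.

Lemma is_CInt_bound (f : R -> C) (a b : R) (l : C) (M : R) : (a <= b)%R ->
  (forall t, (a <= t <= b)%R -> (Cmod (f t) <= M)%R) -> is_CInt f a b l ->
  (Cmod l <= (b - a) * M)%R.
Proof.
  intros Hab HM H. rewrite Cmod_norm.
  apply (norm_RInt_le_const (V := C_R_NormedModule) f a b); [easy| |easy].
  intros t Ht. specialize (HM t Ht). rewrite Cmod_norm in HM. exact HM.
Qed.

Lemma continuous_ccont_comp (f : C -> C) (g : R -> C) (t : R) :
  continuous (U := C_UniformSpace) g t -> ccont f (g t) ->
  continuous (U := C_UniformSpace) (fun s => f (g s)) t.
Proof.
  intros Hg Hf. apply (continuous_comp g f); [easy|now apply ccont_continuous].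
Qed.

Lemma continuous_pair_fun (u v : R -> R) (t : R) : continuous u t -> continuous v t ->
  continuous (U := C_UniformSpace) (fun s => (u s, v s)) t.
Proof.
  intros Hu Hv. apply filterlim_locally. intros eps.
  generalize (proj1 (filterlim_locally _ _) Hu eps) (proj1 (filterlim_locally _ _) Hv eps).
  intros H1 H2. generalize (filter_and _ _ H1 H2). apply filter_imp.
  intros s [Ha Hb]. split; easy.
Qed.

Lemma ex_CInt_continuous (f : R -> C) (a b : R) : (a <= b)%R ->
  (forall t, (a <= t <= b)%R -> continuous (U := C_UniformSpace) f t) ->
  ex_RInt (V := C_R_NormedModule) f a b.
Proof.
  intros Hab H. apply (ex_RInt_continuous (V := C_R_CompleteNormedModule)).
  rewrite Rmin_left, Rmax_right by easy. exact H.
Qed.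

Lemma is_Rderive_Re_scal (k : C) (g : R -> C) (t : R) (l : C) :
  is_Rderive g t l -> is_derive (fun s => Re (k * g s)) t (Re (k * l)).
Proof.
  intros H.
  assert (Hr : is_derive (fun s => Re (g s)) t (Re l)).
  { apply (filterdiff_comp' (U := R_NormedModule) (V := C_R_NormedModule) (W := R_NormedModule)
      g fst t (fun s => scal s l) fst H).
    apply filterdiff_linear, (is_linear_fst (U := R_NormedModule) (V := R_NormedModule)). }
  assert (Hi : is_derive (fun s => Im (g s)) t (Im l)).
  { apply (filterdiff_comp' (U := R_NormedModule) (V := C_R_NormedModule) (W := R_NormedModule)
      g snd t (fun s => scal s l) snd H).
    apply filterdiff_linear, (is_linear_snd (U := R_NormedModule) (V := R_NormedModule)). }
  destruct k as [p q].
  apply (is_derive_minus (fun s => p * Re (g s))%R (fun s => q * Im (g s))%R);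
    now apply is_derive_scal.
Qed.

Lemma is_Rderive_of_slope (g psi : R -> C) (t : R) :
  (forall eps, (0 < eps)%R -> exists d, (0 < d)%R /\
     forall s, (Rabs (s - t) < d)%R -> (Cmod (psi s - psi t) < eps)%R) ->
  (forall s, g s = g t + psi s * RtoC (s - t)) ->
  is_Rderive g t (psi t).
Proof.
  intros Hc E. split; [apply is_linear_scal_l|].
  intros y Hy. assert (t = y) as <-.
  { apply (is_filter_lim_locally_unique (V := R_NormedModule)). exact Hy. }
  intros eps. destruct (Hc eps (cond_pos eps)) as [d [Hd H]].
  exists (mkposreal _ Hd). intros s Hs. specialize (H s Hs).
  rewrite <- !Cmod_norm, scal_R_Cmult.
  change (minus s t) with (s - t)%R.
  change (Cmod ((g s - g t) - RtoC (s - t) * psi t) <= eps * Rabs (s - t))%R.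
  replace ((g s - g t) - RtoC (s - t) * psi t) with ((psi s - psi t) * RtoC (s - t))
    by (rewrite (E s); ring).
  rewrite Cmod_mult, Cmod_R. apply Rmult_le_compat_r; [apply Rabs_pos|lra].
Qed.

(** * Goursat's theorem on rectangles *)

Lemma nested_intervals (u v : nat -> R) :
  (forall n, u n <= u (S n))%R -> (forall n, v (S n) <= v n)%R -> (forall n, u n <= v n)%R ->
  exists x, forall n, (u n <= x <= v n)%R.
Proof.
  intros Hu Hv Huv.
  assert (Mu : forall n k, (u n <= u (n + k)%nat)%R).
  { intros n k. induction k as [|k IH]; [rewrite Nat.add_0_r; lra|].
    rewrite Nat.add_succ_r. specialize (Hu (n + k)%nat). lra. }
  assert (Mv : forall n k, (v (n + k)%nat <= v n)%R).
  { intros n k. induction k as [|k IH]; [rewrite Nat.add_0_r; lra|].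
    rewrite Nat.add_succ_r. specialize (Hv (n + k)%nat). lra. }
  assert (Hle : forall n m, (u n <= v m)%R).
  { intros n m. specialize (Mu n m). specialize (Mv m n). specialize (Huv (n + m)%nat).
    rewrite (Nat.add_comm m n) in Mv. lra. }
  destruct (completeness (fun x => exists n, x = u n)) as [x [Hub Hlub]].
  - exists (v 0%nat). intros x [n ->]. apply Hle.
  - now exists (u 0%nat), 0%nat.
  - exists x. intros n. split.
    + apply Hub. now exists n.
    + apply Hlub. intros y [m ->]. apply Hle.
Qed.

(** Bisection: if [Q] fails, it fails on one quarter, and so on along nested rectangles; these
    shrink to a point around which all small rectangles satisfy [Q]. *)
Lemma rectangle_induction (Q : R -> R -> R -> R -> Prop) (a b c d : R) :
  (a <= b)%R -> (c <= d)%R ->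
  (forall a' b' c' d', a <= a' <= b' -> b' <= b -> c <= c' <= d' -> d' <= d ->
     let m := ((a' + b') / 2)%R in let n := ((c' + d') / 2)%R in
     Q a' m c' n -> Q m b' c' n -> Q a' m n d' -> Q m b' n d' -> Q a' b' c' d')%R ->
  (forall x y, a <= x <= b -> c <= y <= d -> exists delta, 0 < delta /\
     forall a' b' c' d', a <= a' <= x -> x <= b' <= b -> c <= c' <= y -> y <= d' <= d ->
       b' - a' < delta -> d' - c' < delta -> Q a' b' c' d')%R ->
  Q a b c d.
Proof.
  intros Hab Hcd Hsplit Hloc. apply NNPP. intros Hbad.
  (* Bad rectangles are packed with their proof of badness, so that choice yields a total bisection
     step to iterate. *)
  pose (inv := fun r : (R * R) * (R * R) =>
    let '((a', b'), (c', d')) := r in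
    ((a <= a' <= b' /\ b' <= b /\ c <= c' <= d' /\ d' <= d) /\ ~ Q a' b' c' d')%R).
  assert (Hstep : forall r : {r | inv r}, exists r' : {r | inv r},
    let '((a1, b1), (c1, d1)) := proj1_sig r in
    let '((a2, b2), (c2, d2)) := proj1_sig r' in
    (a1 <= a2 /\ b2 <= b1 /\ c1 <= c2 /\ d2 <= d1 /\
     b2 - a2 = (b1 - a1) / 2 /\ d2 - c2 = (d1 - c1) / 2)%R).
  { intros [[[a1 b1] [c1 d1]] [[H1 [H2 [H3 H4]]] Hn]].
    set (m := ((a1 + b1) / 2)%R). set (n := ((c1 + d1) / 2)%R).
    assert (Hm : (a1 <= m <= b1 /\ m - a1 = (b1 - a1) / 2 /\ b1 - m = (b1 - a1) / 2)%R)
      by (unfold m; lra).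
    assert (Hn' : (c1 <= n <= d1 /\ n - c1 = (d1 - c1) / 2 /\ d1 - n = (d1 - c1) / 2)%R)
      by (unfold n; lra).
    assert (Hq : (~ Q a1 m c1 n \/ ~ Q m b1 c1 n \/ ~ Q a1 m n d1 \/ ~ Q m b1 n d1)).
    { apply NNPP. intros H. apply Hn. apply Hsplit; try lra; apply NNPP; tauto. }
    destruct Hq as [Hq|[Hq|[Hq|Hq]]];
    [ assert (I : inv ((a1, m), (c1, n))) | assert (I : inv ((m, b1), (c1, n)))
    | assert (I : inv ((a1, m), (n, d1))) | assert (I : inv ((m, b1), (n, d1))) ];
    try (split; [lra|easy]); exists (exist _ _ I); simpl; lra. }
  destruct (choice _ Hstep) as [step Hs].
  assert (I0 : inv ((a, b), (c, d))) by (split; [lra|easy]).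
  pose (r := fun n => Nat.iter n step (exist _ _ I0)).
  pose (A := fun n => fst (fst (proj1_sig (r n)))). pose (B := fun n => snd (fst (proj1_sig (r n)))).
  pose (C' := fun n => fst (snd (proj1_sig (r n)))). pose (D := fun n => snd (snd (proj1_sig (r n)))).
  assert (Hr : forall n, (A n <= A (S n) /\ B (S n) <= B n /\ C' n <= C' (S n) /\ D (S n) <= D n /\
     B (S n) - A (S n) = (B n - A n) / 2 /\ D (S n) - C' (S n) = (D n - C' n) / 2)%R).
  { intros n. unfold A, B, C', D. change (r (S n)) with (step (r n)).
    specialize (Hs (r n)).
    destruct (proj1_sig (r n)) as [[a1 b1] [c1 d1]].
    destruct (proj1_sig (step (r n))) as [[a2 b2] [c2 d2]]. exact Hs. }
  assert (Hi : forall n, (a <= A n <= B n /\ B n <= b /\ c <= C' n <= D n /\ D n <= d)%R /\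
     ~ Q (A n) (B n) (C' n) (D n)).
  { intros n. unfold A, B, C', D. destruct (r n) as [[[a1 b1] [c1 d1]] I]. exact I. }
  assert (Hw : forall n, (B n - A n = (b - a) * (/ 2) ^ n /\ D n - C' n = (d - c) * (/ 2) ^ n)%R).
  { induction n as [|n IH].
    - unfold A, B, C', D, r. simpl. lra.
    - destruct (Hr n) as [_ [_ [_ [_ [E1 E2]]]]]. simpl. lra. }
  destruct (nested_intervals A B) as [x Hx];
    [apply Hr|apply Hr|intros n; destruct (Hi n); lra|].
  destruct (nested_intervals C' D) as [y Hy];
    [apply Hr|apply Hr|intros n; destruct (Hi n); lra|].
  destruct (Hloc x y) as [delta [Hdelta HQ]].
  { specialize (Hx 0%nat). destruct (Hi 0%nat). lra. }
  { specialize (Hy 0%nat). destruct (Hi 0%nat). lra. }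
  (* The added 1 keeps the denominator positive for a degenerate rectangle. *)
  destruct (pow_lt_1_zero (/ 2) ltac:(rewrite Rabs_pos_eq; lra)
    (delta / (b - a + (d - c) + 1))%R ltac:(apply Rdiv_lt_0_compat; lra)) as [N HN].
  specialize (HN N (le_n N)).
  rewrite Rabs_pos_eq in HN by (apply pow_le; lra).
  assert (Hp : (0 < (/ 2) ^ N)%R) by (apply pow_lt; lra).
  assert (Hs1 : ((b - a + (d - c) + 1) * (/ 2) ^ N < delta)%R).
  { apply Rmult_lt_reg_l with (/ (b - a + (d - c) + 1))%R; [apply Rinv_0_lt_compat; lra|].
    rewrite <- Rmult_assoc, Rinv_l, Rmult_1_l by lra. unfold Rdiv in HN. lra. }
  specialize (Hx N). specialize (Hy N). destruct (Hi N) as [HiN Hbad'].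
  destruct (Hw N) as [E1 E2].
  apply Hbad', HQ; try lra; nra.
Qed.

Definition rect (a b c d : R) (z : C) : Prop := (a <= Re z <= b /\ c <= Im z <= d)%R.

Definition boundary_integral (F : C -> C) (a b c d : R) : C :=
  CInt (fun x => F (x, c)) a b + Ci * CInt (fun y => F (b, y)) c d
  - CInt (fun x => F (x, d)) a b - Ci * CInt (fun y => F (a, y)) c d.

Lemma ex_CInt_horizontal (F : C -> C) (a b y : R) : (a <= b)%R ->
  (forall x, (a <= x <= b)%R -> ccont F (x, y)) ->
  ex_RInt (V := C_R_NormedModule) (fun x => F (x, y)) a b.
Proof.
  intros Hab H. apply ex_CInt_continuous; [easy|]. intros t Ht.
  apply (continuous_ccont_comp F (fun x => (x, y))); [|now apply H].
  apply continuous_pair_fun; [apply continuous_id|apply continuous_const].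
Qed.

Lemma ex_CInt_vertical (F : C -> C) (c d x : R) : (c <= d)%R ->
  (forall y, (c <= y <= d)%R -> ccont F (x, y)) ->
  ex_RInt (V := C_R_NormedModule) (fun y => F (x, y)) c d.
Proof.
  intros Hab H. apply ex_CInt_continuous; [easy|]. intros t Ht.
  apply (continuous_ccont_comp F (fun y => (x, y))); [|now apply H].
  apply continuous_pair_fun; [apply continuous_const|apply continuous_id].
Qed.

Lemma boundary_integral_split (F : C -> C) (a b c d m n : R) :
  (a <= m <= b)%R -> (c <= n <= d)%R -> (forall z, rect a b c d z -> ccont F z) ->
  boundary_integral F a b c d =
    boundary_integral F a m c n + boundary_integral F m b c n +
    boundary_integral F a m n d + boundary_integral F m b n d.
Proof.
  intros Hm Hn HF. unfold boundary_integral.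
  assert (HH : forall y, (c <= y <= d)%R ->
    CInt (fun x => F (x, y)) a b = CInt (fun x => F (x, y)) a m + CInt (fun x => F (x, y)) m b).
  { intros y Hy. symmetry. apply (RInt_Chasles (V := C_R_CompleteNormedModule));
    apply ex_CInt_horizontal; try lra; intros x Hx; apply HF; split; simpl; lra. }
  assert (HV : forall x, (a <= x <= b)%R ->
    CInt (fun y => F (x, y)) c d = CInt (fun y => F (x, y)) c n + CInt (fun y => F (x, y)) n d).
  { intros y Hy. symmetry. apply (RInt_Chasles (V := C_R_CompleteNormedModule));
    apply ex_CInt_vertical; try lra; intros x Hx; apply HF; split; simpl; lra. }
  rewrite (HH c), (HH d), (HV a), (HV b) by lra. ring.
Qed.

Lemma is_RInt_id (a b : R) : is_RInt (fun x => x) a b ((b * b - a * a) / 2)%R.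
Proof.
  replace ((b * b - a * a) / 2)%R with (minus (b * b / 2) (a * a / 2))%R
    by (unfold minus, plus, opp; simpl; lra).
  apply (is_RInt_derive (V := R_CompleteNormedModule) (fun x => x * x / 2)%R (fun x => x)).
  - intros x _. auto_derive; [easy|]. field.
  - intros x _. apply continuous_id.
Qed.

Lemma is_CInt_affine_horizontal (k l : C) (a b y : R) :
  is_CInt (fun x => k + l * (x, y)) a b
    (RtoC (b - a) * k + l * ((b * b - a * a) / 2, (b - a) * y)%R).
Proof.
  apply is_CInt_plus; [apply is_CInt_const|]. apply is_CInt_scal.
  apply is_CInt_pair; [apply is_RInt_id|].
  apply (is_RInt_const (V := R_NormedModule)).
Qed.

Lemma is_CInt_affine_vertical (k l : C) (c d x : R) :
  is_CInt (fun y => k + l * (x, y)) c d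
    (RtoC (d - c) * k + l * ((d - c) * x, (d * d - c * c) / 2)%R).
Proof.
  apply is_CInt_plus; [apply is_CInt_const|]. apply is_CInt_scal.
  apply is_CInt_pair; [|apply is_RInt_id].
  apply (is_RInt_const (V := R_NormedModule)).
Qed.

(* The affine part of [F] integrates to zero, so only the error term counts. *)
Lemma boundary_integral_bound (F : C -> C) (a b c d : R) (k l : C) (eta : R) :
  (a <= b)%R -> (c <= d)%R -> (forall z, rect a b c d z -> ccont F z) ->
  (forall z, rect a b c d z -> Cmod (F z - (k + l * z)) <= eta)%R ->
  (Cmod (boundary_integral F a b c d) <= 2 * (b - a + (d - c)) * eta)%R.
Proof.
  intros Hab Hcd HF Heta.
  assert (HH : forall y, (c <= y <= d)%R ->
    (Cmod (CInt (fun x => F (x, y)) a b -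
      (RtoC (b - a) * k + l * ((b * b - a * a) / 2, (b - a) * y)%R)) <= (b - a) * eta)%R).
  { intros y Hy.
    apply (is_CInt_bound (fun x => F (x, y) - (k + l * (x, y)))); [easy| |].
    - intros t Ht. apply Heta. split; simpl; lra.
    - apply is_CInt_minus; [|apply is_CInt_affine_horizontal].
      apply CInt_correct, ex_CInt_horizontal; [easy|].
      intros x Hx. apply HF. split; simpl; lra. }
  assert (HV : forall x, (a <= x <= b)%R ->
    (Cmod (CInt (fun y => F (x, y)) c d -
      (RtoC (d - c) * k + l * ((d - c) * x, (d * d - c * c) / 2)%R)) <= (d - c) * eta)%R).
  { intros x Hx.
    apply (is_CInt_bound (fun y => F (x, y) - (k + l * (x, y)))); [easy| |].
    - intros t Ht. apply Heta. split; simpl; lra.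
    - apply is_CInt_minus; [|apply is_CInt_affine_vertical].
      apply CInt_correct, ex_CInt_vertical; [easy|].
      intros y Hy. apply HF. split; simpl; lra. }
  assert (H1 := HH c ltac:(lra)). assert (H2 := HH d ltac:(lra)).
  assert (H3 := HV b ltac:(lra)). assert (H4 := HV a ltac:(lra)).
  unfold boundary_integral.
  set (I1 := CInt _ a b) in *. set (I2 := CInt (fun x => F (x, d)) a b) in *.
  set (I3 := CInt (fun y => F (b, y)) c d) in *. set (I4 := CInt (fun y => F (a, y)) c d) in *.
  set (J1 := RtoC (b - a) * k + l * ((b * b - a * a) / 2, (b - a) * c)%R) in *.
  set (J2 := RtoC (b - a) * k + l * ((b * b - a * a) / 2, (b - a) * d)%R) in *.
  set (J3 := RtoC (d - c) * k + l * ((d - c) * b, (d * d - c * c) / 2)%R) in *.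
  set (J4 := RtoC (d - c) * k + l * ((d - c) * a, (d * d - c * c) / 2)%R) in *.
  assert (E : J1 + Ci * J3 - J2 - Ci * J4 = 0).
  { unfold J1, J2, J3, J4. destruct k as [k1 k2], l as [l1 l2].
    apply injective_projections; simpl; field. }
  replace (I1 + Ci * I3 - I2 - Ci * I4)
    with ((I1 - J1) + (Ci * (I3 - J3) + (- (I2 - J2) + Ci * (- (I4 - J4))))
          + (J1 + Ci * J3 - J2 - Ci * J4)) by ring.
  rewrite E, Cplus_0_r.
  eapply Rle_trans; [apply Cmod_triangle|].
  eapply Rle_trans; [apply Rplus_le_compat_l, Cmod_triangle|].
  eapply Rle_trans; [apply Rplus_le_compat_l, Rplus_le_compat_l, Cmod_triangle|].
  rewrite !Cmod_mult, !Cmod_Ci, !Cmod_opp. lra.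
Qed.

(** With [p] the half-perimeter, the bound [2 * eps * p^2] is reproduced by bisection, as four
    quarters contribute [4 * (p / 2)^2]. On a small rectangle it holds because [F] differs from an
    affine function by at most [eps * p]. *)
Theorem goursat (F : C -> C) (a b c d : R) : (a <= b)%R -> (c <= d)%R ->
  (forall z, rect a b c d z -> cdiff F z) -> boundary_integral F a b c d = 0.
Proof.
  intros Hab Hcd HF.
  assert (HC : forall z, rect a b c d z -> ccont F z) by (intros; now apply cdiff_ccont, HF).
  apply Cmod_eq_0. apply Rle_antisym; [|apply Cmod_ge_0].
  set (p := (b - a + (d - c))%R). assert (Hp : (0 <= p)%R) by (unfold p; lra).
  apply Rnot_lt_le. intros Hpos.
  set (B := Cmod (boundary_integral F a b c d)) in *.
  (* This makes [2 * eps * p^2] smaller than [B], contradicting the bound of the induction. *)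
  set (eps := (B / (4 * (p * p + 1)))%R).
  assert (He : (0 < eps)%R) by (apply Rdiv_lt_0_compat; nra).
  assert (Heps : (eps * (4 * (p * p + 1)) = B)%R) by (unfold eps; field; nra).
  assert (HQ : (B <= 2 * eps * (p * p))%R); [|nra].
  apply (rectangle_induction (fun a b c d =>
    Cmod (boundary_integral F a b c d) <= 2 * eps * ((b - a + (d - c)) * (b - a + (d - c))))%R);
    [easy|easy| |].
  - intros a' b' c' d' H1 H2 H3 H4 m n Q1 Q2 Q3 Q4.
    assert (Hm : (a' <= m <= b')%R) by (unfold m; lra).
    assert (Hn : (c' <= n <= d')%R) by (unfold n; lra).
    rewrite (boundary_integral_split F a' b' c' d' m n Hm Hn)
      by (intros z [Hz1 Hz2]; apply HC; split; lra).
    eapply Rle_trans; [apply Cmod_triangle|].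
    eapply Rle_trans; [apply Rplus_le_compat_r, Cmod_triangle|].
    eapply Rle_trans; [apply Rplus_le_compat_r, Rplus_le_compat_r, Cmod_triangle|].
    replace (m - a')%R with ((b' - a') / 2)%R in * by (unfold m; field).
    replace (b' - m)%R with ((b' - a') / 2)%R in * by (unfold m; field).
    replace (n - c')%R with ((d' - c') / 2)%R in * by (unfold n; field).
    replace (d' - n)%R with ((d' - c') / 2)%R in * by (unfold n; field).
    lra.
  - intros x y Hx Hy.
    destruct (HF (x, y)) as [phi [Hphi E]]; [split; simpl; lra|].
    destruct (Hphi eps He) as [delta [Hdelta Hd]].
    exists (delta / 2)%R. split; [lra|].
    intros a' b' c' d' H1 H2 H3 H4 H5 H6.
    set (q := (b' - a' + (d' - c'))%R).
    replace (2 * eps * (q * q))%R with (2 * q * (eps * q))%R by ring.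
    apply (boundary_integral_bound F a' b' c' d'
      (F (x, y) - phi (x, y) * (x, y)) (phi (x, y))); [lra|lra| |].
    + intros z [Hz1 Hz2]; apply HC; split; lra.
    + intros [u v] [Hz1 Hz2]. simpl in Hz1, Hz2.
      assert (Hle : (Cmod ((u, v) - (x, y)) <= q)%R).
      { eapply Rle_trans; [apply (Cmod_le_abs_sum (u - x) (v - y))|].
        unfold q. apply Rplus_le_compat; apply Rabs_le; lra. }
      replace (F (u, v) - (F (x, y) - phi (x, y) * (x, y) + phi (x, y) * (u, v)))
        with ((phi (u, v) - phi (x, y)) * ((u, v) - (x, y)))
        by (rewrite (E (u, v)); ring).
      rewrite Cmod_mult. apply Rmult_le_compat; try apply Cmod_ge_0; [|easy].
      left. apply Hd. unfold q in Hle. lra.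
Qed.

(** * The complex exponential *)

Definition cexp (z : C) : C := (exp (Re z) * cos (Im z), exp (Re z) * sin (Im z))%R.

Lemma cexp_plus (z w : C) : cexp (z + w) = cexp z * cexp w.
Proof.
  destruct z as [a b], w as [c d]. unfold cexp. simpl.
  rewrite exp_plus, cos_plus, sin_plus.
  apply injective_projections; simpl; ring.
Qed.

Lemma cexp_0 : cexp 0 = 1.
Proof.
  unfold cexp. simpl. rewrite exp_0, cos_0, sin_0.
  apply injective_projections; simpl; ring.
Qed.

Lemma Cmod_cexp (z : C) : Cmod (cexp z) = exp (Re z).
Proof.
  unfold Cmod, cexp. simpl fst. simpl snd.
  replace ((exp (Re z) * cos (Im z)) ^ 2 + (exp (Re z) * sin (Im z)) ^ 2)%R
    with (exp (Re z) * exp (Re z) * (Rsqr (sin (Im z)) + Rsqr (cos (Im z))))%R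
    by (unfold Rsqr; ring).
  rewrite sin2_cos2, Rmult_1_r. apply sqrt_square. left. apply exp_pos.
Qed.

Lemma cexp_neq0 (z : C) : cexp z <> 0.
Proof. apply Cmod_gt_0. rewrite Cmod_cexp. apply exp_pos. Qed.

Lemma cexp_period (x : R) : cexp (x, 2 * PI)%R = cexp (x, 0%R).
Proof. unfold cexp. simpl. now rewrite cos_2PI, sin_2PI, cos_0, sin_0. Qed.

Lemma cexp_polar (s t : R) : cexp (s, t) = RtoC (exp s) * cexp (0%R, t).
Proof. unfold cexp. simpl. rewrite exp_0. apply injective_projections; simpl; ring. Qed.

Lemma unit_circle_cexp (z : C) : Cmod z = 1%R ->
  exists t, (0 <= t <= 2 * PI)%R /\ z = cexp (0%R, t).
Proof.
  intros Hz. destruct z as [x y].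
  assert (H : (x * x + y * y = 1)%R).
  { unfold Cmod in Hz. simpl in Hz.
    apply (f_equal (fun u => u * u)%R) in Hz. rewrite sqrt_sqrt in Hz by nra. lra. }
  assert (Hx : (-1 <= x <= 1)%R) by nra.
  destruct (acos_bound x) as [A1 A2].
  assert (Hs : sin (acos x) = Rabs y).
  { rewrite sin_acos by easy. rewrite <- sqrt_Rsqr_abs. f_equal. unfold Rsqr. lra. }
  destruct (Rle_lt_dec 0 y) as [Hy|Hy].
  - exists (acos x). split; [lra|]. unfold cexp. simpl.
    rewrite cos_acos, Hs, exp_0, Rabs_pos_eq by easy. f_equal; ring.
  - exists (2 * PI - acos x)%R. split; [lra|]. unfold cexp. simpl.
    rewrite cos_minus, sin_minus, cos_2PI, sin_2PI, cos_acos, Hs, exp_0, Rabs_left by easy.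
    f_equal; ring.
Qed.

Lemma nonzero_cexp (z : C) : z <> 0 -> exists t, z = cexp (ln (Cmod z), t).
Proof.
  intros Hz. assert (Hp := proj1 (Cmod_gt_0 z) Hz).
  destruct (unit_circle_cexp (z / RtoC (Cmod z))) as [t [_ E]].
  - rewrite Cmod_div by (apply Cmod_gt_0; rewrite Cmod_R, Rabs_pos_eq; lra).
    rewrite Cmod_R, Rabs_pos_eq by lra. field. lra.
  - exists t. rewrite cexp_polar, exp_ln, <- E by easy. field.
    intros E'. apply RtoC_inj in E'. lra.
Qed.

Lemma abs_sin_le (u : R) : (Rabs (sin u) <= Rabs u)%R.
Proof.
  destruct (MVT_gen sin 0 u cos) as [c [_ E]].
  - intros x _. apply is_derive_Reals, derivable_pt_lim_sin.
  - intros x _. apply continuity_sin.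
  - rewrite sin_0, !Rminus_0_r in E. rewrite E, Rabs_mult.
    rewrite <- (Rmult_1_l (Rabs u)) at 2. apply Rmult_le_compat_r; [apply Rabs_pos|].
    apply Rabs_le. apply COS_bound.
Qed.

Lemma one_minus_cos_bound (u : R) : (0 <= 1 - cos u <= u * u / 2)%R.
Proof.
  replace u with (2 * (u / 2))%R at 1 2 by field. rewrite cos_2a_sin.
  assert (H := abs_sin_le (u / 2)). assert (H0 := Rabs_pos (sin (u / 2))).
  assert (E1 := Rsqr_abs (sin (u / 2))). assert (E2 := Rsqr_abs (u / 2)).
  unfold Rsqr in E1, E2. nra.
Qed.

Lemma sin_minus_id_bound (u : R) : (Rabs (sin u - u) <= Rabs u * (u * u))%R.
Proof.
  destruct (MVT_gen sin 0 u cos) as [c [Hc E]].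
  - intros x _. apply is_derive_Reals, derivable_pt_lim_sin.
  - intros x _. apply continuity_sin.
  - rewrite sin_0, !Rminus_0_r in E. rewrite E.
    replace (cos c * u - u)%R with (- ((1 - cos c) * u))%R by ring.
    rewrite Rabs_Ropp, Rabs_mult, Rmult_comm.
    apply Rmult_le_compat_l; [apply Rabs_pos|].
    destruct (one_minus_cos_bound c) as [H1 H2].
    rewrite Rabs_pos_eq by easy.
    unfold Rmin, Rmax in Hc. destruct (Rle_dec 0 u); nra.
Qed.

(** The upper bound comes from [1 - x <= exp (- x)], that is [exp x <= 1 / (1 - x)]. *)
Lemma exp_minus_affine_bound (x : R) : (Rabs x <= / 2)%R ->
  (0 <= exp x - 1 - x <= 2 * (x * x))%R.
Proof.
  intros Hx. apply Rabs_le_between in Hx.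
  assert (H1 := exp_ineq1_le x). assert (H2 := exp_ineq1_le (- x)).
  rewrite exp_Ropp in H2. assert (Hp := exp_pos x).
  split; [lra|].
  assert (H : (exp x * (1 - x) <= 1)%R).
  { apply Rle_trans with (exp x * / exp x)%R; [|rewrite Rinv_r; lra].
    apply Rmult_le_compat_l; lra. }
  nra.
Qed.

Lemma cexp_minus_affine_bound (z : C) : (Cmod z <= / 2)%R ->
  (Cmod (cexp z - 1 - z) <= 6 * (Cmod z * Cmod z))%R.
Proof.
  intros Hz. destruct z as [x y]. set (r := Cmod (x, y)) in *.
  assert (Hx : (Rabs x <= r)%R) by apply (re_le_Cmod (x, y)).
  assert (Hy : (Rabs y <= r)%R) by apply (im_le_Cmod (x, y)).
  assert (P6 : (0 <= r)%R) by apply Cmod_ge_0.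
  assert (H1 := exp_minus_affine_bound x ltac:(lra)).
  assert (H2 := one_minus_cos_bound y). assert (H3 := sin_minus_id_bound y).
  (* With [exp x] written as [1 + x + (exp x - 1 - x)], the parts are
     [(exp x - 1 - x) - exp x (1 - cos y)] and [exp x (sin y - y) + (exp x - 1) y]. The four terms
     are at most [2 r^2], [r^2], [r^2] and [2 r^2], whence the constant 6. *)
  replace (cexp (x, y) - 1 - (x, y))
    with ((exp x - 1 - x) + (- ((1 + x + (exp x - 1 - x)) * (1 - cos y))),
       ((1 + x + (exp x - 1 - x)) * (sin y - y)) + (x + (exp x - 1 - x)) * y)%R
    by (unfold cexp; apply injective_projections; simpl; ring).
  eapply Rle_trans; [apply Cmod_le_abs_sum|].
  eapply Rle_trans; [apply Rplus_le_compat; apply Rabs_triang|].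
  rewrite Rabs_Ropp, !Rabs_mult.
  assert (Ex : (Rabs (exp x - 1 - x) <= 2 * (r * r))%R).
  { rewrite Rabs_pos_eq by lra.
    assert (E := Rsqr_abs x). unfold Rsqr in E. assert (P := Rabs_pos x). nra. }
  assert (Ec : (Rabs (1 - cos y) <= r * r / 2)%R).
  { rewrite Rabs_pos_eq by lra.
    assert (E := Rsqr_abs y). unfold Rsqr in E. assert (P := Rabs_pos y). nra. }
  assert (Es : (Rabs (sin y - y) <= r * r / 2)%R).
  { assert (E := Rsqr_abs y). unfold Rsqr in E. assert (P := Rabs_pos y). nra. }
  assert (E0 : (Rabs (1 + x + (exp x - 1 - x)) <= 2)%R).
  { replace (1 + x + (exp x - 1 - x))%R with (exp x) by ring.
    rewrite Rabs_pos_eq by (left; apply exp_pos).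
    apply Rabs_le_between in Hx. nra. }
  assert (E1 : (Rabs (x + (exp x - 1 - x)) <= 2 * r)%R).
  { eapply Rle_trans; [apply Rabs_triang|]. nra. }
  assert (P1 := Rabs_pos (1 + x + (exp x - 1 - x))). assert (P2 := Rabs_pos (1 - cos y)).
  assert (P3 := Rabs_pos (sin y - y)). assert (P4 := Rabs_pos (x + (exp x - 1 - x))).
  assert (P5 := Rabs_pos y).
  assert (T1 : (Rabs (1 + x + (exp x - 1 - x)) * Rabs (1 - cos y) <= 2 * (r * r / 2))%R)
    by (apply Rmult_le_compat; easy).
  assert (T2 : (Rabs (1 + x + (exp x - 1 - x)) * Rabs (sin y - y) <= 2 * (r * r / 2))%R)
    by (apply Rmult_le_compat; easy).
  assert (T3 : (Rabs (x + (exp x - 1 - x)) * Rabs y <= 2 * r * r)%R)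
    by (apply Rmult_le_compat; easy).
  lra.
Qed.

Lemma has_slope_cexp (z : C) : has_slope cexp (fun w => cexp z * slope cexp 1 0 (w - z)) z.
Proof.
  split.
  - apply ccont_mult; [apply ccont_const|].
    apply (ccont_comp (slope cexp 1 0) (fun w => w - z)).
    + apply ccont_minus; [apply ccont_id|apply ccont_const].
    + rewrite Cminus_diag. intros eps He.
      exists (Rmin (/ 2) (eps / 6)). split; [apply Rmin_glb_lt; lra|].
      intros h Hh. rewrite slope_diag.
      destruct (Ceq_dec h 0) as [->|Hn].
      { rewrite slope_diag, Cminus_diag, Cmod_0. easy. }
      rewrite slope_neq, cexp_0 by easy.
      replace (h - 0) with h in * by ring.
      assert (Hp := proj1 (Cmod_gt_0 h) Hn).
      assert (H1 := Rlt_le_trans _ _ _ Hh (Rmin_l _ _)).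
      assert (H2 := Rlt_le_trans _ _ _ Hh (Rmin_r _ _)).
      assert (H := cexp_minus_affine_bound h ltac:(lra)).
      replace ((cexp h - 1) / h - 1) with ((cexp h - 1 - h) / h) by (field; easy).
      rewrite Cmod_div by easy.
      apply Rle_lt_trans with (6 * Cmod h)%R; [|lra].
      apply Rmult_le_reg_r with (Cmod h); [easy|].
      unfold Rdiv. rewrite Rmult_assoc, Rinv_l, Rmult_1_r by lra. lra.
  - intros w.
    assert (E := slope_eq cexp 1 0 (w - z)). rewrite cexp_0 in E.
    replace w with (z + (w - z)) at 1 by ring. rewrite cexp_plus, E. ring.
Qed.

Lemma cdiff_cexp (z : C) : cdiff cexp z.
Proof. eexists. apply has_slope_cexp. Qed.

(** * The mean value property and the maximum principle *)

(** A difference quotient is continuous at its base point but not known to be differentiable there.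
    Allowing one exceptional point in a neighbourhood replaces the theorem on removable
    singularities. *)
Definition holo_except (h : C -> C) (z : C) : Prop :=
  ccont h z /\ exists r, (0 < r)%R /\
    forall w, w <> z -> (Cmod (w - z) < r)%R -> cdiff h w.

Lemma holo_except_cdiff (h : C -> C) (z : C) (d : R) : (0 < d)%R ->
  (forall w, (Cmod (w - z) < d)%R -> cdiff h w) -> holo_except h z.
Proof.
  intros Hd H. split.
  - apply cdiff_ccont, H. now rewrite Cminus_diag, Cmod_0.
  - exists d. auto.
Qed.

Lemma continuous_circle (h : C -> C) (a : C) (s t : R) :
  ccont h (a + cexp (s, t)) ->
  continuous (U := C_UniformSpace) (fun t => h (a + cexp (s, t))) t.
Proof.
  intros H.
  apply (continuous_ccont_comp (fun w => h (a + cexp w)) (fun t => (s, t))).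
  - apply continuous_pair_fun; [apply continuous_const|apply continuous_id].
  - apply (ccont_comp h (fun w => a + cexp w)); [|easy].
    apply ccont_plus; [apply ccont_const|apply cdiff_ccont, cdiff_cexp].
Qed.

(** Goursat's theorem for [h (a + cexp w)] on a rectangle of height [2 * PI]: the horizontal sides
    cancel by periodicity, so the integral over a circle does not depend on its radius. Letting the
    radius tend to 0 uses only continuity at [a]. *)
Lemma circle_mean (h : C -> C) (a : C) (r s : R) : ccont h a ->
  (forall z, z <> a -> (Cmod (z - a) < r)%R -> cdiff h z) -> (exp s < r)%R ->
  is_CInt (fun t => h (a + cexp (s, t))) 0 (2 * PI) (RtoC (2 * PI) * h a).
Proof.
  intros Hc Hd Hs. assert (HPI := PI_RGT_0).
  assert (Hmod : forall w, Cmod (a + cexp w - a) = exp (Re w)).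
  { intros w. replace (a + cexp w - a) with (cexp w) by ring. apply Cmod_cexp. }
  assert (Hne : forall w, a + cexp w <> a).
  { intros w E. apply (cexp_neq0 w). replace (cexp w) with (a + cexp w - a) by ring.
    rewrite E. ring. }
  set (F := fun w => h (a + cexp w)).
  assert (HF : forall w, (Re w <= s)%R -> cdiff F w).
  { intros w Hw. apply (cdiff_comp h (fun w => a + cexp w)).
    - apply cdiff_plus; [apply cdiff_const|apply cdiff_cexp].
    - apply Hd; [apply Hne|]. rewrite Hmod.
      destruct Hw as [Hw| ->]; [|easy]. apply exp_increasing in Hw. lra. }
  assert (Hcancel : forall A B D : C, A + Ci * B - A - Ci * D = 0 -> D = B).
  { intros A B D E. replace B with (- Ci * (A + Ci * B - A - Ci * D) + D)
      by (destruct A, B, D; apply injective_projections; simpl; ring).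
    rewrite E. ring. }
  assert (HI : forall s', (s' <= s)%R ->
    is_CInt (fun t => F (s', t)) 0 (2 * PI) (CInt (fun t => F (s, t)) 0 (2 * PI))).
  { intros s' Hs'.
    replace (CInt (fun t => F (s, t)) 0 (2 * PI)) with (CInt (fun t => F (s', t)) 0 (2 * PI)).
    - apply CInt_correct, ex_CInt_vertical; [lra|]. intros y _.
      apply cdiff_ccont, HF. easy.
    - assert (G := goursat F s' s 0 (2 * PI) Hs' ltac:(lra)
        ltac:(intros z [Hz _]; apply HF; lra)).
      unfold boundary_integral in G.
      rewrite (RInt_ext (V := C_R_CompleteNormedModule)
        (fun x => F (x, 2 * PI)%R) (fun x => F (x, 0%R))) in G
        by (intros x _; unfold F; now rewrite cexp_period).
      exact (Hcancel _ _ _ G). }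
  replace (RtoC (2 * PI) * h a) with (CInt (fun t => F (s, t)) 0 (2 * PI)).
  { now apply HI; right. }
  set (I := CInt (fun t => F (s, t)) 0 (2 * PI)) in *.
  assert (HE : forall eps, (0 < eps)%R -> (Cmod (I - RtoC (2 * PI) * h a) <= (2 * PI - 0) * eps)%R).
  { intros eps He. destruct (Hc eps He) as [d [Hd' H]].
    set (s' := Rmin s (ln (d / 2))).
    assert (Hs' : (exp s' < d)%R).
    { apply Rle_lt_trans with (d / 2)%R; [|lra].
      rewrite <- (exp_ln (d / 2)) by lra.
      destruct (Rmin_r s (ln (d / 2))) as [Hl|Hl]; unfold s'.
      - left. now apply exp_increasing.
      - rewrite Hl. lra. }
    replace (RtoC (2 * PI)) with (RtoC (2 * PI - 0)) by (f_equal; ring).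
    apply (is_CInt_bound (fun t => F (s', t) - h a)); [lra| |].
    - intros t _. left. apply H. now rewrite Hmod.
    - apply is_CInt_minus; [|apply is_CInt_const]. apply HI, Rmin_l. }
  assert (E0 : Cmod (I - RtoC (2 * PI) * h a) = 0%R).
  { apply Rle_antisym; [|apply Cmod_ge_0]. apply Rnot_lt_le. intros Hpos.
    set (m := Cmod (I - RtoC (2 * PI) * h a)) in *.
    specialize (HE (m / (4 * PI))%R ltac:(apply Rdiv_lt_0_compat; lra)).
    replace ((2 * PI - 0) * (m / (4 * PI)))%R with (m / 2)%R in HE by (field; lra). lra. }
  apply Cmod_eq_0 in E0.
  replace I with (I - RtoC (2 * PI) * h a + RtoC (2 * PI) * h a) by ring. rewrite E0. apply Cplus_0_l.
Qed.

Lemma integral_zero_pointwise (u : R -> R) (a b : R) : (a < b)%R ->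
  (forall t, (a <= t <= b)%R -> continuous u t /\ (0 <= u t)%R) ->
  is_RInt u a b 0%R -> forall t, (a <= t <= b)%R -> u t = 0%R.
Proof.
  intros Hab Hu HI t Ht. apply Rle_antisym; [|now apply Hu].
  apply Rnot_lt_le. intros Hpos.
  destruct (Hu t Ht) as [Hc _].
  assert (He : (0 < u t / 2)%R) by lra.
  destruct (proj1 (filterlim_locally _ _) Hc (mkposreal _ He)) as [d Hd].
  assert (Hdp := cond_pos d).
  set (p := Rmax a (t - d / 2)). set (q := Rmin b (t + d / 2)).
  assert (Hp : (a <= p /\ t - d / 2 <= p /\ p <= t)%R)
    by (unfold p; split; [apply Rmax_l|split; [apply Rmax_r|apply Rmax_lub; lra]]).
  assert (Hq : (q <= b /\ q <= t + d / 2 /\ t <= q)%R)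
    by (unfold q; split; [apply Rmin_l|split; [apply Rmin_r|apply Rmin_glb; lra]]).
  assert (Hpq : (p < q)%R).
  { unfold p, q. apply Rmax_lub_lt; apply Rmin_glb_lt; lra. }
  assert (Hex : forall x y, (a <= x)%R -> (x <= y)%R -> (y <= b)%R -> ex_RInt u x y).
  { intros x y H1 H2 H3. apply (ex_RInt_continuous (V := R_CompleteNormedModule)).
    rewrite Rmin_left, Rmax_right by easy. intros z Hz. apply Hu. lra. }
  assert (H1 : (0 <= RInt u a p)%R)
    by (apply RInt_ge_0; [lra|apply Hex; lra|intros x Hx; apply Hu; lra]).
  assert (H2 : (0 <= RInt u q b)%R)
    by (apply RInt_ge_0; [lra|apply Hex; lra|intros x Hx; apply Hu; lra]).
  assert (H3 : ((q - p) * (u t / 2) <= RInt u p q)%R).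
  { apply Rle_trans with (RInt (fun _ => u t / 2)%R p q).
    { rewrite RInt_const. apply Rle_refl. }
    apply RInt_le; [lra|apply ex_RInt_const|apply Hex; lra|].
    intros x Hx. assert (Hb : ball t d x).
    { change (Rabs (x - t) < d)%R. apply Rabs_lt_between. lra. }
    specialize (Hd x Hb). change (Rabs (u x - u t) < u t / 2)%R in Hd.
    apply Rabs_lt_between in Hd. lra. }
  assert (E := is_RInt_unique _ _ _ _ HI).
  rewrite <- (RInt_Chasles u a p b), <- (RInt_Chasles u p q b) in E
    by (apply Hex; lra).
  unfold plus in E. simpl in E. nra.
Qed.

(** The function [Re (conj (h a) * (h a - h))] is nonnegative on a circle about [a] and has mean 0,
    so it vanishes. Then [|h z - h a|^2 = |h z|^2 - |h a|^2 <= 0]; the case [h a = 0] needs no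
    separate treatment. *)
Lemma local_maximum_principle (h : C -> C) (a : C) (r : R) : ccont h a ->
  (forall z, z <> a -> (Cmod (z - a) < r)%R -> cdiff h z) ->
  (forall z, (Cmod (z - a) < r)%R -> (Cmod (h z) <= Cmod (h a))%R) ->
  forall z, (Cmod (z - a) < r)%R -> h z = h a.
Proof.
  intros Hc Hd Hmax z Hz. assert (HPI := PI_RGT_0).
  destruct (Ceq_dec z a) as [->|Hne]; [easy|].
  assert (Hza := Cminus_neq0 _ _ Hne).
  assert (Hpos := proj1 (Cmod_gt_0 _) Hza).
  destruct (unit_circle_cexp ((z - a) / RtoC (Cmod (z - a)))) as [t [Ht Et]].
  { rewrite Cmod_div by (apply Cmod_gt_0; rewrite Cmod_R, Rabs_pos_eq; lra).
    rewrite Cmod_R, Rabs_pos_eq by lra. field. lra. }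
  set (s := ln (Cmod (z - a))).
  assert (Ez : z = a + cexp (s, t)).
  { unfold s. rewrite cexp_polar, exp_ln, <- Et by easy. field.
    intros E. apply RtoC_inj in E. lra. }
  assert (Es : exp s = Cmod (z - a)) by (unfold s; now apply exp_ln).
  assert (Hin : forall t, (Cmod (a + cexp (s, t) - a) < r)%R).
  { intros y. replace (a + cexp (s, y) - a) with (cexp (s, y)) by ring.
    rewrite Cmod_cexp. simpl. now rewrite Es. }
  assert (HI := circle_mean h a r s Hc Hd ltac:(now rewrite Es)).
  set (u := fun t => Re (Cconj (h a) * (h a - h (a + cexp (s, t))))).
  assert (Hu0 : u t = 0%R).
  { apply (integral_zero_pointwise u 0 (2 * PI)); [lra| | |easy].
    - intros y Hy. split.
      + assert (Hcy : continuous (U := C_UniformSpace) (fun t => Cconj (h a) * (h a - h (a + cexp (s, t)))) y).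
        { apply (continuous_circle (fun w => Cconj (h a) * (h a - h w)) a s y).
          apply ccont_mult; [apply ccont_const|].
          apply ccont_minus; [apply ccont_const|].
          apply cdiff_ccont, Hd; [|apply Hin].
          intros E. apply (cexp_neq0 (s, y)).
          replace (cexp (s, y)) with (a + cexp (s, y) - a) by ring. rewrite E. ring. }
        apply (continuous_comp _ fst); [exact Hcy|apply continuous_fst].
      + unfold u. specialize (Hmax _ (Hin y)).
        set (v := h (a + cexp (s, y))) in *.
        replace (Re (Cconj (h a) * (h a - v)))
          with (Cmod (h a) ^ 2 - Re (Cconj (h a) * v))%R.
        * assert (H1 := re_le_Cmod (Cconj (h a) * v)).
          rewrite Cmod_mult, Cmod_conj in H1.
          assert (H2 := Rle_abs (Re (Cconj (h a) * v))).
          assert (H3 := Cmod_ge_0 (h a)). nra.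
        * rewrite Cmod2_alt. destruct (h a), v. simpl. ring.
    - assert (HR : is_RInt u 0 (2 * PI)
        (Re (Cconj (h a) * (RtoC (2 * PI - 0) * h a - RtoC (2 * PI) * h a)))).
      { apply is_CInt_Re, is_CInt_scal, is_CInt_minus; [apply is_CInt_const|exact HI]. }
      replace (2 * PI - 0)%R with (2 * PI)%R in HR by ring.
      rewrite Cminus_diag, Cmult_0_r in HR. exact HR. }
  specialize (Hmax z Hz). unfold u in Hu0. rewrite <- Ez in Hu0.
  assert (Hsq : (Cmod (h z - h a) ^ 2 <= 0)%R).
  { apply Rle_trans with (Cmod (h z) ^ 2 - Cmod (h a) ^ 2)%R.
    - rewrite !Cmod2_alt. destruct (h a), (h z). simpl in *. nra.
    - assert (H1 := Cmod_ge_0 (h z)). nra. }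
  assert (H0 : Cmod (h z - h a) = 0%R) by (assert (H1 := Cmod_ge_0 (h z - h a)); nra).
  apply Cmod_eq_0 in H0. replace (h z) with (h z - h a + h a) by ring. rewrite H0. ring.
Qed.

(** Apply completeness to the [x] for which [Q] holds on all of [[0, x]]. This serves as the
    connectedness of a segment. *)
Lemma continuous_induction (Q : R -> Prop) :
  Q 0%R ->
  (forall t, (0 <= t < 1)%R -> (forall s, (0 <= s <= t)%R -> Q s) ->
     exists d, (0 < d)%R /\ forall s, (t < s < t + d)%R -> Q s) ->
  (forall t, (0 < t <= 1)%R -> (forall s, (0 <= s < t)%R -> Q s) -> Q t) ->
  forall t, (0 <= t <= 1)%R -> Q t.
Proof.
  intros H0 Hopen Hclosed.
  set (E := fun x => (0 <= x <= 1)%R /\ forall s, (0 <= s <= x)%R -> Q s).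
  destruct (completeness E) as [m [Hub Hlub]].
  { exists 1%R. intros x [Hx _]. lra. }
  { exists 0%R. split; [lra|]. intros s Hs. now replace s with 0%R by lra. }
  assert (Hm : (0 <= m <= 1)%R).
  { split.
    - apply Hub. split; [lra|]. intros s Hs. now replace s with 0%R by lra.
    - apply Hlub. intros x [Hx _]. lra. }
  assert (Hbelow : forall s, (0 <= s < m)%R -> Q s).
  { intros s Hs. apply NNPP. intros Hn.
    assert (H : (m <= s)%R); [|lra]. apply Hlub. intros x [Hx HQ].
    apply Rnot_lt_le. intros Hlt. apply Hn, HQ. lra. }
  assert (HQm : Q m).
  { destruct (Req_dec m 0) as [->|Hn]; [easy|]. apply Hclosed; [lra|easy]. }
  assert (Hle : forall s, (0 <= s <= m)%R -> Q s).
  { intros s [Hs1 [Hs2| ->]]; [apply Hbelow; lra|easy]. }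
  destruct (Req_dec m 1) as [->|Hm1]; [easy|].
  exfalso. destruct (Hopen m ltac:(lra) Hle) as [d [Hd H]].
  assert (Hx : (m + Rmin (d / 2) (1 - m) <= m)%R).
  { assert (H1 := Rmin_l (d / 2) (1 - m)). assert (H2 := Rmin_r (d / 2) (1 - m)).
    assert (H3 : (0 < Rmin (d / 2) (1 - m))%R) by (apply Rmin_glb_lt; lra).
    apply Hub. split; [lra|]. intros s Hs.
    destruct (Rle_lt_dec s m) as [Hsm|Hsm]; [apply Hle; lra|apply H; lra]. }
  assert (H3 : (0 < Rmin (d / 2) (1 - m))%R) by (apply Rmin_glb_lt; lra). lra.
Qed.

(** Equality with [u z1] spreads along the segment from [z1] to [z]: forward by the local principle,
    to limits by continuity. All its points except perhaps [z] are interior, so [z] may lie on the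
    boundary circle. *)
Lemma strong_maximum_principle (u : C -> C) (a z1 z : C) (r : R) :
  (forall w, (Cmod (w - a) < r)%R -> holo_except u w) ->
  (forall w, (Cmod (w - a) < r)%R -> (Cmod (u w) <= Cmod (u z1))%R) ->
  (Cmod (z1 - a) < r)%R -> (Cmod (z - a) <= r)%R -> ccont u z -> u z = u z1.
Proof.
  intros Hh Hmax Hz1 Hz Hc.
  set (p := fun t : R => z1 + RtoC t * (z - z1)).
  assert (Hp : forall t s, Cmod (p s - p t) = (Rabs (s - t) * Cmod (z - z1))%R).
  { intros t s. unfold p.
    replace (z1 + RtoC s * (z - z1) - (z1 + RtoC t * (z - z1)))
      with (RtoC (s - t) * (z - z1)) by (rewrite RtoC_minus; ring).
    now rewrite Cmod_mult, Cmod_R. }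
  assert (Hin : forall t, (0 <= t < 1)%R -> (Cmod (p t - a) < r)%R).
  { intros t Ht. unfold p.
    replace (z1 + RtoC t * (z - z1) - a) with (RtoC (1 - t) * (z1 - a) + RtoC t * (z - a))
      by (rewrite RtoC_minus; ring).
    eapply Rle_lt_trans; [apply Cmod_triangle|].
    rewrite !Cmod_mult, !Cmod_R, !Rabs_pos_eq by lra. nra. }
  assert (H0 : p 0%R = z1) by (unfold p; ring).
  assert (H1 : p 1%R = z) by (unfold p; ring).
  set (K := Cmod (z - z1)). assert (HK : (0 <= K)%R) by apply Cmod_ge_0.
  (* Dividing by [K + 1] instead of [K] covers the degenerate segment [z = z1]. *)
  assert (Hnear : forall d, (0 < d)%R -> (d / (K + 1) * K < d)%R).
  { intros d Hd. apply Rlt_le_trans with (d / (K + 1) * (K + 1))%R.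
    - apply Rmult_lt_compat_l; [apply Rdiv_lt_0_compat|]; lra.
    - right. field. lra. }
  rewrite <- H1.
  apply (continuous_induction (fun t => u (p t) = u z1)); [now rewrite H0| | |lra].
  - intros t Ht Hle. destruct (Hh (p t) (Hin t Ht)) as [Hct [d [Hd Hdiff]]].
    assert (Hgap := Hin t Ht).
    set (d' := Rmin d (r - Cmod (p t - a))).
    assert (Hd' : (0 < d')%R) by (apply Rmin_glb_lt; lra).
    exists (d' / (K + 1))%R. split; [apply Rdiv_lt_0_compat; lra|].
    intros s Hs. rewrite <- (Hle t ltac:(lra)).
    apply (local_maximum_principle u (p t) d'); [easy| | |].
    + intros w Hw Hwd. apply Hdiff; [easy|].
      eapply Rlt_le_trans; [apply Hwd|apply Rmin_l].
    + intros w Hw. rewrite (Hle t ltac:(lra)). apply Hmax.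
      eapply Rle_lt_trans; [apply (Cmod_minus_triangle w (p t))|].
      assert (E := Rmin_r d (r - Cmod (p t - a))). fold d' in E. lra.
    + rewrite Hp. fold K. specialize (Hnear d' Hd').
      rewrite Rabs_pos_eq by lra. eapply Rle_lt_trans; [|apply Hnear].
      apply Rmult_le_compat_r; lra.
  - intros t Ht Hlt.
    assert (Hct : ccont u (p t)).
    { destruct (Req_dec t 1) as [->|Hn]; [now rewrite H1|]. apply Hh, Hin. lra. }
    apply NNPP. intros Hn. apply Cminus_neq0, Cmod_gt_0 in Hn.
    destruct (Hct _ Hn) as [d [Hd H]].
    set (e := Rmin t (d / (K + 1))).
    assert (He : (0 < e)%R) by (apply Rmin_glb_lt; [lra|apply Rdiv_lt_0_compat; lra]).
    assert (He1 : (e <= t)%R) by apply Rmin_l.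
    specialize (H (p (t - e)%R)).
    rewrite (Hlt (t - e)%R ltac:(lra)), (Cmod_minus_sym (u z1)) in H.
    assert (Hc' : (Cmod (p (t - e)%R - p t) < d)%R); [|specialize (H Hc'); lra].
    rewrite Hp. fold K. specialize (Hnear d Hd).
    replace (t - e - t)%R with (- e)%R by ring. rewrite Rabs_Ropp, Rabs_pos_eq by lra.
    eapply Rle_lt_trans; [|apply Hnear]. apply Rmult_le_compat_r; [lra|apply Rmin_r].
Qed.

Lemma maximum_principle (u : C -> C) (a : C) (r M : R) : (0 < r)%R ->
  (forall w, (Cmod (w - a) < r)%R -> holo_except u w) ->
  (forall w, (Cmod (w - a) <= r)%R -> ccont u w) ->
  (forall w, Cmod (w - a) = r -> (Cmod (u w) <= M)%R) ->
  forall z, (Cmod (z - a) <= r)%R -> (Cmod (u z) <= M)%R.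
Proof.
  intros Hr Hh Hc HM z Hz.
  destruct (max_attained_ccont (fun w => (Cmod (w - a) <= r)%R) u) as [_ [[z1 [Hz1 Hmax]] _]].
  - apply closed_disk_closed.
  - apply closed_disk_bounded.
  - now exists z.
  - exact Hc.
  - eapply Rle_trans; [now apply Hmax|].
    destruct Hz1 as [Hz1|Hz1]; [|now apply HM].
    (* An interior maximum is carried to the boundary point [a + r], where the bound [M] is
       known. *)
    assert (Hb : Cmod (a + RtoC r - a) = r).
    { replace (a + RtoC r - a) with (RtoC r) by ring. rewrite Cmod_R, Rabs_pos_eq; lra. }
    rewrite <- (strong_maximum_principle u a z1 (a + RtoC r) r); [now apply HM|easy| |easy|lra|].
    + intros w Hw. apply Hmax. lra.
    + apply Hc. lra.
Qed.

(** * Univalent functions and subordination *)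

Definition univalent (P : C -> C) : Prop :=
  (forall z, unit_disk z -> cdiff P z) /\
  forall z w, unit_disk z -> unit_disk w -> P z = P w -> z = w.

Lemma analytic_on_disk_cdiff (f : C -> C) :
  analytic_on_disk f <-> forall z, unit_disk z -> cdiff f z.
Proof. split; intros H z Hz; apply ex_derive_cdiff, H, Hz. Qed.

Lemma unit_disk_0 : unit_disk 0.
Proof. unfold unit_disk. rewrite Cmod_0. lra. Qed.

Lemma unit_disk_near (z w : C) : (Cmod (w - z) < 1 - Cmod z)%R -> unit_disk w.
Proof.
  intros H. unfold unit_disk. assert (H1 := Cmod_reverse_triangle w z). lra.
Qed.

Lemma unit_disk_ball (a z : C) (r : R) : (r < 1 - Cmod a)%R ->
  (Cmod (z - a) <= r)%R -> unit_disk z.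
Proof. intros H1 H2. apply (unit_disk_near a). lra. Qed.

Lemma holo_except_slope (f psi : C -> C) (c z : C) :
  (forall z, unit_disk z -> cdiff f z) -> has_slope f psi c ->
  unit_disk c -> unit_disk z -> holo_except psi z.
Proof.
  intros Hf Hs Hc Hz.
  assert (Hd : forall w, unit_disk w -> w <> c -> cdiff psi w).
  { intros w Hw Hn. apply (cdiff_ext_loc (slope f (psi c) c) psi w 1 ltac:(lra)).
    - intros x _. now apply has_slope_slope.
    - apply cdiff_slope_away; [easy|now apply Hf]. }
  unfold unit_disk in *. destruct (Ceq_dec z c) as [->|Hn].
  - split; [apply Hs|]. exists (1 - Cmod c)%R. split; [lra|].
    intros w Hw Hwd. apply Hd; [|easy]. now apply (unit_disk_near c).
  - assert (Hp := proj1 (Cmod_gt_0 _) (Cminus_neq0 _ _ Hn)).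
    apply (holo_except_cdiff psi z (Rmin (Cmod (z - c)) (1 - Cmod z))).
    + apply Rmin_glb_lt; lra.
    + intros w Hw. apply Hd.
      * apply (unit_disk_near z). eapply Rlt_le_trans; [apply Hw|apply Rmin_r].
      * intros ->. rewrite Cmod_minus_sym in Hw.
        assert (H := Rmin_l (Cmod (z - c)) (1 - Cmod z)). lra.
Qed.

Lemma holo_except_inv (h : C -> C) (z : C) :
  holo_except h z -> h z <> 0 -> holo_except (fun w => / h w) z.
Proof.
  intros [Hc [r [Hr Hd]]] Hz. split; [now apply ccont_inv|].
  destruct (ccont_neq0 h z Hc Hz) as [d [Hd' Hn]].
  exists (Rmin r d). split; [now apply Rmin_glb_lt|]. intros w Hw Hwd.
  apply cdiff_inv.
  - apply Hd; [easy|]. eapply Rlt_le_trans; [apply Hwd|apply Rmin_l].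
  - apply Hn. eapply Rlt_le_trans; [apply Hwd|apply Rmin_r].
Qed.

Lemma univalent_circle_gap (P : C -> C) (a : C) (r : R) :
  univalent P -> (0 < r < 1 - Cmod a)%R ->
  exists m, (0 < m)%R /\ forall z, Cmod (z - a) = r -> (m <= Cmod (P z - P a))%R.
Proof.
  intros [Hd Hinj] Hr.
  assert (Ha : unit_disk a) by (unfold unit_disk; lra).
  assert (HD : forall z, Cmod (z - a) = r -> unit_disk z)
    by (intros z Hz; apply (unit_disk_ball a z r); lra).
  destruct (max_attained_ccont (fun z => Cmod (z - a) = r) (fun z => P z - P a))
    as [_ [_ [z [Hz Hmin]]]].
  - apply circle_closed.
  - apply circle_bounded.
  - exists (a + RtoC r). replace (a + RtoC r - a) with (RtoC r) by ring.
    rewrite Cmod_R. apply Rabs_pos_eq. lra.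
  - intros z Hz. apply ccont_minus; [|apply ccont_const]. apply cdiff_ccont, Hd. auto.
  - exists (Cmod (P z - P a)). split; [|exact Hmin].
    apply Cmod_gt_0, Cminus_neq0. intros E.
    apply Hinj in E; [|now apply HD|easy]. subst z.
    rewrite Cminus_diag, Cmod_0 in Hz. lra.
Qed.

(** If [P z] is close to [P a] but [z] is far from [a], then [1 / (P - P z)] is analytic on a disk
    about [a], at most [2 / m] on its circle, yet larger than [2 / m] at the centre. This
    contradicts the maximum principle and replaces the open mapping theorem. *)
Lemma univalent_inverse_continuous (P : C -> C) (a : C) (r : R) :
  univalent P -> unit_disk a -> (0 < r)%R ->
  exists d, (0 < d)%R /\
    forall z, unit_disk z -> (Cmod (P z - P a) < d)%R -> (Cmod (z - a) < r)%R.
Proof.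
  intros HP Ha Hr. unfold unit_disk in Ha.
  (* Halving keeps the closed disk of radius [r'] inside the unit disk and leaves every [z] with
     [|z - a| >= r] outside it. *)
  set (r' := (Rmin r (1 - Cmod a) / 2)%R).
  assert (H0 : (0 < Rmin r (1 - Cmod a))%R) by (apply Rmin_glb_lt; lra).
  assert (H1 := Rmin_l r (1 - Cmod a)). assert (H2 := Rmin_r r (1 - Cmod a)).
  destruct (univalent_circle_gap P a r' HP) as [m [Hm Hgap]]; [unfold r'; lra|].
  destruct HP as [Hd Hinj].
  exists (m / 2)%R. split; [lra|]. intros z Hz Hzd.
  apply Rnot_le_lt. intros Hfar.
  assert (HD : forall w, (Cmod (w - a) <= r')%R -> unit_disk w)
    by (intros w Hw; apply (unit_disk_ball a w r'); unfold r' in *; lra).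
  assert (Hne : forall w, (Cmod (w - a) <= r')%R -> P w - P z <> 0).
  { intros w Hw. apply Cminus_neq0. intros E. apply Hinj in E; [|now apply HD|easy].
    subst w. unfold r' in Hw. lra. }
  assert (Hdz : forall w, (Cmod (w - a) <= r')%R -> cdiff (fun w => / (P w - P z)) w).
  { intros w Hw. apply cdiff_inv; [|now apply Hne].
    apply cdiff_minus; [now apply Hd, HD|apply cdiff_const]. }
  assert (H := maximum_principle (fun w => / (P w - P z)) a r' (/ (m / 2))).
  specialize (H ltac:(unfold r'; lra)).
  assert (Hle : (Cmod (/ (P a - P z)) <= / (m / 2))%R).
  { apply H.
    - intros w Hw. apply (holo_except_cdiff _ w (r' - Cmod (w - a))); [lra|].
      intros x Hx. apply Hdz. assert (T := Cmod_minus_triangle x w a). lra.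
    - intros w Hw. now apply cdiff_ccont, Hdz.
    - intros w Hw. rewrite Cmod_inv by (apply Hne; lra).
      apply Rinv_le_contravar; [lra|].
      specialize (Hgap w Hw). assert (T := Cmod_minus_triangle (P w) (P z) (P a)). lra.
    - rewrite Cminus_diag, Cmod_0. unfold r'. lra. }
  assert (Hnea := Hne a). rewrite Cminus_diag, Cmod_0 in Hnea.
  specialize (Hnea ltac:(unfold r'; lra)).
  rewrite Cmod_inv, Cmod_minus_sym in Hle by easy.
  rewrite Cmod_minus_sym in Hle. rewrite (Cmod_minus_sym (P z)) in Hzd.
  apply Rinv_lt_contravar in Hzd; [lra|].
  apply Rmult_lt_0_compat; [|lra]. now apply Cmod_gt_0.
Qed.

Lemma is_Rderive_line (f phi : C -> C) (a h : C) (t : R) :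
  has_slope f phi (a + RtoC t * h) ->
  is_Rderive (fun s => f (a + RtoC s * h)) t (phi (a + RtoC t * h) * h).
Proof.
  intros [Hc E].
  apply (is_Rderive_of_slope (fun s => f (a + RtoC s * h)) (fun s => phi (a + RtoC s * h) * h) t).
  - intros eps He. assert (Hh := Cmod_ge_0 h).
    destruct (Hc (eps / (Cmod h + 1))%R) as [d [Hd H]]; [apply Rdiv_lt_0_compat; lra|].
    exists (d / (Cmod h + 1))%R. split; [apply Rdiv_lt_0_compat; lra|]. intros s Hs.
    rewrite <- (Cmod_opp (_ - _)).
    replace (- (phi (a + RtoC s * h) * h - phi (a + RtoC t * h) * h))
      with (- (phi (a + RtoC s * h) - phi (a + RtoC t * h)) * h) by ring.
    rewrite Cmod_mult, Cmod_opp.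
    assert (Hmul : forall x, (0 < x)%R -> (x / (Cmod h + 1) * Cmod h < x)%R).
    { intros x Hx. apply Rlt_le_trans with (x / (Cmod h + 1) * (Cmod h + 1))%R.
      - apply Rmult_lt_compat_l; [apply Rdiv_lt_0_compat|]; lra.
      - right. field. lra. }
    eapply Rle_lt_trans; [|apply (Hmul eps He)].
    apply Rmult_le_compat_r; [easy|]. left. apply H.
    replace (a + RtoC s * h - (a + RtoC t * h)) with (RtoC (s - t) * h)
      by (rewrite RtoC_minus; ring).
    rewrite Cmod_mult, Cmod_R. eapply Rle_lt_trans; [|apply (Hmul d Hd)].
    apply Rmult_le_compat_r; lra.
  - intros s. rewrite (E (a + RtoC s * h)), RtoC_minus. ring.
Qed.

(** Pairing [f] with the conjugate of [f c - f a] reduces this to the real mean value theorem, whose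
    conclusion is [|f c - f a|^2 = 0]. *)
Lemma zero_derivative_constant (f : C -> C) (a c : C) :
  (forall t, (0 <= t <= 1)%R -> exists phi,
     has_slope f phi (a + RtoC t * (c - a)) /\ phi (a + RtoC t * (c - a)) = 0) ->
  f c = f a.
Proof.
  intros H. set (k := Cconj (f c - f a)).
  assert (Hder : forall t, (0 <= t <= 1)%R ->
    is_derive (fun s => Re (k * f (a + RtoC s * (c - a)))) t 0%R).
  { intros t Ht. destruct (H t Ht) as [phi [Hs E]].
    replace 0%R with (Re (k * (phi (a + RtoC t * (c - a)) * (c - a)))).
    - apply (is_Rderive_Re_scal k (fun s => f (a + RtoC s * (c - a)))). now apply is_Rderive_line.
    - rewrite E, Cmult_0_l, Cmult_0_r. easy. }
  destruct (MVT_gen (fun s => Re (k * f (a + RtoC s * (c - a)))) 0 1 (fun _ => 0%R))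
    as [t [_ E]].
  - intros x Hx. rewrite Rmin_left, Rmax_right in Hx by lra. apply Hder. lra.
  - intros x Hx. rewrite Rmin_left, Rmax_right in Hx by lra.
    apply continuity_pt_filterlim.
    apply (ex_derive_continuous (K := R_AbsRing) (V := R_NormedModule)).
    eexists. now apply Hder.
  - rewrite Rmult_0_l in E.
    replace (a + RtoC 1 * (c - a)) with c in E by ring.
    replace (a + RtoC 0 * (c - a)) with a in E by ring.
    assert (Hsq : (Cmod (f c - f a) ^ 2 = 0)%R).
    { rewrite <- E, Cmod2_alt. unfold k. destruct (f c), (f a). simpl. ring. }
    assert (H0 : Cmod (f c - f a) = 0%R) by (assert (P := Cmod_ge_0 (f c - f a)); nra).
    apply Cmod_eq_0 in H0.
    replace (f c) with (f c - f a + f a) by ring. rewrite H0. ring.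
Qed.

(* If [P'(a) = 0], the maximum principle for the inverse of the difference quotient
   [(P z - P c) / (z - c)] shows that [P'(c) = 0] for every [c] near [a], so that
   [P] is constant near [a]. *)
Lemma univalent_derivative_neq0 (P phi : C -> C) (a : C) :
  univalent P -> unit_disk a -> has_slope P phi a -> phi a <> 0.
Proof.
  intros HP Ha Hphi H0. unfold unit_disk in Ha.
  set (r := ((1 - Cmod a) / 2)%R).
  destruct (univalent_circle_gap P a r HP) as [m [Hm Hgap]]; [unfold r; lra|].
  destruct HP as [Hd Hinj].
  assert (HD : forall w, (Cmod (w - a) <= r)%R -> unit_disk w)
    by (intros w Hw; apply (unit_disk_ball a w r); unfold r in *; lra).
  (* For [c] near [a] and [|w - a| = r], one has [|P w - P c| >= m / 2] and [|w - c| <= 2 * r], so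
     the quotient is at least [m / (4 * r)] in modulus. The radius [d2] keeps [phi] below this
     value. *)
  destruct (cdiff_ccont _ _ (Hd a Ha) (m / 2)%R ltac:(lra)) as [d1 [Hd1 H1]].
  destruct (proj1 Hphi (m / (4 * r))%R) as [d2 [Hd2 H2]];
    [apply Rdiv_lt_0_compat; unfold r; lra|].
  set (d := Rmin r (Rmin d1 d2)).
  assert (Hdpos : (0 < d)%R).
  { apply Rmin_glb_lt; [unfold r; lra|]. now apply Rmin_glb_lt. }
  assert (Hdr : (d <= r)%R) by apply Rmin_l.
  assert (Hdd1 : (d <= d1)%R) by (eapply Rle_trans; [apply Rmin_r|apply Rmin_l]).
  assert (Hdd2 : (d <= d2)%R) by (eapply Rle_trans; [apply Rmin_r|apply Rmin_r]).
  assert (Hcrit : forall c, (Cmod (c - a) < d)%R ->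
    exists psi, has_slope P psi c /\ psi c = 0).
  { intros c Hc. destruct (Ceq_dec c a) as [->|Hca]; [now exists phi|].
    assert (HDc : unit_disk c) by (apply HD; lra).
    destruct (Hd c HDc) as [psi Hpsi]. exists psi. split; [easy|].
    apply NNPP. intros Hn.
    (* Off [c] the quotient vanishes nowhere by injectivity, at [c] by the assumption to be
       refuted. *)
    assert (Hnz : forall w, unit_disk w -> psi w <> 0).
    { intros w Hw E. destruct (Ceq_dec w c) as [->|Hwc]; [easy|].
      apply Hwc, Hinj; try easy. rewrite (proj2 Hpsi w), E. ring. }
    assert (Hle : (Cmod (/ psi a) <= 4 * r / m)%R).
    { apply (maximum_principle (fun w => / psi w) a r); [unfold r; lra| | | |].
      - intros w Hw. assert (HDw : unit_disk w) by (apply HD; lra).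
        apply holo_except_inv; [|now apply Hnz].
        now apply (holo_except_slope P psi c).
      - intros w Hw. assert (HDw : unit_disk w) by (now apply HD).
        apply ccont_inv; [|now apply Hnz].
        now apply (holo_except_slope P psi c).
      - intros w Hw. assert (HDw : unit_disk w) by (apply HD; lra).
        assert (Hwc : w <> c) by (intros ->; lra).
        rewrite Cmod_inv by now apply Hnz.
        rewrite <- (Rinv_inv (4 * r / m)).
        apply Rinv_le_contravar; [apply Rinv_0_lt_compat, Rdiv_lt_0_compat; unfold r; lra|].
        rewrite (has_slope_unfold P psi c w Hpsi Hwc).
        rewrite Cmod_div by now apply Cminus_neq0.
        specialize (H1 c ltac:(lra)). specialize (Hgap w Hw).
        assert (T1 := Cmod_minus_triangle (P w) (P c) (P a)).
        assert (T2 := Cmod_minus_triangle w a c).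
        rewrite (Cmod_minus_sym a c) in T2.
        assert (Hp := proj1 (Cmod_gt_0 _) (Cminus_neq0 _ _ Hwc)).
        apply Rmult_le_reg_r with (Cmod (w - c)); [easy|].
        unfold Rdiv at 2. rewrite Rmult_assoc, Rinv_l, Rmult_1_r by lra.
        apply Rle_trans with (m / 2)%R; [|lra].
        apply Rle_trans with (/ (4 * r / m) * (2 * r))%R.
        + apply Rmult_le_compat_l; [|lra].
          left. apply Rinv_0_lt_compat, Rdiv_lt_0_compat; unfold r; lra.
        + right. field. unfold r. lra.
      - rewrite Cminus_diag, Cmod_0. unfold r. lra. }
    (* The difference quotient is symmetric in its two points; this turns the lower bound on [psi a]
       into one on [phi c], which is small. *)
    assert (Hpsia : psi a = phi c).
    { rewrite (has_slope_unfold P phi a c Hphi Hca).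
      rewrite (has_slope_unfold P psi c a Hpsi) by congruence.
      field. split; apply Cminus_neq0; congruence. }
    specialize (H2 c ltac:(lra)). rewrite H0, <- Hpsia in H2.
    replace (psi a - 0) with (psi a) in H2 by ring.
    rewrite Cmod_inv in Hle by (now apply Hnz).
    assert (Hp := proj1 (Cmod_gt_0 _) (Hnz a Ha)).
    apply Rinv_lt_contravar in H2.
    - replace (/ (m / (4 * r)))%R with (4 * r / m)%R in H2 by (field; unfold r; lra). lra.
    - apply Rmult_lt_0_compat; [easy|]. apply Rdiv_lt_0_compat; unfold r; lra. }
  set (c := a + RtoC (d / 2)).
  assert (Hc : Cmod (c - a) = (d / 2)%R).
  { unfold c. replace (a + RtoC (d / 2) - a) with (RtoC (d / 2)) by ring.
    rewrite Cmod_R, Rabs_pos_eq; lra. }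
  assert (E : P c = P a).
  { apply zero_derivative_constant. intros t Ht. apply Hcrit.
    replace (a + RtoC t * (c - a) - a) with (RtoC t * (c - a)) by ring.
    rewrite Cmod_mult, Cmod_R, Hc, Rabs_pos_eq by lra. nra. }
  apply Hinj in E; [|apply HD; lra|easy].
  rewrite E, Cminus_diag, Cmod_0 in Hc. lra.
Qed.

(** The maximum principle is applied to the slope [h] of [omega] at 0, with [omega z = h z * z]. If
    [|h|] takes the value 1 anywhere, even at 0, the strong principle makes [h] constant; this gives
    the dichotomy. *)
Lemma schwarz (omega : C -> C) :
  (forall z, unit_disk z -> cdiff omega z) ->
  (forall z, unit_disk z -> unit_disk (omega z)) -> omega 0 = 0 ->
  (forall z, unit_disk z -> (Cmod (omega z) <= Cmod z)%R) /\
  ((forall z, unit_disk z -> z <> 0 -> (Cmod (omega z) < Cmod z)%R) \/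
   exists eps, Cmod eps = 1%R /\ forall z, unit_disk z -> omega z = eps * z).
Proof.
  intros Hd Hmap H0. destruct (Hd 0 unit_disk_0) as [h Hh].
  assert (E : forall z, omega z = h z * z).
  { intros z. rewrite (proj2 Hh z), H0. ring. }
  assert (Hol : forall z, unit_disk z -> holo_except h z).
  { intros z Hz. apply (holo_except_slope omega h 0); try easy. apply unit_disk_0. }
  assert (Hle : forall z, unit_disk z -> (Cmod (h z) <= 1)%R).
  { intros z Hz. unfold unit_disk in Hz. apply Rnot_lt_le. intros Hgt.
    (* A radius below 1 that exceeds both [|z|] and [1 / |h z|]; the bound [|h z| <= 1 / r] is then
       absurd. *)
    set (r := Rmax ((1 + Cmod z) / 2) ((1 + / Cmod (h z)) / 2)).
    assert (Hi : (/ Cmod (h z) < 1)%R).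
    { rewrite <- Rinv_1. apply Rinv_lt_contravar; lra. }
    assert (Hi0 : (0 < / Cmod (h z))%R) by (apply Rinv_0_lt_compat; lra).
    assert (Hz0 := Cmod_ge_0 z).
    assert (Hr1 : (r < 1)%R) by (apply Rmax_lub_lt; lra).
    assert (Hr2 : ((1 + Cmod z) / 2 <= r)%R) by apply Rmax_l.
    assert (Hr3 : ((1 + / Cmod (h z)) / 2 <= r)%R) by apply Rmax_r.
    assert (Hb : (Cmod (h z) <= / r)%R).
    { apply (maximum_principle h 0 r); [lra| | | |].
      - intros w Hw. apply Hol. unfold unit_disk. replace (w - 0) with w in Hw by ring. lra.
      - intros w Hw. apply Hol. unfold unit_disk. replace (w - 0) with w in Hw by ring. lra.
      - intros w Hw. replace (w - 0) with w in Hw by ring.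
        assert (Hwd : unit_disk w) by (unfold unit_disk; lra).
        specialize (Hmap w Hwd). unfold unit_disk in Hmap.
        rewrite E, Cmod_mult, Hw in Hmap.
        apply Rmult_le_reg_r with r; [lra|]. rewrite Rinv_l; lra.
      - replace (z - 0) with z by ring. lra. }
    assert (Hb' : (r <= / Cmod (h z))%R).
    { rewrite <- (Rinv_inv r). apply Rinv_le_contravar; lra. }
    lra. }
  split.
  { intros z Hz. rewrite E, Cmod_mult. specialize (Hle z Hz).
    assert (P := Cmod_ge_0 z). nra. }
  destruct (classic (exists z1, unit_disk z1 /\ Cmod (h z1) = 1%R)) as [[z1 [Hz1 Hm]]|Hno].
  - right. exists (h z1). split; [easy|]. intros z Hz. rewrite E. f_equal.
    apply (strong_maximum_principle h 0 z1 z 1).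
    + intros w Hw. apply Hol. unfold unit_disk. now replace (w - 0) with w in Hw by ring.
    + intros w Hw. rewrite Hm. apply Hle. unfold unit_disk.
      now replace (w - 0) with w in Hw by ring.
    + replace (z1 - 0) with z1 by ring. exact Hz1.
    + replace (z - 0) with z by ring. unfold unit_disk in Hz. lra.
    + now apply Hol.
  - left. intros z Hz Hn. rewrite E, Cmod_mult.
    assert (Hp := proj1 (Cmod_gt_0 z) Hn).
    assert (Hlt : (Cmod (h z) < 1)%R).
    { destruct (Hle z Hz) as [Hlt|He]; [easy|]. exfalso. apply Hno. now exists z. }
    nra.
Qed.

(** The function [omega = P^-1 o g] is continuous by the continuity of [P^-1]. Its slope at [z] is
    the slope of [g] divided by that of [P] at [omega z], which vanishes nowhere: at the base point
    because [P'] does not vanish, elsewhere by injectivity. *)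
Lemma subordination (P g : C -> C) : univalent P ->
  (forall z, unit_disk z -> cdiff g z) ->
  (forall z, unit_disk z -> image P unit_disk (g z)) -> g 0 = P 0 ->
  exists omega : C -> C,
    (forall z, unit_disk z -> unit_disk (omega z) /\ g z = P (omega z)) /\
    (forall z, unit_disk z -> (Cmod (omega z) <= Cmod z)%R) /\
    ((forall z, unit_disk z -> z <> 0 -> (Cmod (omega z) < Cmod z)%R) \/
     exists eps, Cmod eps = 1%R /\ forall z, unit_disk z -> omega z = eps * z).
Proof.
  intros HP Hg Hin H0. assert (HP' := HP). destruct HP' as [Hd Hinj].
  assert (Hex : forall z, exists w, unit_disk z -> unit_disk w /\ g z = P w).
  { intros z. destruct (classic (unit_disk z)) as [Hz|Hz]; [|exists 0; tauto].
    destruct (Hin z Hz) as [w [Hw E]]. now exists w. }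
  destruct (choice _ Hex) as [omega Ho].
  exists omega. split; [exact Ho|].
  apply schwarz; [|intros; now apply Ho|].
  - intros z Hz. destruct (Ho z Hz) as [Hoz Ez].
    destruct (Hg z Hz) as [gam [Hgc Hgs]].
    destruct (Hd (omega z) Hoz) as [Phi HPhi].
    assert (Hc : ccont omega z).
    { intros eps He.
      destruct (univalent_inverse_continuous P (omega z) eps HP Hoz He) as [d [Hd' H]].
      destruct (cdiff_ccont _ _ (Hg z Hz) d Hd') as [d' [Hd'' H']].
      unfold unit_disk in Hz.
      exists (Rmin d' (1 - Cmod z)). split; [apply Rmin_glb_lt; lra|].
      intros w Hw.
      assert (Hwd : unit_disk w)
        by (apply (unit_disk_near z); eapply Rlt_le_trans; [apply Hw|apply Rmin_r]).
      destruct (Ho w Hwd) as [How Ew].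
      apply H; [easy|]. rewrite <- Ez, <- Ew. apply H'.
      eapply Rlt_le_trans; [apply Hw|apply Rmin_l]. }
    assert (Hnz : forall x, unit_disk x -> Phi x <> 0).
    { intros x Hx. destruct (Ceq_dec x (omega z)) as [->|Hn].
      - now apply (univalent_derivative_neq0 P).
      - intros E. apply Hn, Hinj; try easy. rewrite (proj2 HPhi x), E. ring. }
    apply (cdiff_loc omega (fun w => gam w * / Phi (omega w)) z (1 - Cmod z)).
    + unfold unit_disk in Hz. lra.
    + apply ccont_mult; [easy|]. apply ccont_inv; [|now apply Hnz].
      apply (ccont_comp Phi omega); [easy|apply HPhi].
    + intros w Hw. assert (Hwd := unit_disk_near z w Hw).
      destruct (Ho w Hwd) as [How Ew].
      assert (E1 := proj2 HPhi (omega w)). rewrite <- Ew, <- Ez, (Hgs w) in E1.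
      assert (E2 : gam w * (w - z) = Phi (omega w) * (omega w - omega z)).
      { replace (gam w * (w - z)) with (g z + gam w * (w - z) - g z) by ring.
        rewrite E1. ring. }
      replace (gam w * / Phi (omega w) * (w - z)) with (gam w * (w - z) * / Phi (omega w)) by ring.
      rewrite E2. field. now apply Hnz.
  - destruct (Ho 0 unit_disk_0) as [Ho0 E]. symmetry. apply Hinj; [apply unit_disk_0|easy|].
    now rewrite <- H0.
Qed.

(** * The integral operator [G |-> int_0^z G(zeta)/zeta dzeta] *)

(** The Alexander transform, which carries normalized starlike functions to convex ones. *)
Definition log_integral (G : C -> C) (z : C) : C :=
  segment_integral (fun zeta => G zeta / zeta) z.

Definition normalized (G : C -> C) : Prop :=
  (forall z, unit_disk z -> cdiff G z) /\ G 0 = 0.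

Lemma unit_disk_scal (t : R) (z : C) : (0 <= t <= 1)%R -> unit_disk z -> unit_disk (RtoC t * z).
Proof.
  unfold unit_disk. intros Ht Hz. rewrite Cmod_mult, Cmod_R, Rabs_pos_eq by easy.
  assert (H := Cmod_ge_0 z). nra.
Qed.

Lemma continuous_ray (h : C -> C) (z : C) (t : R) : ccont h (RtoC t * z) ->
  continuous (U := C_UniformSpace) (fun s => h (RtoC s * z)) t.
Proof.
  intros H.
  apply (continuous_ccont_comp (fun w => h (w * z)) (fun s => (s, 0%R))).
  - apply continuous_pair_fun; [apply continuous_id|apply continuous_const].
  - apply (ccont_comp h (fun w => w * z)); [|exact H].
    apply ccont_mult; [apply ccont_id|apply ccont_const].
Qed.

(** Since [G zeta = h zeta * zeta], the integral is [z] times the mean [A z] of [h] over the segment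
    from 0 to [z]. The singular quotient disappears, and [A] inherits continuity from [h]. *)
Lemma log_integral_factor (G h : C -> C) : normalized G -> has_slope G h 0 ->
  exists A : C -> C, (forall z, unit_disk z -> ccont A z) /\ A 0 = h 0 /\
    forall z, unit_disk z -> log_integral G z = A z * z /\
      is_CInt (fun t => h (RtoC t * z)) 0 1 (A z).
Proof.
  intros [Hd H0] Hh.
  assert (E : forall z, G z = h z * z) by (intros z; rewrite (proj2 Hh z), H0; ring).
  assert (Hc : forall z, unit_disk z -> ccont h z).
  { intros z Hz. apply (holo_except_slope G h 0); try easy. apply unit_disk_0. }
  set (A := fun z => CInt (fun t => h (RtoC t * z)) 0 1 : C).
  assert (HA : forall z, unit_disk z -> is_CInt (fun t => h (RtoC t * z)) 0 1 (A z)).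
  { intros z Hz. apply CInt_correct, ex_CInt_continuous; [lra|].
    intros t Ht. apply continuous_ray, Hc. now apply unit_disk_scal. }
  exists A. split; [|split].
  - intros z Hz eps He.
    (* Uniformity over the disk makes the estimate hold for all [t] at once, although [RtoC t * w]
       may leave the disk. *)
    destruct (heine (fun w => (Cmod (w - 0) <= Cmod z)%R) h) with (eps := (eps / 2)%R)
      as [d [Hd' H]].
    + apply closed_disk_closed.
    + apply closed_disk_bounded.
    + intros w Hw. replace (w - 0) with w in Hw by ring. apply Hc.
      unfold unit_disk in *. lra.
    + lra.
    + unfold unit_disk in Hz. exists (Rmin d (1 - Cmod z)). split; [apply Rmin_glb_lt; lra|].
      intros w Hw.
      assert (Hw1 := Rlt_le_trans _ _ _ Hw (Rmin_l _ _)).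
      assert (Hw2 := Rlt_le_trans _ _ _ Hw (Rmin_r _ _)).
      apply Rle_lt_trans with ((1 - 0) * (eps / 2))%R; [|lra].
      apply (is_CInt_bound (fun t => h (RtoC t * w) - h (RtoC t * z))); [lra| |].
      * intros t Ht. left. apply H.
        -- replace (RtoC t * z - 0) with (RtoC t * z) by ring.
           rewrite Cmod_mult, Cmod_R, Rabs_pos_eq by lra.
           assert (P := Cmod_ge_0 z). nra.
        -- replace (RtoC t * w - RtoC t * z) with (RtoC t * (w - z)) by ring.
           rewrite Cmod_mult, Cmod_R, Rabs_pos_eq by lra.
           assert (P := Cmod_ge_0 (w - z)). nra.
      * apply is_CInt_minus; apply HA; [|easy]. now apply (unit_disk_near z).
  - unfold A. apply is_CInt_unique.
    assert (Hk := is_CInt_const (h 0) 0 1).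
    replace (RtoC (1 - 0) * h 0) with (h 0) in Hk
      by (rewrite Rminus_0_r; ring).
    apply (is_RInt_ext (V := C_R_NormedModule) (fun _ => h 0)); [|exact Hk].
    intros t _. f_equal. ring.
  - intros z Hz. split; [|now apply HA].
    unfold log_integral, segment_integral. apply is_CInt_unique.
    destruct (Ceq_dec z 0) as [->|Hn].
    { assert (Hk := is_CInt_const 0 0 1). rewrite Cmult_0_r in Hk. rewrite Cmult_0_r.
      apply (is_RInt_ext (V := C_R_NormedModule) (fun _ => RtoC 0)); [|exact Hk].
      intros t _. symmetry. apply Cmult_0_r. }
    rewrite Cmult_comm.
    apply (is_RInt_ext (V := C_R_NormedModule) (fun t => z * h (RtoC t * z))).
    + rewrite Rmin_left, Rmax_right by lra. intros t Ht. rewrite E.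
      assert (Ht0 : RtoC t <> 0) by (intros Et; apply RtoC_inj in Et; lra).
      change (z * h (RtoC t * z) = h (RtoC t * z) * (RtoC t * z) / (RtoC t * z) * z).
      field. split; easy.
    + now apply is_CInt_scal, HA.
Qed.

Lemma log_integral_0 (G : C -> C) : log_integral G 0 = 0.
Proof.
  unfold log_integral, segment_integral. apply is_CInt_unique.
  assert (Hk := is_CInt_const 0 0 1). rewrite Cmult_0_r in Hk.
  apply (is_RInt_ext (V := C_R_NormedModule) (fun _ => RtoC 0)); [|exact Hk].
  intros t _. symmetry. apply Cmult_0_r.
Qed.

Lemma log_integral_ext (G G' : C -> C) (z : C) : unit_disk z ->
  (forall w, unit_disk w -> G w = G' w) -> log_integral G z = log_integral G' z.
Proof.
  intros Hz E. apply (RInt_ext (V := C_R_CompleteNormedModule)).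
  rewrite Rmin_left, Rmax_right by lra. intros t Ht.
  rewrite E; [easy|]. apply unit_disk_scal; [lra|easy].
Qed.

Lemma log_integral_dilation (G : C -> C) (c z : C) : G 0 = 0 ->
  log_integral (fun zeta => G (c * zeta)) z = log_integral G (c * z).
Proof.
  intros H0. apply (RInt_ext (V := C_R_CompleteNormedModule)).
  rewrite Rmin_left, Rmax_right by lra. intros t Ht.
  change (G (c * (RtoC t * z)) / (RtoC t * z) * z
    = G (RtoC t * (c * z)) / (RtoC t * (c * z)) * (c * z)).
  replace (RtoC t * (c * z)) with (c * (RtoC t * z)) by ring.
  (* For [c = 0] the right integrand is a quotient by zero times 0; the two sides agree because
     [G 0 = 0]. *)
  destruct (Ceq_dec c 0) as [->|Hc].
  { rewrite Cmult_0_l, H0. unfold Cdiv. ring. }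
  destruct (Ceq_dec z 0) as [->|Hz].
  { ring. }
  field. repeat split; try easy. intros Et. apply RtoC_inj in Et. lra.
Qed.

Lemma log_integral_ccont (G : C -> C) (z : C) : normalized G -> unit_disk z ->
  ccont (log_integral G) z.
Proof.
  intros HG Hz. destruct (proj1 HG 0 unit_disk_0) as [h Hh].
  destruct (log_integral_factor G h HG Hh) as [A [HA [_ E]]].
  assert (Hz' := Hz). unfold unit_disk in Hz'.
  apply (ccont_ext_loc (fun w => A w * w) _ z (1 - Cmod z)); [lra| |].
  - intros w Hw. symmetry. now apply E, (unit_disk_near z).
  - apply ccont_mult; [now apply HA|apply ccont_id].
Qed.

(** The logarithmic coordinates miss the origin; this derivative serves to rule it out as a maximum
    point. *)
Lemma log_integral_slope_0 (G h : C -> C) : normalized G -> has_slope G h 0 ->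
  exists A, has_slope (log_integral G) A 0 /\ A 0 = h 0.
Proof.
  intros HG Hh.
  destruct (log_integral_factor G h HG Hh) as [A [HA [E0 E]]].
  exists (slope (log_integral G) (h 0) 0). split; [|apply slope_diag].
  apply has_slope_of_ccont.
  apply (ccont_ext_loc A _ 0 1); [lra| |apply HA, unit_disk_0].
  intros w Hw. replace (w - 0) with w in Hw by ring.
  destruct (Ceq_dec w 0) as [->|Hn]; [now rewrite slope_diag|].
  rewrite slope_neq, log_integral_0, (proj1 (E w Hw)) by easy. field.
  replace (w - 0) with w by ring. easy.
Qed.

(** By scaling, the value at [x z] is the integral of [h (t z) * z] over [[0, x]], so the
    fundamental theorem applies; the chain rule factor [exp s] turns [h] back into [G]. *)
Lemma is_Rderive_radial (G : C -> C) (z : C) (s : R) : normalized G ->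
  unit_disk (RtoC (exp s) * z) ->
  is_Rderive (fun x => log_integral G (RtoC (exp x) * z)) s (G (RtoC (exp s) * z)).
Proof.
  intros HG Hz. destruct (proj1 HG 0 unit_disk_0) as [h Hh].
  destruct (log_integral_factor G h HG Hh) as [A [HA [_ E]]].
  assert (EG : forall z, G z = h z * z).
  { intros w. rewrite (proj2 Hh w), (proj2 HG). ring. }
  assert (Hc : forall z, unit_disk z -> ccont h z).
  { intros w Hw. apply (holo_except_slope G h 0); try easy; [apply HG|apply unit_disk_0]. }
  assert (HI : forall x, (0 < x)%R -> unit_disk (RtoC x * z) ->
    is_CInt (fun t => h (RtoC t * z) * z) 0 x (log_integral G (RtoC x * z))).
  { intros x Hx Hxz.
    assert (Hin : forall t, (0 <= t <= x)%R -> unit_disk (RtoC t * z)).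
    { intros t Ht. replace (RtoC t * z) with (RtoC (t / x) * (RtoC x * z)).
      - apply unit_disk_scal; [|easy]. split; [apply Rdiv_le_0_compat; lra|].
        apply Rmult_le_reg_r with x; [easy|]. unfold Rdiv.
        rewrite Rmult_assoc, Rinv_l; lra.
      - rewrite RtoC_div by lra. field. intros Ex. apply RtoC_inj in Ex. lra. }
    assert (Hex : is_CInt (fun t => h (RtoC t * z) * z) 0 x
      (CInt (fun t => h (RtoC t * z) * z) 0 x)).
    { apply CInt_correct, ex_CInt_continuous; [lra|]. intros t Ht.
      apply (continuous_ray (fun w => h w * z)). apply ccont_mult; [|apply ccont_const].
      now apply Hc, Hin. }
    assert (Hlin := Hex).
    (* The substitution lemma expects both end points in the form [x * u + 0]. *)
    replace 0%R with (x * 0 + 0)%R in Hlin at 1 by ring.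
    replace x with (x * 1 + 0)%R in Hlin at 2 by ring.
    apply (is_RInt_comp_lin (V := C_R_NormedModule)) in Hlin.
    destruct (E (RtoC x * z) Hxz) as [-> HAx].
    apply (is_CInt_scal (RtoC x * z)) in HAx.
    replace (A (RtoC x * z) * (RtoC x * z)) with (CInt (fun t => h (RtoC t * z) * z) 0 x);
      [exact Hex|].
    rewrite <- (is_CInt_unique _ _ _ _ Hlin), Cmult_comm, <- (is_CInt_unique _ _ _ _ HAx).
    apply (RInt_ext (V := C_R_CompleteNormedModule)). intros t _.
    rewrite scal_R_Cmult, Rplus_0_r, RtoC_mult.
    replace (RtoC t * (RtoC x * z)) with (RtoC x * RtoC t * z) by ring.
    change (RtoC x * (h (RtoC x * RtoC t * z) * z) = RtoC x * z * h (RtoC x * RtoC t * z)).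
    ring. }
  replace (G (RtoC (exp s) * z))
    with (scal (V := C_R_NormedModule) (exp s) (h (RtoC (exp s) * z) * z)).
  2: { rewrite scal_R_Cmult, EG. change (RtoC (exp s) * (h (RtoC (exp s) * z) * z)
         = h (RtoC (exp s) * z) * (RtoC (exp s) * z)). ring. }
  apply (is_derive_comp (K := R_AbsRing) (V := C_R_NormedModule)
    (fun x => log_integral G (RtoC x * z)) exp).
  - apply (is_derive_RInt (V := C_R_NormedModule) (fun t => h (RtoC t * z) * z) _ 0).
    + assert (Hp := exp_pos s). assert (P := Cmod_ge_0 z).
      unfold unit_disk in Hz. rewrite Cmod_mult, Cmod_R, Rabs_pos_eq in Hz by lra.
      set (d := Rmin (exp s) ((1 - exp s * Cmod z) / (Cmod z + 1))).
      assert (Hd : (0 < d)%R).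
      { apply Rmin_glb_lt; [easy|]. apply Rdiv_lt_0_compat; lra. }
      exists (mkposreal d Hd). intros x Hx.
      change (Rabs (x - exp s) < d)%R in Hx. apply Rabs_lt_between in Hx.
      assert (H1 := Rmin_l (exp s) ((1 - exp s * Cmod z) / (Cmod z + 1))). fold d in H1.
      assert (H2 := Rmin_r (exp s) ((1 - exp s * Cmod z) / (Cmod z + 1))). fold d in H2.
      apply HI; [lra|]. unfold unit_disk. rewrite Cmod_mult, Cmod_R, Rabs_pos_eq by lra.
      apply Rle_lt_trans with ((exp s + d) * Cmod z)%R; [apply Rmult_le_compat_r; lra|].
      assert (H3 : (d * (Cmod z + 1) <= 1 - exp s * Cmod z)%R).
      { apply Rmult_le_reg_r with (/ (Cmod z + 1))%R; [apply Rinv_0_lt_compat; lra|].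
        rewrite Rmult_assoc, Rinv_r, Rmult_1_r by lra. exact H2. }
      lra.
    + apply (continuous_ray (fun w => h w * z)). apply ccont_mult; [|apply ccont_const].
      now apply Hc.
  - apply is_derive_exp.
Qed.

(** In Goursat's theorem for [G (cexp w)] on [[x, s] x [t1, t2]], the horizontal sides are known
    from the radial derivative. So the difference of the two sides of the claim does not depend on
    [x], and it tends to 0 as [x] tends to minus infinity because [G] and its transform vanish at
    0. *)
Lemma is_CInt_angular (G : C -> C) (s t1 t2 : R) : normalized G -> (s < 0)%R -> (t1 <= t2)%R ->
  is_CInt (fun t => Ci * G (cexp (s, t))) t1 t2
    (log_integral G (cexp (s, t2)) - log_integral G (cexp (s, t1))).
Proof.
  intros HG Hs Ht.
  assert (Hin : forall w, (Re w < 0)%R -> unit_disk (cexp w)).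
  { intros w Hw. unfold unit_disk. rewrite Cmod_cexp, <- exp_0. now apply exp_increasing. }
  assert (Hdiff : forall w, (Re w < 0)%R -> cdiff (fun w => G (cexp w)) w).
  { intros w Hw. apply cdiff_comp; [apply cdiff_cexp|]. now apply HG, Hin. }
  assert (Hver : forall x, (x <= s)%R ->
    is_CInt (fun t => G (cexp (x, t))) t1 t2 (CInt (fun t => G (cexp (x, t))) t1 t2)).
  { intros x Hx. apply CInt_correct.
    apply (ex_CInt_vertical (fun w => G (cexp w))); [easy|].
    intros y _. apply cdiff_ccont, Hdiff. simpl. lra. }
  set (q := fun x t => log_integral G (cexp (x, t))).
  set (J := fun x => CInt (fun t => G (cexp (x, t))) t1 t2 : C).
  assert (Hhor : forall x t, (x <= s)%R ->
    CInt (fun y => G (cexp (y, t))) x s = q s t - q x t).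
  { intros x t Hx. apply is_CInt_unique.
    apply (is_RInt_derive (V := C_R_CompleteNormedModule) (fun y => q y t)).
    - rewrite Rmin_left, Rmax_right by easy. intros y Hy. unfold q.
      apply (is_derive_ext (K := R_AbsRing) (V := C_R_NormedModule)
        (fun y => log_integral G (RtoC (exp y) * cexp (0%R, t)))).
      + intros u. f_equal. symmetry. apply cexp_polar.
      + rewrite (cexp_polar y). apply is_Rderive_radial; [easy|].
        rewrite <- cexp_polar. apply Hin. simpl. lra.
    - rewrite Rmin_left, Rmax_right by easy. intros y Hy.
      apply (continuous_ccont_comp (fun w => G (cexp w)) (fun y => (y, t))).
      + apply continuous_pair_fun; [apply continuous_id|apply continuous_const].
      + apply cdiff_ccont, Hdiff. simpl. lra. }
  assert (Hgour : forall x, (x <= s)%R ->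
    (q s t2 - q s t1) - Ci * J s = (q x t2 - q x t1) - Ci * J x).
  { intros x Hx.
    assert (Gt := goursat (fun w => G (cexp w)) x s t1 t2 Hx Ht
      ltac:(intros z [Hz _]; apply Hdiff; lra)).
    unfold boundary_integral in Gt. rewrite !Hhor in Gt by easy.
    change (q s t1 - q x t1 + Ci * J s - (q s t2 - q x t2) - Ci * J x = 0) in Gt.
    replace (q s t2 - q s t1 - Ci * J s) with
      ((q x t2 - q x t1) - Ci * J x -
       (q s t1 - q x t1 + Ci * J s - (q s t2 - q x t2) - Ci * J x)) by ring.
    rewrite Gt. ring. }
  assert (Hzero : (q s t2 - q s t1) - Ci * J s = 0).
  { apply Cmod_eq_0. apply Rle_antisym; [|apply Cmod_ge_0]. apply Rnot_lt_le.
    set (m := Cmod _). intros Hm.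
    (* Two end values below [e] and an integral of at most [(t2 - t1) * e] then add up to at most
       [m / 2]. *)
    set (e := (m / (2 * (2 + (t2 - t1))))%R).
    assert (He : (0 < e)%R) by (apply Rdiv_lt_0_compat; lra).
    destruct (log_integral_ccont G 0 HG unit_disk_0 e He) as [d1 [Hd1 H1]].
    destruct (cdiff_ccont _ _ (proj1 HG 0 unit_disk_0) e He) as [d2 [Hd2 H2]].
    rewrite log_integral_0 in H1. rewrite (proj2 HG) in H2.
    set (x := Rmin s (ln (Rmin d1 d2 / 2))).
    assert (Hd : (0 < Rmin d1 d2)%R) by now apply Rmin_glb_lt.
    assert (Hx : (exp x < Rmin d1 d2)%R).
    { apply Rle_lt_trans with (Rmin d1 d2 / 2)%R; [|lra].
      rewrite <- (exp_ln (Rmin d1 d2 / 2)) by lra.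
      destruct (Rmin_r s (ln (Rmin d1 d2 / 2))) as [Hl|Hl]; unfold x.
      - left. now apply exp_increasing.
      - rewrite Hl. lra. }
    assert (Hxs : (x <= s)%R) by apply Rmin_l.
    assert (Hc : forall t, (Cmod (cexp (x, t) - 0) < Rmin d1 d2)%R).
    { intros t. replace (cexp (x, t) - 0) with (cexp (x, t)) by ring. now rewrite Cmod_cexp. }
    assert (B1 : forall t, (Cmod (q x t) < e)%R).
    { intros t. replace (q x t) with (q x t - 0) by ring. apply H1.
      eapply Rlt_le_trans; [apply Hc|apply Rmin_l]. }
    assert (B2 : (Cmod (J x) <= (t2 - t1) * e)%R).
    { apply (is_CInt_bound (fun t => G (cexp (x, t)))); [easy| |now apply Hver].
      intros t _. left. replace (G (cexp (x, t))) with (G (cexp (x, t)) - 0) by ring.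
      apply H2. eapply Rlt_le_trans; [apply Hc|apply Rmin_r]. }
    assert (B : (m <= 2 * e + (t2 - t1) * e)%R).
    { unfold m. rewrite (Hgour x Hxs).
      eapply Rle_trans; [apply Cmod_triangle|].
      eapply Rle_trans; [apply Rplus_le_compat_r, Cmod_triangle|].
      rewrite !Cmod_opp, Cmod_mult, Cmod_Ci.
      assert (Ba := B1 t1). assert (Bb := B1 t2). lra. }
    assert (Ee : (2 * e + (t2 - t1) * e = m / 2)%R) by (unfold e; field; lra).
    lra. }
  replace (log_integral G (cexp (s, t2)) - log_integral G (cexp (s, t1))) with (Ci * J s).
  - apply is_CInt_scal, Hver. lra.
  - unfold q in Hzero.
    replace (Ci * J s) with (Ci * J s + 0) by ring. rewrite <- Hzero. ring.
Qed.

Lemma is_Rderive_angular (G : C -> C) (z : C) : normalized G -> unit_disk z -> z <> 0 ->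
  is_Rderive (fun t => log_integral G (z * cexp (0%R, t))) 0 (Ci * G z).
Proof.
  intros HG Hz Hn. destruct (nonzero_cexp z Hn) as [t0 E].
  set (s := ln (Cmod z)) in *.
  assert (Hs : (s < 0)%R).
  { unfold s. rewrite <- ln_1. apply ln_increasing; [|exact Hz]. now apply Cmod_gt_0. }
  assert (Er : forall t, z * cexp (0%R, t) = cexp (s, (t0 + t)%R)).
  { intros t. rewrite E, <- cexp_plus. f_equal.
    apply injective_projections; simpl; ring. }
  (* Integrating from the angle [-1] puts 0 in the interior of the range, so that the fundamental
     theorem gives a two-sided derivative. *)
  set (k := log_integral G (z * cexp (0%R, (-1)%R))).
  apply (is_derive_ext (K := R_AbsRing) (V := C_R_NormedModule)
    (fun t => plus (minus (log_integral G (z * cexp (0%R, t))) k) k)).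
  { intros t. change (log_integral G (z * cexp (0%R, t)) - k + k
      = log_integral G (z * cexp (0%R, t))). ring. }
  replace (Ci * G z) with (plus (G := C_R_NormedModule) (Ci * G (z * cexp (0%R, 0%R))) zero).
  2: { rewrite plus_zero_r. change ((0%R, 0%R) : C) with (RtoC 0). rewrite cexp_0, Cmult_1_r. easy. }
  apply (is_derive_plus (K := R_AbsRing) (V := C_R_NormedModule));
    [|apply (is_derive_const (K := R_AbsRing) (V := C_R_NormedModule))].
  apply (is_derive_RInt (V := C_R_NormedModule) (fun t => Ci * G (z * cexp (0%R, t))) _ (-1)).
  - exists (mkposreal 1 Rlt_0_1). intros t Ht.
    change (Rabs (t - 0) < 1)%R in Ht. apply Rabs_lt_between in Ht.
    assert (HI := is_CInt_angular G s (t0 + -1) (t0 + t) HG Hs ltac:(lra)).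
    unfold k. rewrite !Er.
    replace (t0 + -1)%R with (1 * -1 + t0)%R in HI by ring.
    replace (t0 + t)%R with (1 * t + t0)%R in HI by ring.
    apply (is_RInt_comp_lin (V := C_R_NormedModule)) in HI.
    replace (t0 + -1)%R with (1 * -1 + t0)%R by ring.
    replace (t0 + t)%R with (1 * t + t0)%R by ring.
    apply (is_RInt_ext (V := C_R_NormedModule)) with (2 := HI).
    intros y _. rewrite Er, (scal_one (K := R_AbsRing) (V := C_R_NormedModule)).
    do 3 f_equal. f_equal. ring.
  - apply (continuous_ccont_comp (fun w => Ci * G (z * cexp w)) (fun t => (0%R, t))).
    + apply continuous_pair_fun; [apply continuous_const|apply continuous_id].
    + apply ccont_mult; [apply ccont_const|].
      apply (ccont_comp G (fun w => z * cexp w)).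
      * apply ccont_mult; [apply ccont_const|apply cdiff_ccont, cdiff_cexp].
      * change ((0%R, 0%R) : C) with (RtoC 0). rewrite cexp_0, Cmult_1_r.
        now apply cdiff_ccont, HG.
Qed.

(** * Comparison with a starlike function *)

Definition starlike_map (F : C -> C) : Prop :=
  univalent F /\ F 0 = 0 /\
  forall z t, unit_disk z -> (0 <= t <= 1)%R -> image F unit_disk (RtoC t * F z).

(** Subordination by inclusion of ranges; for univalent [F] the inner Schwarz function is recovered
    by [subordination]. *)
Definition subordinate (G F : C -> C) : Prop :=
  normalized G /\ forall z, unit_disk z -> image F unit_disk (G z).

Lemma starlike_map_normalized (F : C -> C) : starlike_map F -> normalized F.
Proof. intros [[Hd _] [H0 _]]. now split. Qed.

Lemma starlike_map_neq0 (F : C -> C) (z : C) :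
  starlike_map F -> unit_disk z -> z <> 0 -> F z <> 0.
Proof.
  intros [[_ Hinj] [H0 _]] Hz Hn E. apply Hn, Hinj; [easy|apply unit_disk_0|congruence].
Qed.

Lemma starlike_map_modulus (F : C -> C) (z1 z2 : C) (t : R) : starlike_map F ->
  unit_disk z1 -> unit_disk z2 -> z2 <> 0 -> (0 <= t < 1)%R ->
  F z1 = RtoC t * F z2 -> (Cmod z1 < Cmod z2)%R.
Proof.
  intros HF Hz1 Hz2 Hn Ht E. assert (HF' := HF). destruct HF' as [HU [H0 Hstar]].
  destruct (subordination F (fun z => RtoC t * F z) HU) as [omega [Ho [_ Hcase]]].
  - intros z Hz. apply cdiff_mult; [apply cdiff_const|now apply HU].
  - intros z Hz. apply Hstar; [easy|lra].
  - rewrite H0. ring.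
  - assert (Ez : omega z2 = z1).
    { destruct (Ho z2 Hz2) as [H1 H2]. apply HU; try easy. now rewrite <- H2. }
    destruct Hcase as [Hlt|[eps [Heps Hrot]]].
    + rewrite <- Ez. now apply Hlt.
    (* A rotation would give [t F(z) = F(eps z)]. Division by [z] makes [u] vanish near 0 off 0,
       hence at 0 by continuity; as [F'(0)] is not 0, [t = eps], against [t < 1]. *)
    + exfalso.
      destruct (proj1 HU 0 unit_disk_0) as [h Hh].
      assert (EF : forall z, F z = h z * z).
      { intros z. rewrite (proj2 Hh z), H0. ring. }
      set (u := fun z => RtoC t * h z - eps * h (eps * z)).
      assert (Hu : ccont u 0).
      { apply ccont_minus; apply ccont_mult; try apply ccont_const; [apply Hh|].
        apply (ccont_comp h (fun z => eps * z)).
        - apply ccont_mult; [apply ccont_const|apply ccont_id].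
        - rewrite Cmult_0_r. apply Hh. }
      assert (Hu0 : u 0 = 0).
      { apply NNPP. intros Hne. destruct (ccont_neq0 u 0 Hu Hne) as [d [Hd H]].
        assert (H2 : (0 < Rmin d 1)%R) by (apply Rmin_glb_lt; lra).
        set (x := RtoC (Rmin d 1 / 2)).
        assert (Hx : Cmod x = (Rmin d 1 / 2)%R) by (unfold x; rewrite Cmod_R, Rabs_pos_eq; lra).
        assert (Hd1 := Rmin_l d 1). assert (Hd2 := Rmin_r d 1).
        assert (HDx : unit_disk x) by (unfold unit_disk; lra).
        assert (Hx0 : x <> 0) by (apply Cmod_gt_0; lra).
        apply (H x); [replace (x - 0) with x by ring; lra|].
        destruct (Ho x HDx) as [_ Ex]. rewrite Hrot, !EF in Ex by easy.
        assert (Eu : u x * x = 0).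
        { unfold u. replace ((RtoC t * h x - eps * h (eps * x)) * x) with
            (RtoC t * (h x * x) - h (eps * x) * (eps * x)) by ring. rewrite Ex. ring. }
        replace (u x) with (u x * x / x) by (field; easy). rewrite Eu. unfold Cdiv. ring. }
      assert (Hh0 := univalent_derivative_neq0 F h 0 HU unit_disk_0 Hh).
      unfold u in Hu0. rewrite Cmult_0_r in Hu0.
      assert (Et : RtoC t = eps).
      { replace (RtoC t) with ((RtoC t * h 0 - eps * h 0) / h 0 + eps) by (field; easy).
        rewrite Hu0. unfold Cdiv. ring. }
      rewrite <- Et, Cmod_R, Rabs_pos_eq in Heps by lra. lra.
Qed.

(** This is [starlike_map_modulus] with factor [s1 / s2]: the modulus increases strictly along the
    preimage of a ray. *)
Lemma starlike_map_order (F : C -> C) (e z1 z2 : C) (s1 s2 : R) : starlike_map F ->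
  unit_disk z1 -> unit_disk z2 -> e * F z1 = RtoC s1 -> e * F z2 = RtoC s2 ->
  (0 <= s1 < s2)%R -> (Cmod z1 < Cmod z2)%R.
Proof.
  intros HF Hz1 Hz2 E1 E2 Hs.
  assert (Hs2 : RtoC s2 <> 0) by (intros E; apply RtoC_inj in E; lra).
  assert (He : e <> 0) by (intros ->; apply Hs2; rewrite <- E2; ring).
  apply (starlike_map_modulus F z1 z2 (s1 / s2)); try easy.
  - intros ->. apply Hs2. rewrite <- E2, (proj1 (proj2 HF)). ring.
  - split; [apply Rdiv_le_0_compat; lra|].
    apply Rmult_lt_reg_r with s2; [lra|]. unfold Rdiv. rewrite Rmult_assoc, Rinv_l; lra.
  - assert (E : e * F z1 = e * (RtoC (s1 / s2) * F z2)).
    { replace (e * (RtoC (s1 / s2) * F z2)) with (RtoC (s1 / s2) * (e * F z2)) by ring.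
      rewrite E1, E2, RtoC_div by lra. field. easy. }
    replace (F z1) with (e * F z1 / e) by (field; easy). rewrite E. field. easy.
Qed.

Lemma starlike_map_circle_inj (F : C -> C) (e z1 z2 : C) (s1 s2 : R) : starlike_map F ->
  unit_disk z1 -> unit_disk z2 -> e * F z1 = RtoC s1 -> e * F z2 = RtoC s2 ->
  (0 < s1)%R -> (0 < s2)%R -> Cmod z1 = Cmod z2 -> z1 = z2.
Proof.
  intros HF Hz1 Hz2 E1 E2 H1 H2 Hm.
  destruct (Rtotal_order s1 s2) as [H|[H|H]].
  - assert (T := starlike_map_order F e z1 z2 s1 s2 HF Hz1 Hz2 E1 E2). lra.
  - subst s2. apply HF; try easy.
    assert (He : e <> 0).
    { intros ->. rewrite Cmult_0_l in E1. apply RtoC_inj in E1. lra. }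
    replace (F z1) with (e * F z1 / e) by (field; easy). rewrite E1, <- E2. field. easy.
  - assert (T := starlike_map_order F e z2 z1 s2 s1 HF Hz2 Hz1 E2 E1). lra.
Qed.

Lemma derivative_left_maximum (u : R -> R) (x l d : R) : is_derive u x l -> (0 < d)%R ->
  (forall y, (x - d < y < x)%R -> (u y <= u x)%R) -> (0 <= l)%R.
Proof.
  intros H Hd Hmax. apply is_derive_Reals in H. apply Rnot_lt_le. intros Hl.
  destruct (H (- l)%R ltac:(lra)) as [del Hdel]. assert (Hp := cond_pos del).
  set (k := (Rmin d del / 2)%R).
  assert (Hk : (0 < Rmin d del)%R) by now apply Rmin_glb_lt.
  assert (Hk1 := Rmin_l d del). assert (Hk2 := Rmin_r d del).
  specialize (Hdel (- k)%R ltac:(unfold k; lra)).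
  rewrite Rabs_Ropp, Rabs_pos_eq in Hdel by (unfold k; lra).
  specialize (Hdel ltac:(unfold k; lra)). apply Rabs_lt_between in Hdel.
  specialize (Hmax (x + - k)%R ltac:(unfold k; lra)).
  assert (Hq : (0 <= (u (x + - k) - u x) / - k)%R).
  { replace ((u (x + - k) - u x) / - k)%R with ((u x - u (x + - k)) / k)%R
      by (field; unfold k; lra).
    apply Rdiv_le_0_compat; unfold k in *; lra. }
  lra.
Qed.

Lemma derivative_right_maximum (u : R -> R) (x l d : R) : is_derive u x l -> (0 < d)%R ->
  (forall y, (x < y < x + d)%R -> (u y <= u x)%R) -> (l <= 0)%R.
Proof.
  intros H Hd Hmax.
  assert (H' : is_derive (fun y => u (- y)%R) (- x)%R (- l)%R).
  { replace (- l)%R with (scal (-1)%R l) by (unfold scal; simpl; unfold mult; simpl; ring).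
    apply (is_derive_comp u Ropp); [now rewrite Ropp_involutive|].
    auto_derive; [easy|ring]. }
  assert (T := derivative_left_maximum _ _ _ d H' Hd).
  cut (0 <= - l)%R; [lra|]. apply T. intros y Hy. rewrite Ropp_involutive. apply Hmax. lra.
Qed.

(* [v |-> Re (e * v)] is the real differential of [U] at [p], tested along curves. *)
Definition has_gradient (U : C -> R) (p e : C) : Prop :=
  forall (g : R -> C) (t : R) (l : C), is_Rderive g t l -> g t = p ->
    is_derive (fun s => U (g s)) t (Re (e * l)).

Lemma has_gradient_linear (e p : C) : has_gradient (fun v => Re (e * v)) p e.
Proof. intros g t l Hg _. now apply is_Rderive_Re_scal. Qed.

Lemma circle_maximum (G : C -> C) (U : C -> R) (e z : C) :
  normalized G -> unit_disk z -> z <> 0 -> has_gradient U (log_integral G z) e ->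
  (forall w, Cmod w = Cmod z -> (U (log_integral G w) <= U (log_integral G z))%R) ->
  exists s : R, e * G z = RtoC s.
Proof.
  intros HG Hz Hn HU Hmax.
  assert (Ez : z * cexp (0%R, 0%R) = z).
  { change ((0%R, 0%R) : C) with (RtoC 0). now rewrite cexp_0, Cmult_1_r. }
  assert (Hder := HU _ _ _ (is_Rderive_angular G z HG Hz Hn) (f_equal _ Ez)).
  assert (Hle : forall y, (U (log_integral G (z * cexp (0%R, y))%C)
     <= U (log_integral G (z * cexp (0%R, 0%R))%C))%R).
  { intros y. rewrite Ez. apply Hmax.
    rewrite Cmod_mult, Cmod_cexp. simpl. rewrite exp_0. ring. }
  assert (H1 := derivative_left_maximum _ _ _ 1 Hder Rlt_0_1 (fun y _ => Hle y)).
  assert (H2 := derivative_right_maximum _ _ _ 1 Hder Rlt_0_1 (fun y _ => Hle y)).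
  exists (Re (e * G z)).
  assert (E : Re (e * (Ci * G z)) = (- Im (e * G z))%R).
  { destruct e, (G z). simpl. ring. }
  apply injective_projections; simpl; [easy|].
  change (Im (e * G z) = 0%R). lra.
Qed.

Lemma is_derive_radial (G : C -> C) (e z : C) (s : R) : normalized G ->
  unit_disk (RtoC (exp s) * z) ->
  is_derive (fun x => Re (e * log_integral G (RtoC (exp x) * z)%C)) s
    (Re (e * G (RtoC (exp s) * z)%C)).
Proof.
  intros HG Hz. apply (is_Rderive_Re_scal e (fun x => log_integral G (RtoC (exp x) * z)%C)).
  now apply is_Rderive_radial.
Qed.

Lemma radial_mean_value (G : C -> C) (e z : C) (x : R) : normalized G -> (0 <= x)%R ->
  unit_disk (RtoC (exp x) * z) -> exists c, (0 <= c <= x)%R /\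
  (Re (e * log_integral G (RtoC (exp x) * z)%C) - Re (e * log_integral G z)
    = Re (e * G (RtoC (exp c) * z)%C) * x)%R.
Proof.
  intros HG Hx Hz.
  assert (Hin : forall y, (y <= x)%R -> unit_disk (RtoC (exp y) * z)).
  { intros y Hy. unfold unit_disk in *.
    rewrite Cmod_mult, Cmod_R, Rabs_pos_eq in * by (left; apply exp_pos).
    eapply Rle_lt_trans; [|apply Hz]. apply Rmult_le_compat_r; [apply Cmod_ge_0|].
    destruct Hy as [Hy| ->]; [left; now apply exp_increasing|lra]. }
  destruct (MVT_gen (fun y => Re (e * log_integral G (RtoC (exp y) * z)%C)) 0 x
    (fun y => Re (e * G (RtoC (exp y) * z)%C))) as [c [Hc E]].
  - intros y Hy. rewrite Rmin_left, Rmax_right in Hy by lra.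
    apply is_derive_radial, Hin; [easy|lra].
  - intros y Hy. rewrite Rmin_left, Rmax_right in Hy by lra.
    apply continuity_pt_filterlim.
    apply (ex_derive_continuous (K := R_AbsRing) (V := R_NormedModule)).
    eexists. apply is_derive_radial, Hin; [easy|lra].
  - rewrite Rmin_left, Rmax_right in Hc by lra. exists c. split; [easy|].
    rewrite exp_0, Cmult_1_l, Rminus_0_r in E. exact E.
Qed.

Lemma Cmod_exp_scal (x : R) (z : C) : Cmod (RtoC (exp x) * z) = (exp x * Cmod z)%R.
Proof. rewrite Cmod_mult, Cmod_R, Rabs_pos_eq; [easy|left; apply exp_pos]. Qed.

(** A general [U] is allowed because two choices are needed: linear functionals, for the supporting
    lines, and minus half the squared distance, for the closest point. *)
Lemma disk_maximum (F : C -> C) (U : C -> R) (e z : C) (r : R) : starlike_map F -> e <> 0 ->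
  has_gradient U (log_integral F z) e -> (0 < r < 1)%R -> (Cmod z <= r)%R ->
  (forall w, (Cmod w <= r)%R -> (U (log_integral F w) <= U (log_integral F z))%R) ->
  Cmod z = r /\ exists s, (0 < s)%R /\ e * F z = RtoC s.
Proof.
  intros HF He HU Hr Hz Hmax.
  assert (HN := starlike_map_normalized F HF).
  assert (HzD : unit_disk z) by (unfold unit_disk; lra).
  assert (Hn : z <> 0).
  (* At the origin the transform has derivative [h 0 = F'(0)], not 0. Moving in the direction [k],
     the conjugate of [e * h 0], increases [U] at rate [|e * h 0|^2]. *)
  { intros ->.
    destruct (proj1 HN 0 unit_disk_0) as [h Hh].
    destruct (log_integral_slope_0 F h HN Hh) as [A [HA EA]].
    assert (Hh0 := univalent_derivative_neq0 F h 0 (proj1 HF) unit_disk_0 Hh).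
    set (k := Cconj (e * h 0)).
    assert (Hk : Cmod k = Cmod (e * h 0)) by apply Cmod_conj.
    assert (Hpos : (0 < Cmod (e * h 0))%R) by now apply Cmod_gt_0, Cmult_neq_0.
    assert (Ek : 0 + RtoC 0 * k = 0) by ring.
    assert (HA' : has_slope (log_integral F) A (0 + RtoC 0 * k)) by now rewrite Ek.
    assert (Hder := HU _ _ _ (is_Rderive_line _ _ _ _ _ HA')
      (f_equal (log_integral F) Ek)).
    rewrite Ek, EA in Hder.
    assert (H := derivative_right_maximum _ _ _ (r / Cmod k) Hder
      ltac:(rewrite Hk; apply Rdiv_lt_0_compat; lra)).
    assert (E : Re (e * (h 0 * k)) = (Cmod (e * h 0) ^ 2)%R).
    { rewrite Cmod2_alt. unfold k. destruct e, (h 0). simpl. ring. }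
    cut (Re (e * (h 0 * k)) <= 0)%R; [nra|]. apply H. intros y Hy.
    rewrite Ek. apply Hmax.
    replace (0 + RtoC y * k) with (RtoC y * k) by ring.
    rewrite Cmod_mult, Cmod_R, Rabs_pos_eq by lra.
    apply Rle_trans with (r / Cmod k * Cmod k)%R.
    - apply Rmult_le_compat_r; [apply Cmod_ge_0|lra].
    - right. field. lra. }
  destruct (circle_maximum F U e z HN HzD Hn HU) as [s Es].
  { intros w Hw. apply Hmax. lra. }
  assert (Hs : s <> 0%R).
  { intros ->. apply (starlike_map_neq0 F z HF HzD Hn).
    replace (F z) with (e * F z / e) by (field; easy). rewrite Es. unfold Cdiv. ring. }
  assert (Hz0 : RtoC (exp 0) * z = z) by (rewrite exp_0; ring).
  assert (Hder := HU _ _ _ (is_Rderive_radial F z 0 HN ltac:(now rewrite Hz0)) (f_equal _ Hz0)).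
  rewrite Hz0, Es in Hder. simpl in Hder.
  assert (Hs0 : (0 <= s)%R).
  { apply (derivative_left_maximum _ _ _ 1 Hder Rlt_0_1). intros y Hy.
    rewrite Hz0. apply Hmax. rewrite Cmod_exp_scal.
    assert (H := exp_increasing y 0 ltac:(lra)). rewrite exp_0 in H.
    assert (P := Cmod_ge_0 z). assert (P' := exp_pos y). nra. }
  split; [|exists s; split; [lra|easy]].
  (* An interior maximum could also be tested outward, which would give [s <= 0]. *)
  destruct Hz as [Hlt|]; [exfalso|easy].
  assert (Hp := proj1 (Cmod_gt_0 z) Hn).
  assert (Hln : (0 < ln (r / Cmod z))%R).
  { rewrite <- ln_1. apply ln_increasing; [lra|].
    apply Rmult_lt_reg_r with (Cmod z); [easy|]. unfold Rdiv.
    rewrite Rmult_assoc, Rinv_l; lra. }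
  assert (H := derivative_right_maximum _ _ _ _ Hder Hln).
  cut (s <= 0)%R; [lra|]. apply H. intros y Hy. rewrite Hz0. apply Hmax.
  rewrite Cmod_exp_scal.
  assert (H1 := exp_increasing y (ln (r / Cmod z)) ltac:(lra)).
  rewrite exp_ln in H1 by (apply Rdiv_lt_0_compat; lra).
  apply Rle_trans with (r / Cmod z * Cmod z)%R; [nra|]. right. field. lra.
Qed.

Lemma disk_maximum_exists (F : C -> C) (e : C) (r : R) : starlike_map F -> (0 <= r < 1)%R ->
  exists z, (Cmod z <= r)%R /\
  forall w, (Cmod w <= r)%R -> (Re (e * log_integral F w) <= Re (e * log_integral F z))%R.
Proof.
  intros HF Hr.
  destruct (max_attained_ccont (fun z => (Cmod (z - 0) <= r)%R) (fun z => e * log_integral F z))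
    as [[z [Hz Hm]] _].
  - apply closed_disk_closed.
  - apply closed_disk_bounded.
  - exists 0. rewrite Cminus_diag, Cmod_0. lra.
  - intros z Hz. apply ccont_mult; [apply ccont_const|].
    apply log_integral_ccont; [now apply starlike_map_normalized|].
    unfold unit_disk. replace (z - 0) with z in Hz by ring. lra.
  - exists z. replace (z - 0) with z in Hz by ring. split; [easy|].
    intros w Hw. apply Hm. now replace (w - 0) with w by ring.
Qed.

(** A maximum point exists by compactness, lies on the circle and has [e * F > 0] there. Only one
    point of the circle has this property, so it is [z]. *)
Lemma disk_maximum_of_direction (F : C -> C) (e z : C) (s : R) : starlike_map F ->
  unit_disk z -> z <> 0 -> (0 < s)%R -> e * F z = RtoC s ->
  forall w, (Cmod w <= Cmod z)%R -> (Re (e * log_integral F w) <= Re (e * log_integral F z))%R.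
Proof.
  intros HF Hz Hn Hs E.
  assert (Hp := proj1 (Cmod_gt_0 z) Hn). assert (Hz' := Hz). unfold unit_disk in Hz'.
  assert (He : e <> 0).
  { intros ->. rewrite Cmult_0_l in E. apply RtoC_inj in E. lra. }
  destruct (disk_maximum_exists F e (Cmod z) HF ltac:(lra)) as [z1 [Hz1 Hmax]].
  destruct (disk_maximum F (fun v => Re (e * v)) e z1 (Cmod z) HF He (has_gradient_linear e _)
    ltac:(lra) Hz1 Hmax) as [Em [s1 [Hs1 E1]]].
  assert (z1 = z) as <-; [|exact Hmax].
  apply (starlike_map_circle_inj F e z1 z s1 s); try easy.
  unfold unit_disk. lra.
Qed.

(* [m r] is the value at [e] of the support function of the image of the closed disk
   of radius [r]. *)
Definition support_value (F : C -> C) (e : C) (m : R -> R) : Prop :=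
  forall r, (0 <= r < 1)%R -> exists z, Cmod z = r /\ m r = Re (e * log_integral F z) /\
    forall w, (Cmod w <= r)%R -> (Re (e * log_integral F w) <= m r)%R.

Lemma support_value_exists (F : C -> C) (e : C) : starlike_map F -> e <> 0 ->
  exists m, support_value F e m.
Proof.
  intros HF He.
  assert (Hex : forall r, exists x, (0 <= r < 1)%R ->
    exists z, Cmod z = r /\ x = Re (e * log_integral F z) /\
    forall w, (Cmod w <= r)%R -> (Re (e * log_integral F w) <= x)%R).
  { intros r. destruct (classic (0 <= r < 1)%R) as [Hr|Hr]; [|exists 0%R; tauto].
    destruct (disk_maximum_exists F e r HF Hr) as [z [Hz Hmax]].
    exists (Re (e * log_integral F z)). intros _. exists z. split; [|now split].
    destruct (Req_dec r 0) as [->|Hn].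
    - assert (P := Cmod_ge_0 z). lra.
    - apply (disk_maximum F (fun v => Re (e * v)) e z r); try easy; [apply has_gradient_linear|lra]. }
  destruct (choice _ Hex) as [m Hm]. now exists m.
Qed.

(* At a maximum of [Re (e * log_integral G z) - m |z|] the radial derivative of the
   first term would be the length of a point [e * G z] on the positive axis, which is
   attained by [e * F] strictly inside the disk of radius [|z|], hence shorter than
   the radial derivative of [m]. *)
Lemma support_comparison_no_maximum (F G omega : C -> C) (e : C) (m : R -> R) (z : C) :
  starlike_map F -> e <> 0 -> support_value F e m -> normalized G ->
  unit_disk z -> z <> 0 -> unit_disk (omega z) -> G z = F (omega z) ->
  (Cmod (omega z) < Cmod z)%R ->
  ~ (forall w, (Cmod w <= Cmod z)%R ->
       Re (e * log_integral G w) - m (Cmod w) <= Re (e * log_integral G z) - m (Cmod z))%R.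
Proof.
  intros HF He Hm HG Hz Hn Hoz EG Hlt Hmax.
  assert (HN := starlike_map_normalized F HF).
  assert (Hz1 := Hz). unfold unit_disk in Hz1.
  set (t := Cmod z) in *. assert (Htp := proj1 (Cmod_gt_0 z) Hn). fold t in Htp.
  destruct (circle_maximum G (fun v => Re (e * v)) e z HG Hz Hn (has_gradient_linear e _)) as [sg Esg].
  { intros w Hw. specialize (Hmax w ltac:(unfold t; lra)). rewrite Hw in Hmax.
    unfold t in Hmax. lra. }
  assert (Hdir : forall r zeta, (0 < r < 1)%R -> Cmod zeta = r ->
    m r = Re (e * log_integral F zeta) ->
    (forall w, (Cmod w <= r)%R -> (Re (e * log_integral F w) <= m r)%R) ->
    exists s, (0 < s)%R /\ e * F zeta = RtoC s).
  { intros r zeta Hr Ez Em Hle. apply (disk_maximum F (fun v => Re (e * v)) e zeta r HF He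
      (has_gradient_linear e _) Hr ltac:(lra)).
    intros w Hw. rewrite <- Em. now apply Hle. }
  (* A radius strictly between [|omega z|] and [|z|]: it gives a gap [s1 - sg] that is fixed before
     the step is chosen and persists for all radii from [r1] on. *)
  set (r1 := ((Cmod (omega z) + t) / 2)%R).
  assert (Hr1 : (0 < r1)%R) by (assert (P := Cmod_ge_0 (omega z)); unfold r1; lra).
  assert (Hr1t : (r1 < t)%R) by (unfold r1; lra).
  assert (Hr1o : (Cmod (omega z) < r1)%R) by (unfold r1; lra).
  destruct (Hm r1 ltac:(lra)) as [z1 [Ez1 [Em1 Hle1]]].
  destruct (Hdir r1 z1 ltac:(lra) Ez1 Em1 Hle1) as [s1 [Hs1 Es1]].
  assert (HDz1 : unit_disk z1) by (unfold unit_disk; lra).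
  (* Here [sg = e * F (omega z)]; a value of at least [s1] would force [|omega z| >= r1]. *)
  assert (Hgap : (sg < s1)%R).
  { apply Rnot_le_lt. intros [Hgt|Heq].
    - assert (T := starlike_map_order F e z1 (omega z) s1 sg HF HDz1 Hoz Es1
        ltac:(now rewrite <- EG) ltac:(lra)). lra.
    - assert (T : z1 = omega z).
      { apply HF; try easy. rewrite <- EG.
        replace (F z1) with (e * F z1 / e) by (field; easy).
        rewrite Es1, Heq, <- Esg. field. easy. }
      rewrite <- T in Hr1o. lra. }
  (* A third of the gap, so that [sg + eta < s1 - eta] survives both continuity errors. *)
  set (eta := ((s1 - sg) / 3)%R). assert (Heta : (0 < eta)%R) by (unfold eta; lra).
  destruct (heine (fun w => (Cmod (w - 0) <= t)%R) (fun w => e * F w)) with (eps := eta)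
    as [d1 [Hd1 H1]].
  { apply closed_disk_closed. }
  { apply closed_disk_bounded. }
  { intros w Hw. apply ccont_mult; [apply ccont_const|]. apply cdiff_ccont, HN.
    replace (w - 0) with w in Hw by ring. unfold unit_disk. lra. }
  { easy. }
  assert (HcG : ccont (fun w => e * G w) z).
  { apply ccont_mult; [apply ccont_const|]. now apply cdiff_ccont, HG. }
  destruct (HcG eta Heta) as [d2 [Hd2 H2]].
  (* The step in the logarithm of the radius. The bounds ensure in turn [exp y <= 1 + 2 * x] on the
     step, displacements of at most [2 * x] below [d1] and [d2], and [exp (- x) * t >= r1]. *)
  set (x := Rmin (/ 2) (Rmin (d1 / 3) (Rmin (d2 / 3) (1 - r1 / t)))).
  assert (Hq : (r1 / t < 1)%R).
  { apply Rmult_lt_reg_r with t; [easy|]. unfold Rdiv. rewrite Rmult_assoc, Rinv_l; lra. }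
  assert (Hx : (0 < x)%R) by (repeat apply Rmin_glb_lt; lra).
  assert (Hx1 : (x <= / 2)%R) by apply Rmin_l.
  assert (Hx2 : (x <= d1 / 3)%R) by (eapply Rle_trans; [apply Rmin_r|apply Rmin_l]).
  assert (Hx3 : (x <= d2 / 3)%R)
    by (do 2 (eapply Rle_trans; [apply Rmin_r|]); apply Rmin_l).
  assert (Hx4 : (x <= 1 - r1 / t)%R)
    by (do 2 (eapply Rle_trans; [apply Rmin_r|]); apply Rmin_r).
  assert (Hexp : forall y, (0 <= y <= x)%R -> (1 <= exp y <= 1 + 2 * x)%R).
  { intros y Hy.
    assert (B := exp_minus_affine_bound y ltac:(rewrite Rabs_pos_eq; lra)). nra. }
  set (r := (exp (- x) * t)%R).
  assert (Hexpn : (1 - x <= exp (- x))%R) by (assert (B := exp_ineq1_le (- x)); lra).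
  assert (Hexpn' : (exp (- x) < 1)%R) by (rewrite <- exp_0; apply exp_increasing; lra).
  assert (Exx : (exp x * exp (- x) = 1)%R) by (rewrite <- exp_plus, Rplus_opp_r; apply exp_0).
  assert (Hr : (r1 <= r < t)%R).
  { unfold r. split; [|nra].
    assert (B : (r1 / t * t <= exp (- x) * t)%R) by (apply Rmult_le_compat_r; lra).
    replace (r1 / t * t)%R with r1 in B by (field; lra). exact B. }
  destruct (Hm r ltac:(lra)) as [z2 [Ez2 [Em2 Hle2]]].
  destruct (Hdir r z2 ltac:(lra) Ez2 Em2 Hle2) as [s2 [Hs2 Es2]].
  assert (HDz2 : unit_disk z2) by (unfold unit_disk; lra).
  assert (Hs12 : (s1 <= s2)%R).
  { apply Rnot_lt_le. intros Hgt.
    assert (T := starlike_map_order F e z2 z1 s2 s1 HF HDz2 HDz1 Es2 Es1 ltac:(lra)). lra. }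
  assert (Ext : (exp x * r = t)%R) by (unfold r; rewrite <- Rmult_assoc, Exx; ring).
  destruct (radial_mean_value F e z2 x HN ltac:(lra)) as [c [Hc Ec]].
  { unfold unit_disk. rewrite Cmod_exp_scal, Ez2, Ext. lra. }
  assert (HF1 : (s2 - eta <= Re (e * F (RtoC (exp c) * z2)%C))%R).
  { assert (B : (Cmod (e * F (RtoC (exp c) * z2)%C - e * F z2) < eta)%R).
    { apply H1; [replace (z2 - 0) with z2 by ring; lra|].
      replace (RtoC (exp c) * z2 - z2) with (RtoC (exp c - 1) * z2)
        by (rewrite RtoC_minus; ring).
      specialize (Hexp c Hc). rewrite Cmod_mult, Cmod_R, Rabs_pos_eq by lra. nra. }
    rewrite Es2 in B. assert (B' := re_le_Cmod (e * F (RtoC (exp c) * z2)%C - RtoC s2)).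
    assert (B'' := Rabs_le_between (Re (e * F (RtoC (exp c) * z2)%C - RtoC s2)) eta).
    change (Re (e * F (RtoC (exp c) * z2)%C - RtoC s2))
      with (Re (e * F (RtoC (exp c) * z2)%C) - s2)%R in *.
    lra. }
  (* The maximum point [z2] for radius [r], dilated to radius [t], competes for [m t]; so
     [m t - m r >= (s2 - eta) * x] without differentiating [m]. *)
  destruct (Hm t ltac:(lra)) as [_ [_ [_ Hlet]]].
  assert (Hlow := Hlet (RtoC (exp x) * z2) ltac:(rewrite Cmod_exp_scal, Ez2; lra)).
  set (z3 := RtoC (exp (- x)) * z).
  assert (Ez3 : RtoC (exp x) * z3 = z).
  { unfold z3. rewrite Cmult_assoc, <- RtoC_mult, Exx. ring. }
  assert (Hmz3 : Cmod z3 = r) by (unfold z3, r, t; apply Cmod_exp_scal).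
  destruct (radial_mean_value G e z3 x HG ltac:(lra) ltac:(now rewrite Ez3)) as [c' [Hc' Ec']].
  rewrite Ez3 in Ec'.
  assert (HG1 : (Re (e * G (RtoC (exp c') * z3)%C) <= sg + eta)%R).
  { assert (B : (Cmod (e * G (RtoC (exp c') * z3)%C - e * G z) < eta)%R).
    { apply H2. rewrite <- Ez3.
      replace (RtoC (exp c') * z3 - RtoC (exp x) * z3) with (- (RtoC (exp x - exp c') * z3))
        by (rewrite RtoC_minus; ring).
      assert (Hc1 := Hexp c' Hc'). assert (Hc2 := Hexp x ltac:(lra)).
      rewrite Cmod_opp, Cmod_mult, Cmod_R, Hmz3.
      apply Rle_lt_trans with (2 * x * 1)%R; [|lra].
      apply Rmult_le_compat; [apply Rabs_pos|lra|apply Rabs_le; lra|lra]. }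
    rewrite Esg in B. assert (B' := re_le_Cmod (e * G (RtoC (exp c') * z3)%C - RtoC sg)).
    assert (B'' := Rle_abs (Re (e * G (RtoC (exp c') * z3)%C - RtoC sg))).
    change (Re (e * G (RtoC (exp c') * z3)%C - RtoC sg))
      with (Re (e * G (RtoC (exp c') * z3)%C) - sg)%R in *.
    lra. }
  specialize (Hmax z3 ltac:(lra)). rewrite Hmz3 in Hmax.
  assert (A1 : ((s2 - eta) * x <= Re (e * F (RtoC (exp c) * z2)%C) * x)%R)
    by (apply Rmult_le_compat_r; lra).
  assert (A2 : (Re (e * G (RtoC (exp c') * z3)%C) * x <= (sg + eta) * x)%R)
    by (apply Rmult_le_compat_r; lra).
  assert (A3 : ((sg + eta) * x < (s2 - eta) * x)%R)
    by (apply Rmult_lt_compat_r; [easy|unfold eta; lra]).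
  lra.
Qed.

(** The difference of the two sides attains a maximum on the closed disk of radius [|z|]; this can
    only be at 0, where it is 0. For that, [m] need only be lower semicontinuous. *)
Lemma support_comparison (F G omega : C -> C) (e : C) (m : R -> R) :
  starlike_map F -> e <> 0 -> support_value F e m -> normalized G ->
  (forall z, unit_disk z -> unit_disk (omega z) /\ G z = F (omega z)) ->
  (forall z, unit_disk z -> z <> 0 -> (Cmod (omega z) < Cmod z)%R) ->
  forall z, unit_disk z -> z <> 0 -> (Re (e * log_integral G z) < m (Cmod z))%R.
Proof.
  intros HF He Hm HG Ho Hlt z Hz Hn.
  assert (HN := starlike_map_normalized F HF).
  assert (Hz1 := Hz). unfold unit_disk in Hz1. assert (Hz0 := Cmod_ge_0 z).
  assert (Hnomax := fun w Hw Hwn => support_comparison_no_maximum F G omega e m w HF He Hm HG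
    Hw Hwn (proj1 (Ho w Hw)) (proj2 (Ho w Hw)) (Hlt w Hw Hwn)).
  destruct (max_attained (fun w => (Cmod (w - 0) <= Cmod z)%R)
    (fun w => Re (e * log_integral G w) - m (Cmod w))%R) as [z1 [Hz1' Hmax]].
  - apply closed_disk_closed.
  - apply closed_disk_bounded.
  - exists 0. rewrite Cminus_diag, Cmod_0. easy.
  - intros w Hw eps Heps. replace (w - 0) with w in Hw by ring.
    assert (HDw : unit_disk w) by (unfold unit_disk; lra).
    assert (Hw0 := Cmod_ge_0 w).
    assert (HcG : ccont (fun w => e * log_integral G w) w).
    { apply ccont_mult; [apply ccont_const|]. now apply log_integral_ccont. }
    destruct (HcG (eps / 2)%R ltac:(lra)) as [d1 [Hd1 H1]].
    destruct (Hm (Cmod w) ltac:(lra)) as [zeta [Ez [Em Hle]]].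
    assert (HDzeta : unit_disk zeta) by (unfold unit_disk; lra).
    assert (HcF : ccont (fun w => e * log_integral F w) zeta).
    { apply ccont_mult; [apply ccont_const|]. now apply log_integral_ccont. }
    destruct (HcF (eps / 2)%R ltac:(lra)) as [d2 [Hd2 H2]].
    exists (Rmin d1 d2). split; [now apply Rmin_glb_lt|]. intros y Hy Hyd.
    replace (y - 0) with y in Hy by ring.
    assert (Hy1 := Rlt_le_trans _ _ _ Hyd (Rmin_l _ _)).
    assert (Hy2 := Rlt_le_trans _ _ _ Hyd (Rmin_r _ _)).
    (* Rescaling the maximum point [zeta] for radius [|w|] to modulus [|y|] gives a nearby
       competitor for [m |y|], hence lower semicontinuity. *)
    assert (Hu : exists u, (Cmod u <= Cmod y)%R /\ (Cmod (u - zeta) <= Cmod (y - w))%R).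
    { destruct (Ceq_dec w 0) as [->|Hwn].
      - exists zeta. rewrite Ez, Cmod_0, Cminus_diag, Cmod_0. split; apply Cmod_ge_0.
      - assert (Hwp := proj1 (Cmod_gt_0 w) Hwn).
        assert (Hy0 := Cmod_ge_0 y).
        assert (Hq : (0 <= Cmod y / Cmod w)%R) by (apply Rdiv_le_0_compat; lra).
        exists (RtoC (Cmod y / Cmod w) * zeta). split.
        + rewrite Cmod_mult, Cmod_R, Rabs_pos_eq, Ez by easy. right. field. lra.
        + replace (RtoC (Cmod y / Cmod w) * zeta - zeta)
            with (RtoC (Cmod y / Cmod w - 1) * zeta) by (rewrite RtoC_minus; ring).
          rewrite Cmod_mult, Cmod_R, Ez.
          rewrite <- (Rabs_pos_eq (Cmod w)) at 2 by easy. rewrite <- Rabs_mult.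
          replace ((Cmod y / Cmod w - 1) * Cmod w)%R with (Cmod y - Cmod w)%R by (field; lra).
          assert (T1 := Cmod_reverse_triangle y w). assert (T2 := Cmod_reverse_triangle w y).
          rewrite (Cmod_minus_sym w y) in T2. apply Rabs_le. lra. }
    destruct Hu as [u [Hu1 Hu2]].
    specialize (H1 y Hy1). specialize (H2 u ltac:(lra)).
    destruct (Hm (Cmod y) ltac:(assert (P := Cmod_ge_0 y); lra)) as [_ [_ [_ Hley]]].
    specialize (Hley u Hu1).
    assert (R1 := re_le_Cmod (e * log_integral G y - e * log_integral G w)).
    assert (R2 := re_le_Cmod (e * log_integral F u - e * log_integral F zeta)).
    change (Re (e * log_integral G y - e * log_integral G w))
      with (Re (e * log_integral G y) - Re (e * log_integral G w))%R in R1.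
    change (Re (e * log_integral F u - e * log_integral F zeta))
      with (Re (e * log_integral F u) - Re (e * log_integral F zeta))%R in R2.
    apply Rabs_le_between in R1, R2. lra.
  - replace (z1 - 0) with z1 in Hz1' by ring.
    assert (HDz1 : unit_disk z1) by (unfold unit_disk; lra).
    assert (Hmax' : forall w, (Cmod w <= Cmod z)%R ->
      (Re (e * log_integral G w) - m (Cmod w) <= Re (e * log_integral G z1) - m (Cmod z1))%R).
    { intros w Hw. apply Hmax. now replace (w - 0) with w by ring. }
    assert (E1 : z1 = 0).
    { apply NNPP. intros Hn1. apply (Hnomax z1 HDz1 Hn1). intros w Hw. apply Hmax'. lra. }
    subst z1.
    assert (E0 : (Re (e * log_integral G 0) - m (Cmod 0) = 0)%R).
    { destruct (Hm 0%R ltac:(lra)) as [zeta [Ez [Em _]]].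
      apply Cmod_eq_0 in Ez. subst zeta. rewrite Cmod_0, Em, !log_integral_0. ring. }
    (* Strictness: if the difference were nonnegative at [z], then [z] itself would be a maximum
       point. *)
    apply Rnot_le_lt. intros Hge. apply (Hnomax z Hz Hn).
    intros w Hw. specialize (Hmax' w Hw). lra.
Qed.

(** With [e = conj (F zeta)] the number [e * F zeta = |F zeta|^2] is positive, so [zeta] is the
    maximum point on its circle. If [G] is not a rotation the comparison is strict; if it is, its
    value is that of [F] at [eps * z], and equality forces [eps * z = zeta]. *)
Lemma support_inequality (F G : C -> C) (z zeta : C) : starlike_map F -> subordinate G F ->
  unit_disk z -> z <> 0 -> Cmod zeta = Cmod z ->
  (Re (Cconj (F zeta) * log_integral G z) <= Re (Cconj (F zeta) * log_integral F zeta))%R /\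
  (Re (Cconj (F zeta) * log_integral G z) = Re (Cconj (F zeta) * log_integral F zeta) ->
   exists eps, Cmod eps = 1%R /\ zeta = eps * z /\ forall w, unit_disk w -> G w = F (eps * w)).
Proof.
  intros HF [HG Hsub] Hz Hn Hm.
  assert (HDzeta : unit_disk zeta) by (unfold unit_disk in *; lra).
  assert (Hp := proj1 (Cmod_gt_0 z) Hn).
  assert (Hzeta : zeta <> 0) by (apply Cmod_gt_0; lra).
  assert (HFz := starlike_map_neq0 F zeta HF HDzeta Hzeta).
  set (e := Cconj (F zeta)).
  assert (He : e <> 0).
  { apply Cmod_gt_0. unfold e. rewrite Cmod_conj. now apply Cmod_gt_0. }
  set (s := (Cmod (F zeta) ^ 2)%R).
  assert (Hs : (0 < s)%R) by (apply pow_lt; now apply Cmod_gt_0).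
  assert (Es : e * F zeta = RtoC s) by apply conj_mult_self.
  assert (Hmax := disk_maximum_of_direction F e zeta s HF HDzeta Hzeta Hs Es).
  destruct (subordination F G (proj1 HF)) as [omega [Ho [_ Hcase]]];
    [apply HG|easy|now rewrite (proj2 HG), (proj1 (proj2 HF))|].
  destruct Hcase as [Hlt|[eps [Heps Hrot]]].
  - destruct (support_value_exists F e HF He) as [m Hsup].
    assert (H := support_comparison F G omega e m HF He Hsup HG Ho Hlt z Hz Hn).
    unfold unit_disk in Hz.
    destruct (Hsup (Cmod z) ltac:(lra)) as [z1 [Ez1 [Em1 _]]].
    specialize (Hmax z1 ltac:(lra)). lra.
  - assert (HGF : forall w, unit_disk w -> G w = F (eps * w)).
    { intros w Hw. destruct (Ho w Hw) as [_ ->]. now rewrite Hrot. }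
    assert (EI : log_integral G z = log_integral F (eps * z)).
    { rewrite (log_integral_ext G (fun w => F (eps * w)) z Hz HGF).
      apply (log_integral_dilation F eps z), HF. }
    assert (Hmz : Cmod (eps * z) = Cmod zeta) by (rewrite Cmod_mult, Heps; lra).
    rewrite EI. split; [apply Hmax; lra|]. intros Eq.
    exists eps. split; [easy|]. split; [|easy].
    assert (Hm1 : (Cmod zeta < 1)%R) by exact HDzeta.
    destruct (disk_maximum F (fun v => Re (e * v)) e (eps * z) (Cmod zeta) HF He
      (has_gradient_linear e _) ltac:(lra) ltac:(lra))
      as [_ [s' [Hs' Es']]].
    { intros w Hw. rewrite Eq. now apply Hmax. }
    symmetry. apply (starlike_map_circle_inj F e (eps * z) zeta s' s); try easy.
    unfold unit_disk. lra.
Qed.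

(** * The region of variability *)

Lemma Cconj_neq0 (z : C) : z <> 0 -> Cconj z <> 0.
Proof. intros Hz. apply Cmod_gt_0. rewrite Cmod_conj. now apply Cmod_gt_0. Qed.

Lemma ccont_conj (f : C -> C) (z : C) : ccont f z -> ccont (fun w => Cconj (f w)) z.
Proof.
  intros Hf eps He. destruct (Hf eps He) as [d [Hd H]]. exists d. split; [easy|].
  intros w Hw. rewrite <- Cminus_conj, Cmod_conj. now apply H.
Qed.

(** The factor one half makes the gradient exactly [- conj (p - w)]. Both coordinates of [g] are
    treated as real parts, of [1 * g] and of [- Ci * g]. *)
Lemma has_gradient_distance (p w : C) :
  has_gradient (fun v => - Cmod (v - w) ^ 2 / 2)%R p (- Cconj (p - w)).
Proof.
  intros g t l Hg <-.
  assert (H1 := is_Rderive_Re_scal 1 g t l Hg).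
  assert (H2 := is_Rderive_Re_scal (- Ci) g t l Hg).
  set (u := fun s => Re (1 * g s)). set (v := fun s => Re (- Ci * g s)).
  change (is_derive u t (Re (1 * l))) in H1. change (is_derive v t (Re (- Ci * l))) in H2.
  apply (is_derive_ext (fun s => - ((u s - Re w) ^ 2 + (v s - Im w) ^ 2) / 2)%R).
  { intros s. rewrite Cmod2_alt. unfold u, v. destruct (g s), w. simpl.
    unfold Rdiv. f_equal. ring. }
  replace (Re (- Cconj (g t - w) * l))
    with (- ((u t - Re w) * Re (1 * l) + (v t - Im w) * Re (- Ci * l)))%R
    by (unfold u, v; destruct (g t), w, l; simpl; ring).
  clearbody u v. auto_derive.
  - split; [|split; [|easy]]; eexists; [exact H1|exact H2].
  - change (fun x : R => u x) with u. change (fun x : R => v x) with v.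
    rewrite (is_derive_unique _ _ _ H1), (is_derive_unique _ _ _ H2). field.
Qed.

Definition support_region (F : C -> C) (r : R) (w : C) : Prop :=
  forall zeta, Cmod zeta = r ->
    (Re (Cconj (F zeta) * w) <= Re (Cconj (F zeta) * log_integral F zeta))%R.

(** A point on the supporting line at [zeta] is itself a maximum point of the same functional, and
    that is unique. This gives both strict support and injectivity on circles. *)
Lemma log_integral_circle_unique (F : C -> C) (zeta z : C) :
  starlike_map F -> unit_disk zeta -> zeta <> 0 -> (Cmod z <= Cmod zeta)%R ->
  Re (Cconj (F zeta) * log_integral F z) = Re (Cconj (F zeta) * log_integral F zeta) ->
  z = zeta.
Proof.
  intros HF Hzeta Hn Hz E.
  assert (HFz := starlike_map_neq0 F zeta HF Hzeta Hn).
  assert (Hs : (0 < Cmod (F zeta) ^ 2)%R) by now apply pow_lt, Cmod_gt_0.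
  assert (Hmax := disk_maximum_of_direction F _ zeta _ HF Hzeta Hn Hs (conj_mult_self _)).
  assert (Hp := proj1 (Cmod_gt_0 zeta) Hn). assert (H1 := Hzeta). unfold unit_disk in H1.
  destruct (disk_maximum F (fun v => Re (Cconj (F zeta) * v)) (Cconj (F zeta)) z (Cmod zeta) HF
    (Cconj_neq0 _ HFz) (has_gradient_linear _ _) ltac:(lra) Hz) as [Em [s [Hs' Es]]].
  { intros w Hw. rewrite E. now apply Hmax. }
  apply (starlike_map_circle_inj F _ z zeta _ _ HF) with (4 := conj_mult_self _) (3 := Es);
    try easy. unfold unit_disk. lra.
Qed.

Lemma image_in_support_region (F : C -> C) (r : R) (z : C) : starlike_map F ->
  (0 < r < 1)%R -> (Cmod z <= r)%R -> support_region F r (log_integral F z).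
Proof.
  intros HF Hr Hz zeta Ez.
  assert (Hzeta : unit_disk zeta) by (unfold unit_disk; lra).
  assert (Hn : zeta <> 0) by (apply Cmod_gt_0; lra).
  apply (disk_maximum_of_direction F _ zeta (Cmod (F zeta) ^ 2)); try easy.
  - now apply pow_lt, Cmod_gt_0, starlike_map_neq0.
  - apply conj_mult_self.
  - lra.
Qed.

(* The point of the image closest to [w] is [K z] with [|z| = r] and outward normal
   [F z], so [w] violates the half-plane condition at [z] unless [w = K z]. *)
Lemma support_region_in_image (F : C -> C) (r : R) (w : C) : starlike_map F ->
  (0 < r < 1)%R -> support_region F r w ->
  exists z, (Cmod z <= r)%R /\ log_integral F z = w.
Proof.
  intros HF Hr Hw.
  destruct (max_attained_ccont (fun z => (Cmod (z - 0) <= r)%R) (fun z => log_integral F z - w))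
    as [_ [_ [z [Hz Hmin]]]].
  - apply closed_disk_closed.
  - apply closed_disk_bounded.
  - exists 0. rewrite Cminus_diag, Cmod_0. lra.
  - intros z Hz. apply ccont_minus; [|apply ccont_const].
    apply log_integral_ccont; [now apply starlike_map_normalized|].
    unfold unit_disk. replace (z - 0) with z in Hz by ring. lra.
  - replace (z - 0) with z in Hz by ring. exists z. split; [easy|].
    apply NNPP. intros Hne. set (d := log_integral F z - w) in *.
    assert (Hd : d <> 0) by now apply Cminus_neq0.
    destruct (disk_maximum F (fun v => - Cmod (v - w) ^ 2 / 2)%R (- Cconj d) z r HF)
      as [Em [s [Hs Es]]].
    + intros E. apply (Cconj_neq0 d Hd).
      replace (Cconj d) with (- - Cconj d) by ring. rewrite E. ring.
    + apply has_gradient_distance.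
    + easy.
    + easy.
    + intros x Hx. specialize (Hmin x ltac:(now replace (x - 0) with x by ring)).
      fold d. assert (P := Cmod_ge_0 d).
      assert (Q : (Cmod d ^ 2 <= Cmod (log_integral F x - w) ^ 2)%R) by (apply pow_incr; lra).
      lra.
    (* The excess of [w] over the half-plane bound at [z] is exactly
       [Re (- conj d * F z) = s > 0]. *)
    + specialize (Hw z Em).
      assert (E : (Re (Cconj (F z) * w) - Re (Cconj (F z) * log_integral F z)
        = Re (- Cconj d * F z))%R).
      { unfold d. destruct (F z), (log_integral F z), w. simpl. ring. }
      rewrite Es in E. change (Re (RtoC s)) with s in E. lra.
Qed.

Lemma segment_Re (e u v w : C) : segment u v w -> exists t, (0 <= t <= 1)%R /\
  (Re (e * w) = (1 - t) * Re (e * u) + t * Re (e * v))%R.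
Proof.
  intros [t [Ht ->]]. exists t. split; [easy|]. destruct e, u, v. simpl. ring.
Qed.

Lemma support_region_convex (F : C -> C) (r : R) : convex_set (support_region F r).
Proof.
  intros u v Hu Hv w Hw zeta Ez. specialize (Hu zeta Ez). specialize (Hv zeta Ez).
  destruct (segment_Re (Cconj (F zeta)) u v w Hw) as [t [Ht ->]]. nra.
Qed.

(** Continuous induction from a point of [U] to a point of [V]: covering and disjointness make [U]
    persist at limits, so it reaches the point of [V]. *)
Lemma connected_ray (w v : C) :
  connected_set (fun z => exists s, (0 <= s)%R /\ z = w + RtoC s * v).
Proof.
  intros [U [V [HU [HV [Hcov [Hdis [[u [[a [Ha Eu]] Uu]] [x [[b [Hb Ex]] Vx]]]]]]]]].
  rewrite open_Cmod in HU, HV.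
  set (p := fun t : R => w + RtoC ((1 - t) * a + t * b) * v).
  assert (Hp : forall t, (0 <= t <= 1)%R -> exists s, (0 <= s)%R /\ p t = w + RtoC s * v).
  { intros t Ht. exists ((1 - t) * a + t * b)%R. split; [nra|easy]. }
  assert (Hdist : forall s t, Cmod (p s - p t) = (Rabs (s - t) * Cmod (RtoC (b - a) * v))%R).
  { intros s t. unfold p. rewrite <- Cmod_R, <- Cmod_mult. f_equal.
    rewrite !RtoC_minus, !RtoC_plus, !RtoC_mult, !RtoC_minus. ring. }
  set (k := Cmod (RtoC (b - a) * v)). assert (Hk : (0 <= k)%R) by apply Cmod_ge_0.
  assert (Hclose : forall d s t, (0 < d)%R -> (Rabs (s - t) <= d / (k + 1))%R ->
    (Cmod (p s - p t) < d)%R).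
  { intros d s t Hd Hst. rewrite Hdist. fold k.
    apply Rle_lt_trans with (d / (k + 1) * k)%R; [apply Rmult_le_compat_r; lra|].
    apply Rlt_le_trans with (d / (k + 1) * (k + 1))%R.
    - apply Rmult_lt_compat_l; [apply Rdiv_lt_0_compat|]; lra.
    - right. field. lra. }
  assert (H0 : p 0%R = u) by (rewrite Eu; unfold p; do 3 f_equal; ring).
  assert (H1 : p 1%R = x) by (rewrite Ex; unfold p; do 3 f_equal; ring).
  apply (Hdis (p 1%R)); [apply Hp; lra|]. split; [|now rewrite H1].
  apply (continuous_induction (fun t => U (p t))); [now rewrite H0| | |lra].
  - intros t Ht Hle. destruct (HU (p t)) as [d [Hd H]]; [apply Hle; lra|].
    exists (d / (k + 1))%R. split; [apply Rdiv_lt_0_compat; lra|].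
    intros s Hs. apply H, Hclose; [easy|]. rewrite Rabs_pos_eq; lra.
  - intros t Ht Hlt.
    destruct (Hcov (p t)) as [|Vt]; [apply Hp; lra|easy|exfalso].
    destruct (HV (p t) Vt) as [d [Hd H]].
    set (e := Rmin t (d / (k + 1))).
    assert (He : (0 < e)%R) by (apply Rmin_glb_lt; [lra|apply Rdiv_lt_0_compat; lra]).
    assert (He1 : (e <= t)%R) by apply Rmin_l.
    apply (Hdis (p (t - e)%R)); [apply Hp; lra|]. split; [apply Hlt; lra|].
    apply H, Hclose; [easy|]. replace (t - e - t)%R with (- e)%R by ring.
    rewrite Rabs_Ropp, Rabs_pos_eq by lra. apply Rmin_r.
Qed.

(** Equality would give [cos (y - x) = 1], but [1 - cos (y - x) = 2 sin^2 ((y - x) / 2)] is positive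
    on this range. *)
Lemma cexp_angle_lt (x y : R) : (0 <= x)%R -> (x < y)%R -> (y < 2 * PI)%R ->
  cexp (0%R, x) <> cexp (0%R, y).
Proof.
  intros Hx Hxy Hy E.
  assert (E1 : cexp (0%R, (y - x)%R) = 1).
  { replace ((0%R, (y - x)%R) : C) with ((0%R, y) + - (0%R, x))
      by (apply injective_projections; simpl; ring).
    rewrite cexp_plus, <- E, <- cexp_plus, <- cexp_0. f_equal. ring. }
  unfold cexp in E1. simpl in E1. rewrite exp_0 in E1.
  apply (f_equal fst) in E1. simpl in E1.
  replace (y - x)%R with (2 * ((y - x) / 2))%R in E1 by field.
  rewrite cos_2a_sin in E1.
  assert (H := sin_gt_0 ((y - x) / 2) ltac:(lra) ltac:(lra)). nra.
Qed.

Definition boundary_path (F : C -> C) (z0 : C) (t : R) : C :=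
  log_integral F (cexp (0%R, 2 * PI * t)%R * z0).

Lemma Cmod_rotate (x : R) (z : C) : Cmod (cexp (0%R, x) * z) = Cmod z.
Proof. rewrite Cmod_mult, Cmod_cexp. simpl. rewrite exp_0. ring. Qed.

Lemma boundary_path_range (F : C -> C) (z0 w : C) : z0 <> 0 ->
  (exists t, (0 <= t <= 1)%R /\ boundary_path F z0 t = w) <->
  (exists zeta, Cmod zeta = Cmod z0 /\ log_integral F zeta = w).
Proof.
  intros Hn. assert (HPI := PI_RGT_0). split.
  - intros [t [_ E]]. eexists. split; [|exact E]. apply Cmod_rotate.
  - intros [zeta [Em E]]. assert (Hp := proj1 (Cmod_gt_0 z0) Hn).
    destruct (unit_circle_cexp (zeta / z0)) as [x [Hx Ex]].
    { rewrite Cmod_div, Em by easy. field. lra. }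
    exists (x / (2 * PI))%R. split.
    + split; [apply Rdiv_le_0_compat; lra|].
      apply Rmult_le_reg_r with (2 * PI)%R; [lra|]. unfold Rdiv.
      rewrite Rmult_assoc, Rinv_l; lra.
    + unfold boundary_path. replace (2 * PI * (x / (2 * PI)))%R with x by (field; lra).
      rewrite <- Ex, <- E. f_equal. field. easy.
Qed.

Lemma boundary_path_jordan (F : C -> C) (z0 : C) : starlike_map F ->
  unit_disk z0 -> z0 <> 0 ->
  jordan_curve (fun w => exists zeta, Cmod zeta = Cmod z0 /\ log_integral F zeta = w).
Proof.
  intros HF Hz0 Hn. assert (HPI := PI_RGT_0).
  assert (HD : forall x, unit_disk (cexp (0%R, x) * z0)).
  { intros x. unfold unit_disk. now rewrite Cmod_rotate. }
  exists (boundary_path F z0). split; [|split; [|split]].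
  - intros t _. apply (filterlim_filter_le_1 (F := locally t)); [apply filter_le_within|].
    apply (continuous_ccont_comp (fun w => log_integral F (cexp w * z0))
      (fun t => (0%R, 2 * PI * t)%R)).
    + apply continuous_pair_fun; [apply continuous_const|].
      apply (ex_derive_continuous (K := R_AbsRing) (V := R_NormedModule) (fun t => 2 * PI * t)%R).
      auto_derive. easy.
    + apply (ccont_comp (log_integral F) (fun w => cexp w * z0)).
      * apply ccont_mult; [apply cdiff_ccont, cdiff_cexp|apply ccont_const].
      * apply log_integral_ccont, HD. now apply starlike_map_normalized.
  - unfold boundary_path. rewrite Rmult_0_r, Rmult_1_r. now rewrite cexp_period.
  - intros s t Hs Ht E.
    assert (E1 : cexp (0%R, 2 * PI * s)%R * z0 = cexp (0%R, 2 * PI * t)%R * z0).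
    { apply (log_integral_circle_unique F); [easy|apply HD| | |].
      - apply Cmod_gt_0. rewrite Cmod_rotate. now apply Cmod_gt_0.
      - rewrite !Cmod_rotate. lra.
      - do 2 f_equal. exact E. }
    assert (E2 : cexp (0%R, 2 * PI * s)%R = cexp (0%R, 2 * PI * t)%R).
    { replace (cexp (0%R, 2 * PI * s)%R) with (cexp (0%R, 2 * PI * s)%R * z0 / z0)
        by (field; easy). rewrite E1. field. easy. }
    destruct (Rtotal_order s t) as [H|[H|H]]; [exfalso|easy|exfalso].
    + apply (cexp_angle_lt (2 * PI * s) (2 * PI * t)); try easy; nra.
    + apply (cexp_angle_lt (2 * PI * t) (2 * PI * s)); try easy; nra.
  - intros w. symmetry. now apply boundary_path_range.
Qed.

Lemma support_region_complement_open (F : C -> C) (r : R) :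
  open (fun w => ~ support_region F r w).
Proof.
  apply open_Cmod. intros w Hw. apply not_all_ex_not in Hw as [zeta H].
  apply imply_to_and in H as [Ez H]. apply Rnot_le_lt in H.
  set (gap := (Re (Cconj (F zeta) * w) - Re (Cconj (F zeta) * log_integral F zeta))%R).
  exists (gap / (Cmod (F zeta) + 1))%R. assert (P := Cmod_ge_0 (F zeta)).
  assert (Hgap : (0 < gap)%R) by (unfold gap; lra).
  split; [apply Rdiv_lt_0_compat; lra|]. intros y Hy Hin. specialize (Hin zeta Ez).
  assert (B := re_le_Cmod (Cconj (F zeta) * (w - y))).
  rewrite Cmod_mult, Cmod_conj, Cmod_minus_sym in B.
  assert (E : Re (Cconj (F zeta) * (w - y))
    = (Re (Cconj (F zeta) * w) - Re (Cconj (F zeta) * y))%R).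
  { destruct (F zeta), w, y. simpl. ring. }
  rewrite E in B. assert (B' := Rle_trans _ _ _ (Rle_abs _) B).
  assert (T : (Cmod (F zeta) * Cmod (y - w) <= Cmod (F zeta) * (gap / (Cmod (F zeta) + 1)))%R)
    by (apply Rmult_le_compat_l; lra).
  assert (T' : (Cmod (F zeta) * (gap / (Cmod (F zeta) + 1)) < gap)%R).
  { apply Rlt_le_trans with ((Cmod (F zeta) + 1) * (gap / (Cmod (F zeta) + 1)))%R.
    - apply Rmult_lt_compat_r; [apply Rdiv_lt_0_compat|]; lra.
    - right. field. lra. }
  assert (Eg : gap = (Re (Cconj (F zeta) * w) - Re (Cconj (F zeta) * log_integral F zeta))%R)
    by easy.
  lra.
Qed.

(** By compactness the slack of [w] in the half-planes has a minimum [gap] over the circle. It is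
    positive, since slack 0 at [z1] would put [w] on the curve. Moving [w] to [y] changes each slack
    by at most [M * |y - w|]. *)
Lemma image_interior_open (F : C -> C) (r : R) : starlike_map F -> (0 < r < 1)%R ->
  open (fun w => support_region F r w /\
    ~ exists zeta, Cmod zeta = r /\ log_integral F zeta = w).
Proof.
  intros HF Hr. apply open_Cmod. intros w [Hin Hw].
  assert (HN := starlike_map_normalized F HF).
  assert (HD : forall zeta, Cmod zeta = r -> unit_disk zeta)
    by (intros zeta Ez; unfold unit_disk; lra).
  assert (Hne : exists zeta, Cmod (zeta - 0) = r).
  { exists (RtoC r). replace (RtoC r - 0) with (RtoC r) by ring.
    rewrite Cmod_R, Rabs_pos_eq; lra. }
  destruct (max_attained_ccont (fun zeta => Cmod (zeta - 0) = r)
    (fun zeta => Cconj (F zeta) * (w - log_integral F zeta)) (circle_closed 0 r)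
    (circle_bounded 0 r) Hne) as [[z1 [Ez1 Hmax]] _].
  { intros zeta Ez. replace (zeta - 0) with zeta in Ez by ring.
    apply ccont_mult; [now apply ccont_conj, cdiff_ccont, HN, HD|].
    apply ccont_minus; [apply ccont_const|]. now apply log_integral_ccont, HD. }
  destruct (max_attained_ccont (fun zeta => Cmod (zeta - 0) = r) F (circle_closed 0 r)
    (circle_bounded 0 r) Hne) as [_ [[z2 [Ez2 HM]] _]].
  { intros zeta Ez. replace (zeta - 0) with zeta in Ez by ring.
    now apply cdiff_ccont, HN, HD. }
  replace (z1 - 0) with z1 in Ez1 by ring. set (M := Cmod (F z2)) in *.
  assert (Esplit : forall zeta y, Re (Cconj (F zeta) * (y - log_integral F zeta))
    = (Re (Cconj (F zeta) * y) - Re (Cconj (F zeta) * log_integral F zeta))%R).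
  { intros zeta y. destruct (F zeta), y, (log_integral F zeta). simpl. ring. }
  set (gap := (- Re (Cconj (F z1) * (w - log_integral F z1)))%R).
  assert (Hgap : (0 < gap)%R).
  { unfold gap. rewrite Esplit. assert (Hle := Hin z1 Ez1).
    destruct Hle as [Hlt|Heq]; [lra|exfalso]. apply Hw.
    destruct (support_region_in_image F r w HF Hr Hin) as [z [Hz E]].
    assert (z = z1) as ->; [|now exists z1].
    apply (log_integral_circle_unique F); [easy|now apply HD|apply Cmod_gt_0; lra|lra|].
    now rewrite E. }
  assert (HM0 : (0 <= M)%R) by apply Cmod_ge_0.
  exists (gap / (M + 1))%R. split; [apply Rdiv_lt_0_compat; lra|]. intros y Hy.
  assert (Hstrict : forall zeta, Cmod zeta = r ->
    (Re (Cconj (F zeta) * y) < Re (Cconj (F zeta) * log_integral F zeta))%R).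
  { intros zeta Ez.
    assert (H1 := Hmax zeta ltac:(now replace (zeta - 0) with zeta by ring)).
    assert (H2 := HM zeta ltac:(now replace (zeta - 0) with zeta by ring)).
    rewrite Esplit in H1.
    assert (B := re_le_Cmod (Cconj (F zeta) * (y - w))).
    rewrite Cmod_mult, Cmod_conj in B.
    assert (E : Re (Cconj (F zeta) * (y - w))
      = (Re (Cconj (F zeta) * y) - Re (Cconj (F zeta) * w))%R).
    { destruct (F zeta), w, y. simpl. ring. }
    rewrite E in B. assert (B' := Rle_trans _ _ _ (Rle_abs _) B).
    assert (T : (Cmod (F zeta) * Cmod (y - w) <= M * (gap / (M + 1)))%R)
      by (apply Rmult_le_compat; try apply Cmod_ge_0; lra).
    assert (T' : (M * (gap / (M + 1)) < gap)%R).
    { apply Rlt_le_trans with ((M + 1) * (gap / (M + 1)))%R.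
      - apply Rmult_lt_compat_r; [apply Rdiv_lt_0_compat|]; lra.
      - right. field. lra. }
    assert (Eg : gap = (- Re (Cconj (F z1) * (w - log_integral F z1)))%R) by easy.
    lra. }
  split.
  - intros zeta Ez. left. now apply Hstrict.
  - intros [zeta [Ez E]]. specialize (Hstrict zeta Ez). rewrite E in Hstrict. lra.
Qed.

Lemma support_region_bounded (F : C -> C) (r : R) : starlike_map F -> (0 < r < 1)%R ->
  bounded_set (support_region F r).
Proof.
  intros HF Hr.
  destruct (max_attained_ccont (fun z => (Cmod (z - 0) <= r)%R) (log_integral F))
    as [_ [[z1 [_ HM]] _]].
  - apply closed_disk_closed.
  - apply closed_disk_bounded.
  - exists 0. rewrite Cminus_diag, Cmod_0. lra.
  - intros z Hz. apply log_integral_ccont; [now apply starlike_map_normalized|].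
    unfold unit_disk. replace (z - 0) with z in Hz by ring. lra.
  - exists (Cmod (log_integral F z1)). intros w Hw.
    destruct (support_region_in_image F r w HF Hr Hw) as [z [Hz <-]].
    apply HM. now replace (z - 0) with z by ring.
Qed.

(** Off the curve the plane splits into two disjoint open sets, the rest of the bounded region and
    its complement, so a component starting in the region stays there. From a point outside, a ray
    leads to infinity without meeting the curve. *)
Lemma support_region_jordan (F : C -> C) (z0 : C) : starlike_map F ->
  unit_disk z0 -> z0 <> 0 -> closed_jordan_domain (support_region F (Cmod z0)).
Proof.
  intros HF Hz0 Hn. set (r := Cmod z0).
  assert (Hr : (0 < r < 1)%R) by (split; [now apply Cmod_gt_0|exact Hz0]).
  set (J := fun w => exists zeta, Cmod zeta = r /\ log_integral F zeta = w).
  exists J. split; [now apply boundary_path_jordan|].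
  assert (HJ : forall w, J w -> support_region F r w).
  { intros w [zeta [Ez <-]]. apply image_in_support_region; [easy|easy|lra]. }
  intros w. split.
  - intros Hw. destruct (classic (J w)) as [HJw|HJw]; [now left|right].
    split; [easy|]. destruct (support_region_bounded F r HF Hr) as [M HM].
    exists M. intros y [B [Hconn [HB [Bw By]]]]. apply HM.
    apply NNPP. intros Hy. apply Hconn.
    exists (fun w => support_region F r w /\ ~ J w), (fun w => ~ support_region F r w).
    split; [now apply image_interior_open|].
    split; [apply support_region_complement_open|].
    split; [|split; [|split]].
    + intros z Bz. specialize (HB z Bz).
      destruct (classic (support_region F r z)); [left|right]; easy.
    + intros z _ [[H1 _] H2]. easy.
    + now exists w.
    + now exists y.
  - intros [HJw|[HJw [M HM]]]; [now apply HJ|].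
    apply NNPP. intros Hw. apply not_all_ex_not in Hw as [zeta H].
    apply imply_to_and in H as [Ez H]. apply Rnot_le_lt in H.
    assert (HFz : F zeta <> 0).
    { apply starlike_map_neq0; [easy|unfold unit_disk; lra|apply Cmod_gt_0; lra]. }
    assert (Hq := proj1 (Cmod_gt_0 _) HFz).
    (* Moving along the outer normal [F zeta] of a violated half-plane only increases the violation,
       and the curve lies in that half-plane. *)
    assert (Hray : forall s, (0 <= s)%R ->
      component (fun z => ~ J z) w (w + RtoC s * F zeta)).
    { intros s Hs. exists (fun z => exists s, (0 <= s)%R /\ z = w + RtoC s * F zeta).
      split; [apply connected_ray|]. split; [|split].
      - intros u [x [Hx ->]] HJu. specialize (HJ _ HJu zeta Ez).
        assert (E : Re (Cconj (F zeta) * (w + RtoC x * F zeta))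
          = (Re (Cconj (F zeta) * w) + x * Cmod (F zeta) ^ 2)%R).
        { rewrite Cmod2_alt. destruct (F zeta), w. simpl. ring. }
        rewrite E in HJ. assert (P : (0 <= x * Cmod (F zeta) ^ 2)%R) by nra. lra.
      - exists 0%R. split; [lra|]. ring.
      - now exists s. }
    (* So far along the ray the modulus is at least [|M| + 1], beyond the supposed bound. *)
    set (s := ((Rabs M + Cmod w + 1) / Cmod (F zeta))%R).
    assert (PM := Rabs_pos M). assert (Pw := Cmod_ge_0 w).
    assert (Hs : (0 <= s)%R) by (apply Rdiv_le_0_compat; lra).
    specialize (HM _ (Hray s Hs)).
    assert (T := Cmod_reverse_triangle (RtoC s * F zeta) (- w)).
    replace (RtoC s * F zeta - - w) with (w + RtoC s * F zeta) in T by ring.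
    rewrite Cmod_opp, Cmod_mult, Cmod_R, Rabs_pos_eq in T by easy.
    assert (Es : (s * Cmod (F zeta) = Rabs M + Cmod w + 1)%R) by (unfold s; field; lra).
    assert (PM' := Rle_abs M). lra.
Qed.

Lemma closed_jordan_domain_ext (A B : C -> Prop) :
  set_eq A B -> closed_jordan_domain B -> closed_jordan_domain A.
Proof.
  intros E [J [HJ H]]. exists J. split; [easy|]. intros w. rewrite (E w). apply H.
Qed.

Theorem theorem2p1 (b z0 : C) (Omega : C -> Prop) (P : C -> C)
  (Hz0 : unit_disk z0) (Hz0_neq0 : z0 <> 0)
  (HOmega_domain : domain Omega)
  (HOmega_proper : exists w : C, ~ Omega w)
  (HOmega_starlike : starlike Omega b)
  (HP : conformal_map_onto P Omega) (HP0 : P 0 = b) :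
  let V := variability_region Omega b z0 in
  let K := fun z : C => integral_quotient P b z in
  (convex_set V /\ closed_jordan_domain V) /\
  set_eq V (image K (closed_disk (Cmod z0))) /\
  (forall (eps : C) (g : C -> C),
     Cmod eps = 1%R -> analytic_into Omega g -> g 0 = b ->
     (integral_quotient g b z0 = K (eps * z0) <->
      forall z : C, unit_disk z -> g z = P (eps * z))).
Proof.
  intros V K. destruct HP as [HPd [HPinj HPonto]].
  rewrite analytic_on_disk_cdiff in HPd.
  set (F := fun z => P z - b).
  assert (HFP : forall z, P z = F z + b) by (intros z; unfold F; ring).
  assert (HF : starlike_map F).
  { split; [split|split].
    - intros z Hz. apply cdiff_minus; [now apply HPd|apply cdiff_const].
    - intros z w Hz Hw E. apply HPinj; try easy. rewrite !HFP. now rewrite E.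
    - unfold F. rewrite HP0. ring.
    - intros z t Hz Ht.
      assert (HO : Omega (b + RtoC t * F z)).
      { apply (proj2 HOmega_starlike (P z)); [apply HPonto; now exists z|].
        exists t. split; [easy|]. rewrite HFP, RtoC_minus. ring. }
      apply HPonto in HO as [w [Hw Ew]]. exists w. split; [easy|].
      unfold F at 1. rewrite Ew. ring. }
  assert (Hsub : forall g, analytic_into Omega g -> g 0 = b ->
    subordinate (fun z => g z - b) F).
  { intros g [Hg Hin] Hg0. rewrite analytic_on_disk_cdiff in Hg. split; [split|].
    - intros z Hz. apply cdiff_minus; [now apply Hg|apply cdiff_const].
    - rewrite Hg0. ring.
    - intros z Hz. destruct (proj2 (HPonto (g z)) (Hin z Hz)) as [w [Hw Ew]].
      exists w. split; [easy|]. unfold F. now rewrite Ew. }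
  set (r := Cmod z0).
  assert (Hr : (0 < r < 1)%R) by (split; [now apply Cmod_gt_0|exact Hz0]).
  assert (HVH : forall w, V w -> support_region F r w).
  { intros w [g [Hg [Hg0 ->]]] zeta Ez.
    exact (proj1 (support_inequality F (fun z => g z - b) z0 zeta HF (Hsub g Hg Hg0) Hz0 Hz0_neq0 Ez)). }
  assert (HKV : forall z, (Cmod z <= r)%R -> V (log_integral F z)).
  { intros z Hz. set (c := z / z0).
    assert (Hc : (Cmod c <= 1)%R).
    { unfold c. rewrite Cmod_div by easy. fold r.
      apply Rmult_le_reg_r with r; [lra|]. unfold Rdiv. rewrite Rmult_assoc, Rinv_l; lra. }
    assert (Hcz : forall w, unit_disk w -> unit_disk (c * w)).
    { intros w Hw. unfold unit_disk in *. rewrite Cmod_mult.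
      assert (Q := Cmod_ge_0 w). nra. }
    exists (fun w => P (c * w)). split; [split|split].
    - apply analytic_on_disk_cdiff. intros w Hw. apply cdiff_comp; [|now apply HPd, Hcz].
      apply cdiff_mult; [apply cdiff_const|apply cdiff_id].
    - intros w Hw. apply HPonto. exists (c * w). split; [now apply Hcz|easy].
    - now rewrite Cmult_0_r.
    - replace z with (c * z0) by (unfold c; field; easy).
      symmetry. apply (log_integral_dilation F c z0), HF. }
  assert (HVeq : set_eq V (support_region F r)).
  { intros w. split; [apply HVH|]. intros Hw.
    destruct (support_region_in_image F r w HF Hr Hw) as [z [Hz <-]]. now apply HKV. }
  split; [split|split].
  - intros u v Hu Hv w Hw. apply HVeq.
    apply (support_region_convex F r u v); [now apply HVH|now apply HVH|easy].
  - apply (closed_jordan_domain_ext _ _ HVeq). now apply support_region_jordan.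
  - intros w. split.
    + intros Hw. destruct (support_region_in_image F r w HF Hr (HVH w Hw)) as [z [Hz E]].
      now exists z.
    + intros [z [Hz <-]]. now apply HKV.
  - intros eps g Heps Hg Hg0. split.
    + intros E.
      assert (Em : Cmod (eps * z0) = Cmod z0) by (rewrite Cmod_mult, Heps; ring).
      destruct (support_inequality F (fun z => g z - b) z0 (eps * z0) HF (Hsub g Hg Hg0)
        Hz0 Hz0_neq0 Em) as [_ Heq].
      destruct Heq as [eps' [_ [E' HG]]].
      { do 2 f_equal. exact E. }
      assert (eps' = eps) as ->.
      { replace eps' with (eps' * z0 / z0) by (field; easy). rewrite <- E'. field. easy. }
      intros z Hz. rewrite HFP, <- HG by easy. ring.
    + intros E.
      transitivity (log_integral (fun z => F (eps * z)) z0).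
      * apply (log_integral_ext (fun z => g z - b)); [easy|].
        intros w Hw. rewrite E by easy. easy.
      * apply (log_integral_dilation F eps z0), HF.
Qed.
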